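(* Let $N\geq 4$ be an even integer and let $\alpha\geq\frac12$ with $\alpha\neq 1$. Then every axially symmetric solution $u=u(x)$ of $$\alpha(-1)^{\frac N2}\left[(1-x^2)^{\frac N2}u'\right]^{(N-1)}+(N-1)!-\frac{(N-1)!\sqrt{\pi}\,\Gamma(\frac N2)}{\Gamma(\frac{N+1}{2})\,\gamma}\,e^{Nu}=0,\qquad x\in(-1,1),$$ where $\gamma=\int_{-1}^{1}(1-x^2)^{\frac{N-2}{2}}e^{Nu}\,dx$, is a constant function.
   Context: Primes and superscripts $^{(m)}$ denote derivatives in $x$. A function $u$ on the unit sphere $\mathbb S^N\subset\mathbb R^{N+1}$ is axially symmetric if, up to a rotation, $u=u(x)$ depends only on the coordinate $x=x_1\in[-1,1]$. The displayed equation is the form taken, for axially symmetric functions, by $$\alpha P_Nu+(N-1)!\left(1-\frac{e^{Nu}}{\int_{\mathbb S^N}e^{Nu}dw}\right)=0\quad\text{on }\mathbb S^N,\qquad P_N=\prod_{k=0}^{\frac{N-2}{2}}\bigl(-\Delta+k(N-k-1)\bigr),$$ where $dw$ is the normalized surface measure ($\int_{\mathbb S^N}dw=1$) and $\Delta$ is the Laplace–Beltrami operator. A solution means an axially symmetric $u\in H^{N/2}(\mathbb S^N)$ solving this equation on the whole sphere; by elliptic regularity such $u$ is a smooth function on $\mathbb S^N$, so that $u(x)$ is smooth on the closed interval $[-1,1]$. *)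

(* Defs.v *)
From Stdlib Require Export Reals Factorial.
From Coquelicot Require Export Coquelicot.
Open Scope R_scope.

(* Euler's integral; the intended use is s > 0.  The integral is improper at
   both ends: [Rpower t (s - 1)] is meaningful for t > 0 only. *)
Definition Gamma (s : R) : R :=
  RInt_gen (fun t => Rpower t (s - 1) * exp (- t))
           (at_right 0) (Rbar_locally p_infty).

(* Smoothness on the closed interval [a, b] of a function whose values outside
   [a, b] are irrelevant: u is continuous on [a, b], and every derivative of u
   on (a, b) exists and extends continuously to [a, b]. *)
Definition smooth_on_closed (a b : R) (u : R -> R) : Prop :=
  continuous_on (fun x => a <= x <= b) u /\
  forall n : nat,
    (forall x, a < x < b -> ex_derive_n u n x) /\
    exists g : R -> R,
      continuous_on (fun x => a <= x <= b) g /\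
      (forall x, a < x < b -> g x = Derive_n u n x).

Definition gamma_mass (N : nat) (u : R -> R) : R :=
  RInt (fun x => (1 - x ^ 2) ^ ((N - 2) / 2)%nat * exp (INR N * u x)) (-1) 1.

(* N is meant to be even, so that the natural-number quotients N / 2 and
   (N - 2) / 2 are exact. *)
Definition axial_Q_equation (N : nat) (alpha : R) (u : R -> R) (x : R) : Prop :=
  alpha * (-1) ^ (N / 2)%nat
    * Derive_n (fun y => (1 - y ^ 2) ^ (N / 2)%nat * Derive u y) (N - 1) x
  + INR (fact (N - 1))
  - INR (fact (N - 1)) * sqrt PI * Gamma (INR N / 2)
      / (Gamma ((INR N + 1) / 2) * gamma_mass N u)
      * exp (INR N * u x)
  = 0.

(* A smooth axially symmetric function on the sphere S^N, written as a function
   of x = x_1, is smooth up to the poles x = -1 and x = 1; this is what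
   distinguishes solutions on the whole sphere from solutions of the ordinary
   differential equation that are singular at a pole. *)
Definition axial_solution (N : nat) (alpha : R) (u : R -> R) : Prop :=
  smooth_on_closed (-1) 1 u /\
  (forall x, -1 < x < 1 -> axial_Q_equation N alpha u x).

(* Main.v *)
(* Write N = 2n + 2, w = 1 - x^2, G = w u', v = w^n G, psi = v^(n), and let F be e^(Nu), normalised so
   that the equation reads F = 1 + c v^(2n+1).  Testing it against low degree polynomials gives the
   Kazdan-Warner identities: F is centred and v has mean zero when alpha <> 1.  Testing it against
   x v and (w v)' gives two identities for E0 = int psi^2 and E1 = int w psi'^2.

   The (2n+1)-st derivative has an explicit Green function, so that x - alpha G(x) is the average of
   phi((x - y) / (1 - x y)) against w^n F.  The profile phi solves a first order equation which shows
   that phi(T) >= T and phi' >= n / (n + 1).  The first bound, symmetrised in a double integral, yields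
   int w^n F x^2 <= (int w^n) / (N - 1); the second one then bounds alpha G' from above.

   Spectral gaps on the ladder from G to psi give E1 >= (n + 1)(n + 2) E0.  For N >= 8 a pointwise
   trace bound of v^2 by E0, inserted in the identity for E1, forces E0 = 0.  For N = 4 and N = 6 the
   cubic term int v^(2n+1) v G is rewritten as an integral of G' times a nonnegative quantity, to which
   the bound on G' applies; a second Poincare inequality, with a defect given by the first harmonic
   int x v, again forces E0 = 0.  Finally E0 = 0 means u' = 0. *)

Require Import Defs.
From Stdlib Require Import Reals Lra Lia Psatz FunctionalExtensionality.
From Coquelicot Require Import Coquelicot.
Open Scope R_scope.

(** Very little is known of F: it is positive, its mass and first moment against w^n are fixed, and
    its second moment m is only bounded. Each kernel bound is therefore replaced by a polynomial of
    degree at most 2 in the integration variable, so that only the mass W = int w^n and m enter. The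
    separation at N = 8 is numerical. With q = n - 1 the trace argument ends in 16 q^4 + 40 q^3 - 44
    q^2 - 146 q - 50 <= 0, false from q = 2 on but true at q = 0 and q = 1. In the two low cases the
    constants are the eigenvalues of degree 2. The first harmonic int x v is not zero, so its
    contribution has to be paid for: alpha >= 1/2 bounds it once by E0 and once by W, and the
    product of the two bounds is a small multiple of E0. The solution is first extended to a C^k
    function on the line, so that derivatives and boundary terms at the poles have their ordinary
    meaning. The normalising factor of e^(Nu) enters as a single number; integrating the equation
    against w^n shows that it is positive. *)

Lemma cp_const (c x : R) : continuity_pt (fun _ => c) x.
Proof. apply continuity_pt_filterlim, continuous_const. Qed.

Lemma cp_id (x : R) : continuity_pt (fun y => y) x.
Proof. apply continuity_pt_filterlim, continuous_id. Qed.

Lemma cp_plus (f g : R -> R) (x : R) :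
  continuity_pt f x -> continuity_pt g x -> continuity_pt (fun y => f y + g y) x.
Proof. intros; now apply (continuity_pt_plus f g). Qed.

Lemma cp_minus (f g : R -> R) (x : R) :
  continuity_pt f x -> continuity_pt g x -> continuity_pt (fun y => f y - g y) x.
Proof. intros; now apply (continuity_pt_minus f g). Qed.

Lemma cp_opp (f : R -> R) (x : R) :
  continuity_pt f x -> continuity_pt (fun y => - f y) x.
Proof. intros; now apply (continuity_pt_opp f). Qed.

Lemma cp_mult (f g : R -> R) (x : R) :
  continuity_pt f x -> continuity_pt g x -> continuity_pt (fun y => f y * g y) x.
Proof. intros; now apply (continuity_pt_mult f g). Qed.

Lemma cp_div (f g : R -> R) (x : R) :
  continuity_pt f x -> continuity_pt g x -> g x <> 0 ->
  continuity_pt (fun y => f y / g y) x.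
Proof. intros; now apply (continuity_pt_div f g). Qed.

Lemma cp_pow (f : R -> R) (n : nat) (x : R) :
  continuity_pt f x -> continuity_pt (fun y => f y ^ n) x.
Proof.
  intros H; induction n as [|n IH]; simpl.
  - apply cp_const.
  - now apply cp_mult.
Qed.

Lemma cp_comp (f g : R -> R) (x : R) :
  continuity_pt f x -> continuity_pt g (f x) -> continuity_pt (fun y => g (f y)) x.
Proof. intros; now apply (continuity_pt_comp f g). Qed.

Lemma cp_derive (f : R -> R) (x l : R) : is_derive f x l -> continuity_pt f x.
Proof.
  intros H; apply continuity_pt_filterlim.
  apply (ex_derive_continuous f); now exists l.
Qed.

(** * Integration over [[-1, 1]] *)

Definition RI (f : R -> R) (a b : R) : R := RInt f a b.

Definition Int (f : R -> R) : R := RI f (-1) 1.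

(** Continuity is two-sided even at -1 and 1: functions live on the whole line, and the endpoints
    need no separate notion. *)
Definition contI (f : R -> R) : Prop := forall x, -1 <= x <= 1 -> continuity_pt f x.

Ltac cnt :=
  repeat first
    [ assumption
    | match goal with
      | H : forall x : R, continuity_pt ?f x |- continuity_pt ?f _ => apply H
      | H : forall x : R, continuity_pt ?f x |- continuity_pt (fun y => ?f y) _ => apply H
      | H : forall x : R, -1 <= x <= 1 -> continuity_pt ?f x |- continuity_pt ?f _ =>
          apply H; solve [assumption | lra]
      | H : forall x : R, -1 <= x <= 1 -> continuity_pt ?f x
        |- continuity_pt (fun y => ?f y) _ => apply H; solve [assumption | lra]
      | H : contI ?f |- continuity_pt ?f _ => apply (H _); solve [assumption | lra]
      | H : contI ?f |- continuity_pt (fun y => ?f y) _ =>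
          apply (H _); solve [assumption | lra]
      end
    | lazymatch goal with
      | |- continuity_pt (fun _ => ?c) _ => apply (cp_const c)
      | |- continuity_pt (fun y => y) _ => apply cp_id
      | |- continuity_pt (fun y => @?f y ^ ?n) _ => apply (cp_pow f n)
      | |- continuity_pt (fun y => @?f y - @?g y) _ => apply (cp_minus f g)
      | |- continuity_pt (fun y => @?f y + @?g y) _ => apply (cp_plus f g)
      | |- continuity_pt (fun y => - @?f y) _ => apply (cp_opp f)
      | |- continuity_pt (fun y => @?f y * @?g y) _ => apply (cp_mult f g)
      end ].

Lemma ex_RInt_cont (f : R -> R) (a b : R) :
  a <= b -> (forall x, a <= x <= b -> continuity_pt f x) -> ex_RInt f a b.
Proof.
  intros Hab H; apply (ex_RInt_continuous (V := R_CompleteNormedModule)).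
  rewrite Rmin_left, Rmax_right by assumption.
  intros z Hz; now apply continuity_pt_filterlim, H.
Qed.

Lemma ex_Int (f : R -> R) : contI f -> ex_RInt f (-1) 1.
Proof. intros H; apply ex_RInt_cont; [lra | exact H]. Qed.

Lemma RI_plus (f g : R -> R) (a b : R) :
  ex_RInt f a b -> ex_RInt g a b -> RI (fun x => f x + g x) a b = RI f a b + RI g a b.
Proof. exact (RInt_plus (V := R_CompleteNormedModule) f g a b). Qed.

Lemma RI_scal (c : R) (f : R -> R) (a b : R) :
  ex_RInt f a b -> RI (fun x => c * f x) a b = c * RI f a b.
Proof. exact (RInt_scal (V := R_CompleteNormedModule) f a b c). Qed.

Lemma RI_Chasles (f : R -> R) (a b c : R) :
  ex_RInt f a b -> ex_RInt f b c -> RI f a b + RI f b c = RI f a c.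
Proof. exact (RInt_Chasles (V := R_CompleteNormedModule) f a b c). Qed.

Lemma RI_ext (f g : R -> R) (a b : R) :
  a <= b -> (forall x, a <= x <= b -> f x = g x) -> RI f a b = RI g a b.
Proof.
  intros Hab H; apply RInt_ext.
  rewrite Rmin_left, Rmax_right by lra; intros x Hx; apply H; lra.
Qed.

Lemma RI_point (f : R -> R) (a : R) : RI f a a = 0.
Proof. exact (RInt_point (V := R_CompleteNormedModule) a f). Qed.

Lemma Int_ext (f g : R -> R) :
  (forall x, -1 <= x <= 1 -> f x = g x) -> Int f = Int g.
Proof. apply RI_ext; lra. Qed.

Lemma Int_lin (a b : R) (f g : R -> R) :
  contI f -> contI g -> Int (fun x => a * f x + b * g x) = a * Int f + b * Int g.
Proof.
  intros Hf Hg; unfold Int.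
  rewrite RI_plus, 2!RI_scal; try reflexivity;
    apply ex_Int; try assumption; intros x Hx; cnt; auto.
Qed.

Lemma Int_scal (a : R) (f : R -> R) : contI f -> Int (fun x => a * f x) = a * Int f.
Proof. intros Hf; now apply RI_scal, ex_Int. Qed.

Lemma Int_plus (f g : R -> R) :
  contI f -> contI g -> Int (fun x => f x + g x) = Int f + Int g.
Proof.
  intros Hf Hg; rewrite <- (Rmult_1_l (Int f)), <- (Rmult_1_l (Int g)), <- Int_lin by assumption.
  apply Int_ext; intros; ring.
Qed.

Lemma Int_const (a : R) : Int (fun _ => a) = 2 * a.
Proof.
  unfold Int, RI; rewrite RInt_const; unfold scal; simpl; unfold mult; simpl; ring.
Qed.

Lemma Int_lin3 (a b c : R) (f g h : R -> R) :
  contI f -> contI g -> contI h ->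
  Int (fun x => a * f x + b * g x + c * h x) = a * Int f + b * Int g + c * Int h.
Proof.
  intros Hf Hg Hh.
  rewrite Int_plus, Int_lin, Int_scal by
    (try assumption; intros x Hx; cnt; auto); reflexivity.
Qed.

Lemma Int_lin4 (a b c d : R) (f g h k : R -> R) :
  contI f -> contI g -> contI h -> contI k ->
  Int (fun x => a * f x + b * g x + c * h x + d * k x)
  = a * Int f + b * Int g + c * Int h + d * Int k.
Proof.
  intros Hf Hg Hh Hk.
  rewrite Int_plus, Int_lin3, Int_scal by
    (try assumption; intros x Hx; cnt; auto); reflexivity.
Qed.

Lemma Int_le (f g : R -> R) :
  contI f -> contI g -> (forall x, -1 < x < 1 -> f x <= g x) -> Int f <= Int g.
Proof.
  intros Hf Hg H; apply RInt_le; try (now apply ex_Int); try lra; exact H.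
Qed.

Lemma Int_ge_0 (f : R -> R) :
  contI f -> (forall x, -1 < x < 1 -> 0 <= f x) -> 0 <= Int f.
Proof. intros Hf H; apply RInt_ge_0; [lra | now apply ex_Int | exact H]. Qed.

Lemma Int_gt_0 (f : R -> R) :
  contI f -> (forall x, -1 < x < 1 -> 0 < f x) -> 0 < Int f.
Proof.
  intros Hf H; apply RInt_gt_0; [lra | exact H |].
  intros x Hx; now apply continuity_pt_filterlim, Hf.
Qed.

Lemma RI_ftc (f g : R -> R) (a b : R) :
  a <= b -> (forall x, a <= x <= b -> is_derive f x (g x)) ->
  (forall x, a <= x <= b -> continuity_pt g x) -> RI g a b = f b - f a.
Proof.
  intros Hab Hd Hc; apply is_RInt_unique.
  apply (is_RInt_derive (V := R_CompleteNormedModule) f g);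
    rewrite Rmin_left, Rmax_right by assumption; [exact Hd |].
  intros x Hx; now apply continuity_pt_filterlim, Hc.
Qed.

Lemma Int_ftc (f g : R -> R) :
  (forall x, is_derive f x (g x)) -> contI g -> Int g = f 1 - f (-1).
Proof. intros Hd Hc; apply RI_ftc; [lra | intros; apply Hd | exact Hc]. Qed.

Lemma derive_RI (f : R -> R) (a x : R) :
  (forall y, continuity_pt f y) -> is_derive (fun y => RI f a y) x (f x).
Proof.
  intros H; apply (is_derive_RInt (V := R_NormedModule) f (fun y => RI f a y) a).
  - apply filter_forall; intros y; apply (RInt_correct (V := R_CompleteNormedModule)).
    apply (ex_RInt_continuous (V := R_CompleteNormedModule)).
    intros z _; apply continuity_pt_filterlim, H.
  - apply continuity_pt_filterlim, H.
Qed.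

(** Retraction of the line onto [-1, 1]. Composition with it extends a function continuous on the
    interval to one continuous everywhere, as [derive_RI] requires. *)
Definition clamp (x : R) : R := Rmax (-1) (Rmin 1 x).

Lemma clamp_in (x : R) : -1 <= clamp x <= 1.
Proof.
  unfold clamp; split; [apply Rmax_l |].
  apply Rmax_lub; [lra | apply Rmin_l].
Qed.

Lemma clamp_id (x : R) : -1 <= x <= 1 -> clamp x = x.
Proof. intros H; unfold clamp; rewrite Rmin_right, Rmax_right; lra. Qed.

Lemma clamp_lip (x y : R) : Rabs (clamp x - clamp y) <= Rabs (x - y).
Proof.
  unfold clamp, Rmax, Rmin.
  repeat destruct Rle_dec; unfold Rabs; repeat destruct Rcase_abs; lra.
Qed.

Lemma cp_clamp (x : R) : continuity_pt clamp x.
Proof.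
  intros eps Heps; exists eps; split; [exact Heps |].
  intros y [_ Hy]; simpl in *; unfold Rdist in *.
  eapply Rle_lt_trans; [apply clamp_lip | exact Hy].
Qed.

(** The derivative [d] may contain quotients by [w] and is never integrated. The mean value theorem
    is applied to the primitive of [r] plus [p], for which continuity at the endpoints is enough. *)
Lemma Int_plus_incr (r p d : R -> R) :
  contI r -> contI p -> (forall x, -1 < x < 1 -> is_derive p x (d x)) ->
  (forall x, -1 < x < 1 -> 0 <= r x + d x) -> 0 <= Int r + p 1 - p (-1).
Proof.
  intros Hr Hp Hd Hpos.
  set (rc := fun x => r (clamp x)).
  assert (Hrc : forall x, continuity_pt rc x).
  { intros x; apply (cp_comp clamp r); [apply cp_clamp |].
    apply Hr, clamp_in. }
  assert (HI : Int r = RI rc (-1) 1).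
  { apply Int_ext; intros x Hx; unfold rc; now rewrite clamp_id. }
  set (f := fun x => RI rc (-1) x + p x).
  (* [MVT_gen] only places its point in the closed interval; the value 0 at the endpoints keeps [df]
     nonnegative there. *)
  set (df := fun x => if Rlt_dec (-1) x then if Rlt_dec x 1 then r x + d x else 0 else 0).
  destruct (MVT_gen f (-1) 1 df) as [c [_ Hc]].
  - rewrite Rmin_left, Rmax_right by lra; intros x Hx.
    unfold df; destruct Rlt_dec; [| lra]; destruct Rlt_dec; [| lra].
    replace (r x) with (rc x) by (unfold rc; rewrite clamp_id; lra).
    apply (is_derive_plus (V := R_NormedModule)); [apply derive_RI; exact Hrc | now apply Hd].
  - rewrite Rmin_left, Rmax_right by lra; intros x Hx.
    apply cp_plus; [| now apply Hp].
    eapply cp_derive; apply derive_RI; assumption.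
  - unfold f in Hc; rewrite <- HI, RI_point in Hc.
    assert (0 <= df c).
    { unfold df; repeat destruct Rlt_dec; try lra; now apply Hpos. }
    nra.
Qed.

Lemma Int_zero (f : R -> R) :
  contI f -> (forall x, -1 < x < 1 -> 0 <= f x) -> Int f = 0 ->
  forall x, -1 < x < 1 -> f x = 0.
Proof.
  intros Hc Hpos H0 x Hx.
  set (fc := fun y => f (clamp y)).
  assert (Hfc : forall y, continuity_pt fc y).
  { intros y; apply (cp_comp clamp f); [apply cp_clamp | apply Hc, clamp_in]. }
  set (P := fun y => RI fc (-1) y).
  assert (HP : forall y, is_derive P y (fc y)) by (intros; apply derive_RI; assumption).
  assert (Hex : forall a b, ex_RInt fc a b).
  { intros a b; apply (ex_RInt_continuous (V := R_CompleteNormedModule)).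
    intros z _; apply continuity_pt_filterlim, Hfc. }
  assert (Hp0 : forall a b, -1 <= a -> a <= b -> b <= 1 -> 0 <= RI fc a b).
  { intros a b Ha Hab Hb; apply RInt_ge_0; [lra | apply Hex |].
    intros y Hy; unfold fc; rewrite clamp_id by lra; apply Hpos; lra. }
  assert (Hz : forall y, -1 <= y <= 1 -> P y = 0).
  { intros y Hy.
    assert (P y + RI fc y 1 = 0).
    { unfold P.
      rewrite RI_Chasles by apply Hex.
      rewrite <- H0; apply Int_ext; intros z Hz; unfold fc; now rewrite clamp_id. }
    pose proof (Hp0 y 1 ltac:(lra) ltac:(lra) ltac:(lra)).
    pose proof (Hp0 (-1) y ltac:(lra) ltac:(lra) ltac:(lra)).
    unfold P in *; lra. }
  assert (Hd0 : is_derive P x 0).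
  { apply (is_derive_ext_loc (V := R_NormedModule) (fun _ => 0)).
    - assert (He : 0 < Rmin (x + 1) (1 - x)) by (apply Rmin_case; lra).
      exists (mkposreal _ He); intros y Hy; symmetry; apply Hz.
      unfold ball in Hy; simpl in Hy; unfold AbsRing_ball, abs, minus, plus, opp in Hy; simpl in Hy.
      apply Rabs_def2 in Hy.
      pose proof (Rmin_l (x + 1) (1 - x)); pose proof (Rmin_r (x + 1) (1 - x)); lra.
    - auto_derive; auto. }
  pose proof (is_derive_unique _ _ _ (HP x)) as H1.
  rewrite (is_derive_unique _ _ _ Hd0) in H1.
  unfold fc in H1; rewrite clamp_id in H1; lra.
Qed.

(** * Functions of class C^k and repeated integration by parts *)

Fixpoint Ck (k : nat) (f : R -> R) : Prop :=
  match k with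
  | O => forall x, continuity_pt f x
  | S k' => (forall x, ex_derive f x) /\ Ck k' (Derive f)
  end.

Lemma Ck_cont (k : nat) (f : R -> R) : Ck k f -> forall x, continuity_pt f x.
Proof.
  destruct k as [|k]; [easy |]; intros [H _] x.
  eapply cp_derive; now apply Derive_correct.
Qed.

Lemma Ck_pred (k : nat) : forall f, Ck (S k) f -> Ck k f.
Proof.
  induction k as [|k IH]; intros f H.
  - exact (Ck_cont 1 f H).
  - destruct H as [H1 H2]; split; [exact H1 | now apply IH].
Qed.

Lemma Ck_le (j k : nat) (f : R -> R) : (j <= k)%nat -> Ck k f -> Ck j f.
Proof.
  induction 1 as [|k Hk IH]; [easy |]; intros H; now apply IH, Ck_pred.
Qed.

Lemma Ck_Derive (k : nat) (f : R -> R) : Ck (S k) f -> Ck k (Derive f).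
Proof. now intros [_ H]. Qed.

Lemma Derive_n_S_comm (f : R -> R) (n : nat) : Derive_n (Derive f) n = Derive_n f (S n).
Proof.
  apply functional_extensionality; intros x.
  rewrite <- (Nat.add_1_r n); exact (Derive_n_comp f n 1 x).
Qed.

Lemma Ck_Derive_n (j : nat) : forall k f, Ck (j + k) f -> Ck k (Derive_n f j).
Proof.
  induction j as [|j IH]; intros k f H; [exact H |].
  rewrite <- Derive_n_S_comm; apply IH; now apply Ck_Derive.
Qed.

Lemma Ck_cont_n (k j : nat) (f : R -> R) :
  Ck k f -> (j <= k)%nat -> forall x, continuity_pt (Derive_n f j) x.
Proof.
  intros H Hj; apply (Ck_cont (k - j)), Ck_Derive_n.
  now replace (j + (k - j))%nat with k by lia.
Qed.

Lemma Ck_is_derive (k j : nat) (f : R -> R) :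
  Ck k f -> (j < k)%nat ->
  forall x, is_derive (Derive_n f j) x (Derive_n f (S j) x).
Proof.
  intros H Hj x; apply Derive_correct.
  assert (H1 : Ck (S (k - S j)) (Derive_n f j)).
  { apply Ck_Derive_n; now replace (j + S (k - S j))%nat with k by lia. }
  now destruct H1 as [H1 _].
Qed.

Lemma Ck_is_derive_pred (k j : nat) (f : R -> R) :
  Ck k f -> (1 <= j <= k)%nat ->
  forall x, is_derive (Derive_n f (pred j)) x (Derive_n f j x).
Proof.
  destruct j as [|j]; [lia |]; intros H Hj.
  apply (Ck_is_derive k); [assumption | lia].
Qed.

Lemma Ck_const (c : R) (k : nat) : Ck k (fun _ => c).
Proof.
  revert c; induction k as [|k IH]; intros c.
  - intros x; apply cp_const.
  - split; [intros x; apply ex_derive_const |].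
    replace (Derive (fun _ => c)) with (fun _ : R => 0); [apply IH |].
    apply functional_extensionality; intros x; now rewrite Derive_const.
Qed.

Lemma Ck_id (k : nat) : Ck k (fun x => x).
Proof.
  destruct k as [|k]; [intros x; apply cp_id |].
  split; [intros x; apply ex_derive_id |].
  replace (Derive (fun x => x)) with (fun _ : R => 1); [apply Ck_const |].
  apply functional_extensionality; intros x; now rewrite Derive_id.
Qed.

Lemma Ck_plus (k : nat) : forall f g, Ck k f -> Ck k g -> Ck k (fun x => f x + g x).
Proof.
  induction k as [|k IH]; intros f g Hf Hg.
  - intros x; apply cp_plus; auto.
  - destruct Hf as [Hf1 Hf2], Hg as [Hg1 Hg2]; split.
    + intros x; now apply (ex_derive_plus (V := R_NormedModule) f g).
    + replace (Derive (fun x => f x + g x)) with (fun x => Derive f x + Derive g x);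
        [now apply IH |].
      apply functional_extensionality; intros x; now rewrite Derive_plus.
Qed.

Lemma Ck_mult (k : nat) : forall f g, Ck k f -> Ck k g -> Ck k (fun x => f x * g x).
Proof.
  induction k as [|k IH]; intros f g Hf Hg.
  - intros x; apply cp_mult; auto.
  - pose proof (Ck_pred _ _ Hf) as Hf'; pose proof (Ck_pred _ _ Hg) as Hg'.
    destruct Hf as [Hf1 Hf2], Hg as [Hg1 Hg2]; split.
    + intros x; now apply ex_derive_mult.
    + replace (Derive (fun x => f x * g x))
        with (fun x => Derive f x * g x + f x * Derive g x);
        [apply Ck_plus; now apply IH |].
      apply functional_extensionality; intros x; now rewrite Derive_mult.
Qed.

Lemma Ck_minus (k : nat) (f g : R -> R) : Ck k f -> Ck k g -> Ck k (fun x => f x - g x).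
Proof.
  intros Hf Hg.
  replace (fun x => f x - g x) with (fun x => f x + -1 * g x)
    by (apply functional_extensionality; intros; ring).
  apply Ck_plus; [exact Hf |].
  apply (Ck_mult k (fun _ => -1)); [apply Ck_const | exact Hg].
Qed.

Lemma Ck_pow (k n : nat) (f : R -> R) : Ck k f -> Ck k (fun x => f x ^ n).
Proof.
  intros H; induction n as [|n IH]; simpl; [apply Ck_const |].
  now apply Ck_mult.
Qed.

Lemma Ck_sum (k n : nat) (f : nat -> R -> R) :
  (forall j, Ck k (f j)) -> Ck k (fun x => sum_f_R0 (fun j => f j x) n).
Proof.
  intros H; induction n as [|n IH]; simpl; [apply H |].
  now apply Ck_plus.
Qed.

Ltac ck :=
  repeat first
    [ assumption
    | lazymatch goal with
      | |- Ck _ (fun _ => ?c) => apply (Ck_const c)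
      | |- Ck _ (fun y => y) => apply Ck_id
      | |- Ck _ (fun y => @?f y ^ ?n) => apply (Ck_pow _ n f)
      | |- Ck _ (fun y => @?f y - @?g y) => apply (Ck_minus _ f g)
      | |- Ck _ (fun y => @?f y + @?g y) => apply (Ck_plus _ f g)
      | |- Ck _ (fun y => @?f y * @?g y) => apply (Ck_mult _ f g)
      | |- Ck _ (fun y => sum_f_R0 _ _) => apply Ck_sum; intros
      end ].

Ltac rd H :=
  match type of H with
  | is_derive ?f ?x ?l =>
      first
        [ replace (Derive (fun y => f y) x) with l
            by (symmetry; exact (is_derive_unique _ _ _ H))
        | replace (Derive f x) with l by (symmetry; exact (is_derive_unique _ _ _ H)) ]
  end.

Lemma D_mult (f g : R -> R) (x f' g' : R) :
  is_derive f x f' -> is_derive g x g' ->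
  is_derive (fun y => f y * g y) x (f' * g x + f x * g').
Proof. intros; now apply (is_derive_mult f g x f' g'); [| | intros; apply Rmult_comm]. Qed.

Lemma D_plus (f g : R -> R) (x f' g' : R) :
  is_derive f x f' -> is_derive g x g' -> is_derive (fun y => f y + g y) x (f' + g').
Proof. intros; now apply (is_derive_plus (V := R_NormedModule) f g). Qed.

Lemma D_minus (f g : R -> R) (x f' g' : R) :
  is_derive f x f' -> is_derive g x g' -> is_derive (fun y => f y - g y) x (f' - g').
Proof. intros; now apply (is_derive_minus (V := R_NormedModule) f g). Qed.

Lemma D_opp (f : R -> R) (x f' : R) : is_derive f x f' -> is_derive (fun y => - f y) x (- f').
Proof. intros; now apply (is_derive_opp (V := R_NormedModule) f). Qed.

Lemma D_pow (f : R -> R) (k : nat) (x f' : R) :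
  is_derive f x f' -> is_derive (fun y => f y ^ k) x (INR k * f' * f x ^ pred k).
Proof. intros; now apply is_derive_pow. Qed.

Lemma D_const (c x : R) : is_derive (fun _ => c) x 0.
Proof. apply (is_derive_const (V := R_NormedModule)). Qed.

Lemma D_id (x : R) : is_derive (fun y => y) x 1.
Proof. apply (is_derive_id (K := R_AbsRing)). Qed.

Lemma is_derive_linmul (c d e : R) (f g : R -> R) (x f' g' : R) :
  is_derive f x f' -> is_derive g x g' ->
  is_derive (fun y => (c + d * y) * f y + e * g y) x
    (d * f x + (c + d * x) * f' + e * g').
Proof.
  intros Hf Hg; auto_derive; [repeat split; eexists; first [apply Hf | apply Hg] |].
  rd Hf; rd Hg; ring.
Qed.

(** Leibniz rule with an affine factor: two terms survive. At k = 0 the index [pred 0] does no harm,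
    its coefficient being [INR 0]. *)
Lemma Derive_n_linmul (c d : R) (f : R -> R) (k : nat) :
  Ck k f -> forall x,
  Derive_n (fun y => (c + d * y) * f y) k x
  = (c + d * x) * Derive_n f k x + INR k * d * Derive_n f (pred k) x.
Proof.
  induction k as [|k IH]; intros Hf x; [simpl; ring |].
  pose proof (Ck_pred _ _ Hf) as Hf'.
  change (Derive (Derive_n (fun y => (c + d * y) * f y) k) x
          = (c + d * x) * Derive_n f (S k) x + INR (S k) * d * Derive_n f k x).
  apply is_derive_unique.
  apply (is_derive_ext
           (fun x => (c + d * x) * Derive_n f k x + INR k * d * Derive_n f (pred k) x));
    [intros t; symmetry; now apply IH |].
  pose proof (Ck_is_derive (S k) k f Hf ltac:(lia) x) as D1.
  destruct k as [|k].
  - apply (is_derive_ext (fun y => (c + d * y) * f y + 0 * f y));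
      [intros t; simpl; ring |].
    evar_last; [apply is_derive_linmul; exact D1 | simpl; ring].
  - pose proof (Ck_is_derive (S (S k)) k f Hf ltac:(lia) x) as D2.
    evar_last; [apply is_derive_linmul; [exact D1 | exact D2] |].
    rewrite (S_INR (S k)); simpl pred; ring.
Qed.

(** * The weight, its powers, and repeated integration by parts *)

Definition w (x : R) : R := 1 - x ^ 2.

Lemma Ck_w (k : nat) : Ck k w.
Proof. unfold w; ck. Qed.

Ltac ckw := repeat (ck; try apply Ck_w).

Lemma cp_w (x : R) : continuity_pt w x.
Proof. apply (Ck_cont 0), Ck_w. Qed.

Ltac cntw := repeat (cnt; try apply cp_w).

Lemma is_derive_w (x : R) : is_derive w x (- 2 * x).
Proof. unfold w; auto_derive; [exact I | ring]. Qed.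

Lemma is_derive_wpow (k : nat) (x : R) :
  is_derive (fun y => w y ^ k) x (- 2 * INR k * x * w x ^ pred k).
Proof.
  evar_last; [apply (is_derive_pow w k x (- 2 * x)), is_derive_w | ring].
Qed.

Ltac deriv :=
  first
    [ match goal with
      | H : forall x, is_derive ?f x _ |- is_derive ?f _ _ => apply H
      | H : forall x, is_derive ?f x _ |- is_derive (fun y => ?f y) _ _ => apply H
      | H : forall x, _ -> is_derive ?f x _ |- is_derive ?f _ _ => now apply H
      | H : forall x, _ -> is_derive ?f x _ |- is_derive (fun y => ?f y) _ _ => now apply H
      end
    | lazymatch goal with
      | |- is_derive (fun _ => ?c) _ _ => apply (D_const c)
      | |- is_derive (fun y => y) _ _ => apply D_id
      | |- is_derive w _ _ => apply is_derive_w
      | |- is_derive (fun y => w y) _ _ => apply is_derive_w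
      | |- is_derive (fun y => w y ^ ?k) _ _ => apply is_derive_wpow
      | |- is_derive (fun y => @?f y ^ ?k) _ _ => apply (D_pow f k); deriv
      | |- is_derive (fun y => @?f y + @?g y) _ _ => apply (D_plus f g); deriv
      | |- is_derive (fun y => @?f y - @?g y) _ _ => apply (D_minus f g); deriv
      | |- is_derive (fun y => - @?f y) _ _ => apply (D_opp f); deriv
      | |- is_derive (fun y => @?f y * @?g y) _ _ => apply (D_mult f g); deriv
      end ].

Lemma w_pos (x : R) : -1 < x < 1 -> 0 < w x.
Proof. unfold w; intros; nra. Qed.

Lemma w_nonneg (x : R) : -1 <= x <= 1 -> 0 <= w x.
Proof. unfold w; intros; nra. Qed.

Lemma Derive_n_wmul (f : R -> R) (k : nat) :
  Ck k f -> forall x,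
  Derive_n (fun y => w y * f y) k x
  = w x * Derive_n f k x - 2 * INR k * x * Derive_n f (pred k) x
    - INR k * (INR k - 1) * Derive_n f (pred (pred k)) x.
Proof.
  intros Hf x.
  (* The weight is split into two affine factors, so that the affine Leibniz rule applies twice. *)
  replace (fun y => w y * f y) with (fun y => (1 + -1 * y) * ((1 + 1 * y) * f y))
    by (apply functional_extensionality; intros; unfold w; ring).
  rewrite Derive_n_linmul by ck.
  rewrite Derive_n_linmul by ck.
  destruct k as [|k]; [simpl; unfold w; ring |].
  rewrite Derive_n_linmul by (simpl; now apply Ck_pred).
  rewrite !S_INR; simpl pred; unfold w; ring.
Qed.

Lemma Derive_n_wpow_vanish (n k : nat) : forall (f : R -> R) (a : R),
  Ck k f -> w a = 0 -> (k < n)%nat -> Derive_n (fun y => w y ^ n * f y) k a = 0.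
Proof.
  revert k; induction n as [|n IH]; intros k f a Hf Ha Hk; [lia |].
  replace (fun y => w y ^ S n * f y) with (fun y => w y * (w y ^ n * f y))
    by (apply functional_extensionality; intros; simpl; ring).
  assert (Hg : Ck k (fun y => w y ^ n * f y)) by ckw.
  rewrite Derive_n_wmul, Ha by exact Hg.
  destruct k as [|k]; [simpl; ring |].
  rewrite (IH (pred (S k))) by (try assumption; simpl; try lia; now apply Ck_pred).
  destruct k as [|k]; [simpl; ring |].
  rewrite (IH (pred (pred (S (S k))))) by (try assumption; simpl; try lia; now do 2 apply Ck_pred).
  ring.
Qed.

Lemma w_1 : w 1 = 0. Proof. unfold w; ring. Qed.
Lemma w_m1 : w (-1) = 0. Proof. unfold w; ring. Qed.

(** Boundary term of k + 1 integrations by parts: the sum over i <= k of (-1)^i f^(k-i) g^(i). *)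
Fixpoint bdry (k : nat) (f g : R -> R) (x : R) : R :=
  match k with
  | O => f x * g x
  | S k' => Derive_n f (S k') x * g x - bdry k' f (Derive g) x
  end.

Lemma parts1 (f g : R -> R) (a b : R) :
  a <= b -> Ck 1 f -> Ck 1 g ->
  RI (fun x => Derive f x * g x) a b
  = f b * g b - f a * g a - RI (fun x => f x * Derive g x) a b.
Proof.
  intros Hab Hf Hg.
  pose proof (Ck_cont _ _ Hf) as Cf; pose proof (Ck_cont _ _ Hg) as Cg.
  pose proof (Ck_is_derive 1 0 f Hf ltac:(lia)) as Df.
  pose proof (Ck_is_derive 1 0 g Hg ltac:(lia)) as Dg.
  destruct Hf as [Hf1 Hf2], Hg as [Hg1 Hg2]; simpl in Hf2, Hg2.
  assert (E1 : ex_RInt (fun x => Derive f x * g x) a b)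
    by (apply ex_RInt_cont; [assumption | intros; cnt]).
  assert (E2 : ex_RInt (fun x => f x * Derive g x) a b)
    by (apply ex_RInt_cont; [assumption | intros; cnt]).
  rewrite <- (RI_ftc (fun x => f x * g x)
                (fun x => Derive f x * g x + f x * Derive g x) a b Hab).
  - rewrite RI_plus by assumption; ring.
  - intros x _; apply D_mult; [apply Df | apply Dg].
  - intros; cnt.
Qed.

Lemma parts (k : nat) : forall (f g : R -> R) (a b : R),
  a <= b -> Ck (S k) f -> Ck (S k) g ->
  RI (fun x => Derive_n f (S k) x * g x) a b
  = bdry k f g b - bdry k f g a
    + (-1) ^ (S k) * RI (fun x => f x * Derive_n g (S k) x) a b.
Proof.
  induction k as [|k IH]; intros f g a b Hab Hf Hg.
  - change (Derive_n f 1) with (Derive f); change (Derive_n g 1) with (Derive g).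
    rewrite parts1 by assumption; cbn [bdry]; ring.
  - change (Derive_n f (S (S k))) with (Derive (Derive_n f (S k))).
    rewrite parts1; [| assumption | | now apply (Ck_le 1 (S (S k))); [lia |]].
    2:{ apply Ck_Derive_n; now replace (S k + 1)%nat with (S (S k)) by lia. }
    rewrite IH; [| assumption | now apply Ck_pred | now apply Ck_Derive].
    rewrite Derive_n_S_comm.
    cbn [bdry]; rewrite <- (tech_pow_Rmult (-1) (S k)); ring.
Qed.

(** Meant for points where the vanishing orders of the two functions leave only one of the k + 1
    products. *)
Lemma bdry_single (k : nat) : forall (i0 : nat) (f g : R -> R) (x : R),
  (i0 <= k)%nat ->
  (forall i, (i <= k)%nat -> i <> i0 -> Derive_n f (k - i) x * Derive_n g i x = 0) ->
  bdry k f g x = (-1) ^ i0 * (Derive_n f (k - i0) x * Derive_n g i0 x).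
Proof.
  induction k as [|k IH]; intros i0 f g x Hi H.
  - replace i0 with 0%nat by lia; simpl; ring.
  - cbn [bdry]; destruct i0 as [|i0].
    + rewrite (IH 0%nat f (Derive g) x); [| lia |].
      * rewrite (Derive_n_S_comm g 0).
        pose proof (H 1%nat ltac:(lia) ltac:(lia)) as H1.
        replace (S k - 1)%nat with k in H1 by lia.
        rewrite !Nat.sub_0_r, H1; simpl; ring.
      * intros i Hk Hne; rewrite Derive_n_S_comm.
        exact (H (S i) ltac:(lia) ltac:(lia)).
    + rewrite (IH i0 f (Derive g) x); [| lia |].
      * pose proof (H 0%nat ltac:(lia) ltac:(lia)) as H0.
        rewrite Nat.sub_0_r in H0; rewrite Derive_n_S_comm.
        change (Derive_n g 0 x) with (g x) in H0.
        replace (S k - S i0)%nat with (k - i0)%nat by lia.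
        rewrite H0; simpl pow; ring.
      * intros i Hk Hne; rewrite Derive_n_S_comm.
        exact (H (S i) ltac:(lia) ltac:(lia)).
Qed.

Lemma bdry_zero (k : nat) (f g : R -> R) (x : R) :
  (forall i, (i <= k)%nat -> Derive_n f (k - i) x * Derive_n g i x = 0) ->
  bdry k f g x = 0.
Proof.
  intros H; rewrite (bdry_single k 0) by (intros; try lia; now apply H).
  rewrite H by lia; ring.
Qed.

Lemma Int_parts (k : nat) (f g : R -> R) :
  Ck (S k) f -> Ck (S k) g ->
  (forall i a, (i <= k)%nat -> w a = 0 -> Derive_n f (k - i) a * Derive_n g i a = 0) ->
  Int (fun x => Derive_n f (S k) x * g x)
  = (-1) ^ (S k) * Int (fun x => f x * Derive_n g (S k) x).
Proof.
  intros Hf Hg H; unfold Int; rewrite parts by (assumption || lra).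
  rewrite !bdry_zero by (intros; apply H; [assumption | first [apply w_1 | apply w_m1]]).
  ring.
Qed.

(** An even polynomial of degree 2n + 2 becomes a multiple of x after 2n + 1 derivatives. In the
    induction a further factor [w] only brings in the derivatives of orders 2n + 1, 2n + 2 and 2n +
    3 of the previous power. *)
Lemma Derive_n_wpow (n : nat) : forall x,
  Derive_n (fun y => w y ^ S n) (2 * n + 1) x = (-1) ^ S n * INR (fact (2 * n + 2)) * x.
Proof.
  induction n as [|n IH]; intros x.
  - simpl. apply is_derive_unique; unfold w; auto_derive; [exact I | ring].
  - set (f := fun y => w y ^ S n); set (c := (-1) ^ S n * INR (fact (2 * n + 2))) in *.
    assert (Hf : forall k, Ck k f) by (intros k; unfold f; ckw).
    assert (E1 : forall y, Derive_n f (2 * n + 2) y = c).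
    { intros y; replace (2 * n + 2)%nat with (S (2 * n + 1)) by lia.
      apply is_derive_unique.
      apply (is_derive_ext (fun y => c * y)); [intros t; symmetry; apply IH |].
      auto_derive; [exact I | ring]. }
    assert (E2 : forall y, Derive_n f (2 * n + 3) y = 0).
    { intros y; replace (2 * n + 3)%nat with (S (2 * n + 2)) by lia.
      apply is_derive_unique.
      apply (is_derive_ext (fun y => c)); [intros t; symmetry; apply E1 |].
      auto_derive; [exact I | ring]. }
    change (fun y => w y ^ S (S n)) with (fun y => w y * f y).
    replace (2 * S n + 1)%nat with (2 * n + 3)%nat by lia.
    rewrite Derive_n_wmul, E2 by apply Hf.
    replace (pred (2 * n + 3)) with (2 * n + 2)%nat by lia.
    replace (pred (2 * n + 2)) with (2 * n + 1)%nat by lia.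
    rewrite E1; change (Derive_n f) with (Derive_n (fun y => w y ^ S n)); rewrite IH.
    replace (2 * S n + 2)%nat with (S (S (2 * n + 2))) by lia.
    rewrite !fact_simpl, !mult_INR, <- (tech_pow_Rmult (-1) (S n)).
    unfold c; replace (2 * n + 3)%nat with (S (2 * n + 2)) by lia.
    rewrite !S_INR, !plus_INR, !mult_INR; simpl INR; ring.
Qed.

Lemma Derive_n_wpow_top (n : nat) : forall x,
  Derive_n (fun y => w y ^ n) (2 * n) x = (-1) ^ n * INR (fact (2 * n)).
Proof.
  destruct n as [|n]; intros x; [simpl; ring |].
  replace (2 * S n)%nat with (S (2 * n + 1)) by lia.
  apply is_derive_unique.
  apply (is_derive_ext (fun y => (-1) ^ S n * INR (fact (2 * n + 2)) * y));
    [intros t; symmetry; apply Derive_n_wpow |].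
  replace (S (2 * n + 1)) with (2 * n + 2)%nat by lia.
  generalize ((-1) ^ S n * INR (fact (2 * n + 2))); intros c; auto_derive; [exact I | ring].
Qed.

Lemma Derive_n_wpow_over (n : nat) : forall x,
  Derive_n (fun y => w y ^ n) (2 * n + 1) x = 0.
Proof.
  intros x; replace (2 * n + 1)%nat with (S (2 * n)) by lia.
  apply is_derive_unique.
  apply (is_derive_ext (fun y => (-1) ^ n * INR (fact (2 * n))));
    [intros t; symmetry; apply Derive_n_wpow_top |].
  auto_derive; [exact I | ring].
Qed.

Lemma Derive_n_xwpow (n : nat) : forall x,
  Derive_n (fun y => y * w y ^ n) (2 * n + 1) x = (-1) ^ n * INR (fact (2 * n + 1)).
Proof.
  intros x.
  replace (fun y => y * w y ^ n) with (fun y => (0 + 1 * y) * w y ^ n)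
    by (apply functional_extensionality; intros; ring).
  rewrite Derive_n_linmul by (ckw).
  replace (pred (2 * n + 1)) with (2 * n)%nat by lia.
  rewrite Derive_n_wpow_over, Derive_n_wpow_top.
  replace (2 * n + 1)%nat with (S (2 * n)) by lia.
  rewrite fact_simpl, mult_INR; ring.
Qed.

Definition mass (n : nat) : R := Int (fun x => w x ^ n).

Lemma mass_pos (n : nat) : 0 < mass n.
Proof.
  apply Int_gt_0.
  - intros x _; apply cp_pow, cp_w.
  - intros x Hx; now apply pow_lt, w_pos.
Qed.

Lemma mass_S (n : nat) :
  (2 * INR n + 3) * mass (S n) = (2 * INR n + 2) * mass n.
Proof.
  assert (H : Int (fun x => (2 * INR n + 3) * w x ^ S n + - (2 * INR n + 2) * w x ^ n) = 0).
  { rewrite (Int_ftc (fun x => x * w x ^ S n)).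
    - rewrite w_1, w_m1; simpl; ring.
    - intros x; evar_last; [deriv |].
      unfold one; rewrite S_INR; simpl; unfold w; ring.
    - intros x _; cntw. }
  rewrite Int_lin in H by (intros x _; cntw).
  unfold mass; lra.
Qed.

(** * Integral identities for axially symmetric solutions *)

Definition vfun (n : nat) (u : R -> R) (x : R) : R := w x ^ S n * Derive u x.
Definition Gfun (u : R -> R) (x : R) : R := w x * Derive u x.
Definition psi (n : nat) (u : R -> R) : R -> R := Derive_n (vfun n u) n.
Definition dpsi (n : nat) (u : R -> R) : R -> R := Derive_n (vfun n u) (S n).
Definition coef (n : nat) (al : R) : R := al * (-1) ^ S n / INR (fact (2 * n + 1)).

(* In the notation of the statement N = 2 n + 2, and F is the normalised
   density e^(N u) / int e^(N u). *)
Record axial (n : nat) (al : R) (u F : R -> R) : Prop := {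
  ax_u : Ck (2 * n + 5) u;
  ax_F : forall x, is_derive F x (2 * INR (S n) * Derive u x * F x);
  ax_pos : forall x, 0 < F x;
  ax_eq : forall x, -1 <= x <= 1 ->
    F x = 1 + coef n al * Derive_n (vfun n u) (2 * n + 1) x
}.

Lemma vfun_G (n : nat) (u : R -> R) (x : R) : vfun n u x = w x ^ n * Gfun u x.
Proof. unfold vfun, Gfun; simpl; ring. Qed.

Lemma Ck_v (n : nat) (u : R -> R) : Ck (2 * n + 5) u -> Ck (2 * n + 4) (vfun n u).
Proof.
  intros H; unfold vfun; ckw.
  apply Ck_Derive; now replace (S (2 * n + 4)) with (2 * n + 5)%nat by lia.
Qed.

Lemma Ck_G (n : nat) (u : R -> R) : Ck (2 * n + 5) u -> Ck (2 * n + 4) (Gfun u).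
Proof.
  intros H; unfold Gfun; ckw.
  apply Ck_Derive; now replace (S (2 * n + 4)) with (2 * n + 5)%nat by lia.
Qed.

Lemma v_vanish (n : nat) (u : R -> R) (k : nat) (a : R) :
  Ck (2 * n + 5) u -> (k <= n)%nat -> w a = 0 -> Derive_n (vfun n u) k a = 0.
Proof.
  intros H Hk Ha; apply (Derive_n_wpow_vanish (S n)); [| assumption | lia].
  apply (Ck_le k (2 * n + 4)); [lia |]; apply Ck_Derive.
  now replace (S (2 * n + 4)) with (2 * n + 5)%nat by lia.
Qed.

Lemma cp_F (n : nat) (al : R) (u F : R -> R) :
  axial n al u F -> forall x, continuity_pt F x.
Proof. intros H x; eapply cp_derive; apply (ax_F _ _ _ _ H). Qed.

(** No boundary term remains: at the poles v vanishes with its derivatives up to order n, w^n h with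
    those up to order n - 1, and the two orders in each product add up to 2n. *)
Lemma Int_v_test (n : nat) (u h : R -> R) :
  Ck (2 * n + 5) u -> Ck (2 * n + 1) h ->
  Int (fun x => Derive_n (vfun n u) (2 * n + 1) x * (w x ^ n * h x))
  = - Int (fun x => vfun n u x * Derive_n (fun y => w y ^ n * h y) (2 * n + 1) x).
Proof.
  intros Hu Hh.
  replace (2 * n + 1)%nat with (S (2 * n)) in * by lia.
  rewrite (Int_parts (2 * n) (vfun n u) (fun y => w y ^ n * h y)).
  - rewrite <- (Rmult_1_l (- _)), <- tech_pow_Rmult, pow_1_even; ring.
  - apply (Ck_le _ (2 * n + 4)); [lia | now apply Ck_v].
  - ckw.
  - intros i a Hi Ha; destruct (Nat.lt_ge_cases i n) as [Hin | Hin].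
    + rewrite (Derive_n_wpow_vanish n i h) by (first [assumption | apply (Ck_le i (S (2 * n))); [lia | assumption]]).
      ring.
    + rewrite v_vanish by (try assumption; lia); ring.
Qed.

Lemma EF_split (n : nat) (al : R) (u F g : R -> R) :
  axial n al u F -> contI g ->
  Int (fun x => F x * g x)
  = Int g + coef n al * Int (fun x => Derive_n (vfun n u) (2 * n + 1) x * g x).
Proof.
  intros H Hg.
  assert (Hc : forall x, continuity_pt (Derive_n (vfun n u) (2 * n + 1)) x).
  { apply (Ck_cont_n (2 * n + 4)); [apply Ck_v, (ax_u _ _ _ _ H) | lia]. }
  rewrite <- (Rmult_1_l (Int g)), <- Int_lin; [| assumption | intros x Hx; cntw; now apply Hg].
  apply Int_ext; intros x Hx; rewrite (ax_eq _ _ _ _ H) by assumption; ring.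
Qed.

Lemma EF_test (n : nat) (al : R) (u F h : R -> R) :
  axial n al u F -> Ck (2 * n + 1) h ->
  Int (fun x => F x * (w x ^ n * h x))
  = Int (fun x => w x ^ n * h x)
    - coef n al * Int (fun x => vfun n u x * Derive_n (fun y => w y ^ n * h y) (2 * n + 1) x).
Proof.
  intros H Hh.
  rewrite (EF_split n al u F (fun x => w x ^ n * h x) H).
  - rewrite Int_v_test by (assumption || apply (ax_u _ _ _ _ H)); ring.
  - pose proof (Ck_cont _ _ Hh); intros x _; cntw.
Qed.

(** Integration against w^n F dx, where w^n dx is, up to a factor, the image of the measure of the
    sphere under x. *)
Definition EF (n : nat) (F h : R -> R) : R := Int (fun x => w x ^ n * F x * h x).

Lemma EF_lin (n : nat) (F : R -> R) (a b : R) (f g : R -> R) :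
  contI F -> contI f -> contI g ->
  EF n F (fun x => a * f x + b * g x) = a * EF n F f + b * EF n F g.
Proof.
  intros HF Hf Hg; unfold EF; rewrite <- Int_lin.
  - apply Int_ext; intros; ring.
  - intros x Hx; cntw.
  - intros x Hx; cntw.
Qed.

Lemma EF_ext (n : nat) (F f g : R -> R) :
  (forall x, -1 <= x <= 1 -> f x = g x) -> EF n F f = EF n F g.
Proof. intros H; apply Int_ext; intros x Hx; now rewrite H. Qed.

(** Integrate the derivative of w^(n+1) F xi. The weight contributes x, and F' = 2(n+1) u' F
    contributes w u' = G, whence the factor x - G. *)
Lemma EF_derive (n : nat) (al : R) (u F xi dxi : R -> R) :
  axial n al u F -> (forall x, is_derive xi x (dxi x)) -> (forall x, continuity_pt dxi x) ->
  EF n F (fun x => w x * dxi x)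
  = 2 * INR (S n) * EF n F (fun x => (x - Gfun u x) * xi x).
Proof.
  intros H Hxi Hc.
  pose proof (cp_F _ _ _ _ H) as HF.
  pose proof (ax_F _ _ _ _ H) as DF.
  pose proof (Ck_cont _ _ (Ck_G n u (ax_u _ _ _ _ H))) as HG.
  assert (Hxc : forall x, continuity_pt xi x) by (intros x; eapply cp_derive; apply Hxi).
  assert (E : Int (fun x => 1 * (w x ^ n * F x * (w x * dxi x))
                + - (2 * INR (S n)) * (w x ^ n * F x * ((x - Gfun u x) * xi x))) = 0).
  { rewrite (Int_ftc (fun x => w x ^ S n * F x * xi x)).
    - rewrite w_1, w_m1; simpl; ring.
    - intros x; evar_last.
      + deriv.
      + unfold Gfun; simpl pred; simpl pow; ring.
    - intros x _; cntw. }
  rewrite Int_lin in E by (intros x _; cntw).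
  unfold EF; lra.
Qed.

(** A derivative of odd order is antisymmetric, so the integral is its own opposite. *)
Lemma Int_zero_v (n : nat) (u : R -> R) :
  Ck (2 * n + 5) u ->
  Int (fun x => Derive_n (vfun n u) (2 * n + 1) x * vfun n u x) = 0.
Proof.
  intros Hu.
  assert (Hv : Ck (2 * n + 1) (vfun n u)) by (apply (Ck_le _ (2 * n + 4)); [lia | now apply Ck_v]).
  pose proof (Int_parts (2 * n) (vfun n u) (vfun n u)) as E.
  replace (S (2 * n)) with (2 * n + 1)%nat in E by lia.
  specialize (E Hv Hv).
  assert (E2 : (-1) ^ (2 * n + 1) = -1) by (replace (2 * n + 1)%nat with (S (2 * n)) by lia; apply pow_1_odd).
  rewrite E2 in E.
  assert (E3 : Int (fun x => vfun n u x * Derive_n (vfun n u) (2 * n + 1) x)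
               = Int (fun x => Derive_n (vfun n u) (2 * n + 1) x * vfun n u x))
    by (apply Int_ext; intros; ring).
  rewrite E3 in E.
  enough (Int (fun x => Derive_n (vfun n u) (2 * n + 1) x * vfun n u x)
          = -1 * Int (fun x => Derive_n (vfun n u) (2 * n + 1) x * vfun n u x)) by lra.
  apply E; intros i a Hi Ha.
  destruct (Nat.lt_ge_cases n i) as [Hin | Hin].
  - rewrite v_vanish by (try assumption; lia); ring.
  - rewrite (v_vanish n u i) by (try assumption; lia); ring.
Qed.

Lemma coef_fact (n : nat) (al : R) :
  coef n al * ((-1) ^ n * INR (fact (2 * n + 1))) = - al.
Proof.
  unfold coef; rewrite <- tech_pow_Rmult.
  replace (al * (-1 * (-1) ^ n) / INR (fact (2 * n + 1)) * ((-1) ^ n * INR (fact (2 * n + 1))))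
    with (- al * ((-1) ^ n * (-1) ^ n) * (INR (fact (2 * n + 1)) / INR (fact (2 * n + 1))))
    by (unfold Rdiv; ring).
  rewrite <- Rpow_mult_distr; replace (-1 * -1) with 1 by ring; rewrite pow1.
  field; apply INR_fact_neq_0.
Qed.

(** The test polynomial w^n has degree 2n and is annihilated by the derivative of order 2n + 1. *)
Lemma EF_1 (n : nat) (al : R) (u F : R -> R) :
  axial n al u F -> EF n F (fun _ => 1) = mass n.
Proof.
  intros H.
  pose proof (EF_test n al u F (fun _ => 1) H ltac:(ckw)) as E; cbv beta in E.
  replace (Int (fun x => F x * (w x ^ n * 1))) with (EF n F (fun _ => 1)) in E
    by (apply Int_ext; intros; ring).
  rewrite E.
  replace (Int (fun x => vfun n u x * Derive_n (fun y => w y ^ n * 1) (2 * n + 1) x)) with 0.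
  - unfold mass; rewrite Rmult_0_r, Rminus_0_r; apply Int_ext; intros; ring.
  - rewrite (Int_ext _ (fun _ => 0)); [now rewrite Int_const, Rmult_0_r |].
    intros x _; replace (fun y => w y ^ n * 1) with (fun y => w y ^ n)
      by (apply functional_extensionality; intros; ring).
    rewrite Derive_n_wpow_over; ring.
Qed.

Lemma Int_odd_mass (n : nat) : Int (fun x => w x ^ n * x) = 0.
Proof.
  assert (E : - 2 * INR (S n) * Int (fun x => w x ^ n * x) = 0).
  { rewrite <- Int_scal by (intros x _; cntw).
    rewrite (Int_ftc (fun x => w x ^ S n)).
    - rewrite w_1, w_m1; ring.
    - intros x; evar_last; [apply is_derive_wpow | simpl pred; ring].
    - intros x _; cntw. }
  assert (0 < INR (S n)) by (apply lt_0_INR; lia); nra.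
Qed.

Lemma EF_x (n : nat) (al : R) (u F : R -> R) :
  axial n al u F -> EF n F (fun x => x) = al * Int (vfun n u).
Proof.
  intros H.
  pose proof (EF_test n al u F (fun x => x) H ltac:(ckw)) as E; cbv beta in E.
  replace (Int (fun x => F x * (w x ^ n * x))) with (EF n F (fun x => x)) in E
    by (apply Int_ext; intros; ring).
  rewrite E, Int_odd_mass.
  rewrite (Int_ext (fun x => vfun n u x * Derive_n (fun y => w y ^ n * y) (2 * n + 1) x)
             (fun x => (-1) ^ n * INR (fact (2 * n + 1)) * vfun n u x)).
  - rewrite Int_scal; [| intros x _; apply (Ck_cont _ _ (Ck_v n u (ax_u _ _ _ _ H)))].
    rewrite <- Rmult_assoc, coef_fact; ring.
  - intros x _; replace (fun y => w y ^ n * y) with (fun y => y * w y ^ n)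
      by (apply functional_extensionality; intros; ring).
    rewrite Derive_n_xwpow; ring.
Qed.

(** As w^n G = v, the nonconstant part of F drops out by [Int_zero_v]. *)
Lemma EF_G (n : nat) (al : R) (u F : R -> R) :
  axial n al u F -> EF n F (Gfun u) = Int (vfun n u).
Proof.
  intros H.
  pose proof (Ck_cont _ _ (Ck_v n u (ax_u _ _ _ _ H))) as Hv.
  rewrite <- (Rplus_0_r (Int (vfun n u))), <- (Rmult_0_r (coef n al)),
    <- (Int_zero_v n u (ax_u _ _ _ _ H)), <- (EF_split n al u F (vfun n u)); try assumption.
  - apply Int_ext; intros; rewrite vfun_G; ring.
  - intros x _; apply Hv.
Qed.

(* The Kazdan-Warner obstruction; this is where [al <> 1] enters. *)
Lemma center_of_mass (n : nat) (al : R) (u F : R -> R) :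
  axial n al u F -> al <> 1 -> Int (vfun n u) = 0 /\ EF n F (fun x => x) = 0.
Proof.
  intros H Hal.
  pose proof (cp_F _ _ _ _ H) as HF.
  pose proof (Ck_cont _ _ (Ck_G n u (ax_u _ _ _ _ H))) as HG.
  pose proof (EF_derive n al u F (fun _ => 1) (fun _ => 0) H) as E; cbv beta in E.
  rewrite (EF_ext n F (fun x => (x - Gfun u x) * 1) (fun x => 1 * x + -1 * Gfun u x)) in E
    by (intros; ring).
  rewrite EF_lin in E by (intros x _; cntw).
  rewrite (EF_x n al u F H), (EF_G n al u F H) in E.
  replace (EF n F (fun x => w x * 0)) with 0 in E.
  2:{ symmetry; unfold EF; rewrite (Int_ext _ (fun _ => 0)) by (intros; ring).
      now rewrite Int_const, Rmult_0_r. }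
  assert (Hi : 0 < INR (S n)) by (apply lt_0_INR; lia).
  assert (E0 : (al - 1) * Int (vfun n u) = 0).
  { assert (E1 : 0 = 2 * INR (S n) * ((al - 1) * Int (vfun n u))).
    { rewrite E; [ring | |]; intros x; [auto_derive; [exact I | ring] | cntw]. }
    apply (Rmult_eq_reg_l (2 * INR (S n))); lra. }
  assert (E2 : Int (vfun n u) = 0).
  { apply Rmult_integral in E0; destruct E0; [exfalso; lra | assumption]. }
  split; [exact E2 | rewrite (EF_x n al u F H), E2; ring].
Qed.

Definition mom2 (n : nat) (F : R -> R) : R := EF n F (fun x => x ^ 2).
(** By [dfct_mom2] this is proportional to the excess of [mom2] over mass n / (2n + 3), its value
    for F = 1. *)
Definition dfct (n : nat) (u F : R -> R) : R := EF n F (fun x => x * Gfun u x).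

Lemma dfct_mom2 (n : nat) (al : R) (u F : R -> R) :
  axial n al u F ->
  2 * INR (S n) * dfct n u F = (2 * INR n + 3) * mom2 n F - mass n.
Proof.
  intros H.
  pose proof (cp_F _ _ _ _ H) as HF.
  pose proof (Ck_cont _ _ (Ck_G n u (ax_u _ _ _ _ H))) as HG.
  pose proof (EF_derive n al u F (fun x => x) (fun _ => 1) H) as E; cbv beta in E.
  rewrite (EF_ext n F (fun x => (x - Gfun u x) * x)
             (fun x => 1 * x ^ 2 + -1 * (x * Gfun u x))) in E by (intros; ring).
  rewrite (EF_ext n F (fun x => w x * 1) (fun x => 1 * 1 + -1 * x ^ 2)) in E
    by (intros; unfold w; ring).
  rewrite !EF_lin in E by (intros x _; cntw).
  rewrite (EF_1 n al u F H) in E; fold (mom2 n F) (dfct n u F) in E.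
  rewrite S_INR in *.
  enough (1 * mass n + -1 * mom2 n F
          = 2 * (INR n + 1) * (1 * mom2 n F + -1 * dfct n u F)) by lra.
  apply E; intros x; [auto_derive; [exact I | ring] | cntw].
Qed.

(** The test polynomial is w^(n+1), whose derivative of order 2n + 1 is a multiple of x; [dfct_mom2]
    and [mass_S] then eliminate the second moment and [mass (S n)]. *)
Lemma first_harmonic (n : nat) (al : R) (u F : R -> R) :
  axial n al u F -> al * (2 * INR n + 3) * Int (fun x => x * vfun n u x) = dfct n u F.
Proof.
  intros H.
  pose proof (cp_F _ _ _ _ H) as HF.
  pose proof (Ck_cont _ _ (Ck_v n u (ax_u _ _ _ _ H))) as Hv.
  pose proof (EF_test n al u F w H (Ck_w _)) as E; cbv beta in E.
  rewrite (Int_ext (fun x => F x * (w x ^ n * w x))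
             (fun x => w x ^ n * F x * (1 * 1 + -1 * x ^ 2))) in E by (intros; unfold w; ring).
  change (Int (fun x => w x ^ n * F x * (1 * 1 + -1 * x ^ 2)))
    with (EF n F (fun x => 1 * 1 + -1 * x ^ 2)) in E.
  rewrite EF_lin in E by (intros x _; cntw).
  rewrite (EF_1 n al u F H) in E; fold (mom2 n F) in E.
  rewrite (Int_ext (fun x => w x ^ n * w x) (fun x => w x ^ S n)) in E by (intros; simpl; ring).
  fold (mass (S n)) in E.
  rewrite (Int_ext (fun x => vfun n u x * Derive_n (fun y => w y ^ n * w y) (2 * n + 1) x)
             (fun x => (-1) ^ S n * INR (fact (2 * n + 2)) * (x * vfun n u x))) in E.
  2:{ intros x _; replace (fun y => w y ^ n * w y) with (fun y => w y ^ S n)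
        by (apply functional_extensionality; intros; simpl; ring).
      rewrite Derive_n_wpow; ring. }
  rewrite Int_scal in E by (intros x _; cntw).
  pose proof (dfct_mom2 n al u F H) as E2.
  pose proof (mass_S n) as E3.
  pose proof (coef_fact n al) as E4.
  replace (coef n al * ((-1) ^ S n * INR (fact (2 * n + 2)) * Int (fun x => x * vfun n u x)))
    with (al * (2 * INR n + 2) * Int (fun x => x * vfun n u x)) in E.
  2:{ replace (2 * n + 2)%nat with (S (2 * n + 1)) by lia.
      rewrite fact_simpl, mult_INR, <- tech_pow_Rmult.
      replace al with (- (coef n al * ((-1) ^ n * INR (fact (2 * n + 1))))) at 1 by lra.
      rewrite S_INR, plus_INR, mult_INR; simpl INR; ring. }
  rewrite S_INR in E2.
  pose proof (pos_INR n).
  assert (E5 : 2 * (INR n + 1) * dfct n u F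
               = 2 * (INR n + 1) * (al * (2 * INR n + 3) * Int (fun x => x * vfun n u x))).
  { rewrite E2; nra. }
  apply Rmult_eq_reg_l in E5; lra.
Qed.

(** * Quadratic identities for the energies E0 and E1 *)

Lemma Int_parts_half (n : nat) (u g : R -> R) :
  (1 <= n)%nat -> Ck (2 * n + 5) u -> Ck n g ->
  (forall i a, (i < n)%nat -> w a = 0 -> Derive_n g i a = 0) ->
  Int (fun x => Derive_n (vfun n u) (2 * n + 1) x * g x)
  = (-1) ^ n * Int (fun x => dpsi n u x * Derive_n g n x).
Proof.
  intros Hn Hu Hg H0.
  destruct n as [|p]; [lia |]; unfold dpsi.
  set (f := Derive_n (vfun (S p) u) (S (S p))).
  rewrite <- (Int_parts p f g).
  - apply Int_ext; intros x _; unfold f; rewrite Derive_n_comp; do 2 f_equal; lia.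
  - unfold f; apply Ck_Derive_n, (Ck_le _ (2 * S p + 4)); [lia | now apply Ck_v].
  - exact Hg.
  - intros i a Hi Ha; rewrite (H0 i a) by (assumption || lia); ring.
Qed.

Lemma D_psi (n : nat) (u : R -> R) :
  Ck (2 * n + 5) u -> forall x, is_derive (psi n u) x (dpsi n u x).
Proof.
  intros Hu; apply (Ck_is_derive (2 * n + 4)); [now apply Ck_v | lia].
Qed.

Lemma cp_psi (n : nat) (u : R -> R) :
  Ck (2 * n + 5) u -> forall x, continuity_pt (psi n u) x.
Proof. intros Hu; apply (Ck_cont_n (2 * n + 4)); [now apply Ck_v | lia]. Qed.

Lemma cp_dpsi (n : nat) (u : R -> R) :
  Ck (2 * n + 5) u -> forall x, continuity_pt (dpsi n u) x.
Proof. intros Hu; apply (Ck_cont_n (2 * n + 4)); [now apply Ck_v | lia]. Qed.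

Lemma psi_end (n : nat) (u : R -> R) (a : R) :
  Ck (2 * n + 5) u -> w a = 0 -> psi n u a = 0.
Proof. intros; apply v_vanish; (assumption || lia). Qed.

Definition E0 (n : nat) (u : R -> R) : R := Int (fun x => psi n u x ^ 2).
Definition E1 (n : nat) (u : R -> R) : R := Int (fun x => w x * dpsi n u x ^ 2).

(* Both quadratic forms come from integrating by parts n times, so that each
   factor carries half of the 2n+1 derivatives. *)
Lemma Int_x_form (n : nat) (u : R -> R) :
  (1 <= n)%nat -> Ck (2 * n + 5) u ->
  Int (fun x => Derive_n (vfun n u) (2 * n + 1) x * (x * vfun n u x))
  = - (-1) ^ n * ((INR n + / 2) * E0 n u).
Proof.
  intros Hn Hu.
  pose proof (Ck_v n u Hu) as Hv.
  assert (Hvk : forall k, (k <= 2 * n + 4)%nat -> Ck k (vfun n u))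
    by (intros k Hk; now apply (Ck_le k (2 * n + 4))).
  assert (Ex : (fun x => x * vfun n u x) = (fun x => (0 + 1 * x) * vfun n u x))
    by (apply functional_extensionality; intros; ring).
  rewrite (Int_parts_half n u (fun x => x * vfun n u x)); try assumption.
  2:{ ckw; apply Hvk; lia. }
  2:{ intros i a Hi Ha; rewrite Ex, Derive_n_linmul by (apply Hvk; lia).
      rewrite !v_vanish by (assumption || lia); ring. }
  pose proof (cp_psi n u Hu) as Cp; pose proof (cp_dpsi n u Hu) as Cd.
  (* The n-th derivative of x v is x psi + n q with q = v^(n-1) and q' = psi, so psi' times it is an
     exact derivative up to a multiple of psi^2. *)
  pose proof (D_psi n u Hu) as Dp; set (q := Derive_n (vfun n u) (pred n)).
  assert (Cq : forall x, continuity_pt q x) by (apply (Ck_cont_n (2 * n + 4)); [assumption | lia]).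
  assert (Dq : forall x, is_derive q x (psi n u x)).
  { apply (Ck_is_derive_pred (2 * n + 4)); [assumption | lia]. }
  rewrite (Int_ext _ (fun x => dpsi n u x * (x * psi n u x + INR n * q x))).
  2:{ intros x _; rewrite Ex, Derive_n_linmul by (apply Hvk; lia); unfold psi, q; ring. }
  assert (E : Int (fun x => 1 * (dpsi n u x * (x * psi n u x + INR n * q x))
                    + (INR n + / 2) * psi n u x ^ 2) = 0).
  { rewrite (Int_ftc (fun x => psi n u x * (/ 2 * (x * psi n u x) + INR n * q x))).
    - rewrite !(psi_end n u) by (assumption || apply w_1 || apply w_m1); ring.
    - intros x; evar_last.
      + deriv.
      + unfold zero, one; simpl; field.
    - intros x _; cntw. }
  rewrite Int_lin in E by (intros x _; cntw).
  fold (E0 n u) in E.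
  replace (Int (fun x => dpsi n u x * (x * psi n u x + INR n * q x)))
    with (- ((INR n + / 2) * E0 n u)) by lra.
  ring.
Qed.

Lemma Int_w_form (n : nat) (u : R -> R) :
  (1 <= n)%nat -> Ck (2 * n + 5) u ->
  Int (fun x => Derive_n (vfun n u) (2 * n + 1) x * Derive (fun y => w y * vfun n u y) x)
  = (-1) ^ n * (E1 n u + (INR n + 1) ^ 2 * E0 n u).
Proof.
  intros Hn Hu.
  pose proof (Ck_v n u Hu) as Hv.
  assert (Hvk : forall k, (k <= 2 * n + 4)%nat -> Ck k (vfun n u))
    by (intros k Hk; now apply (Ck_le k (2 * n + 4))).
  rewrite (Int_parts_half n u (Derive (fun y => w y * vfun n u y))); try assumption.
  2:{ apply Ck_Derive; ckw; apply Hvk; lia. }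
  2:{ intros i a Hi Ha; rewrite Derive_n_S_comm, Derive_n_wmul by (apply Hvk; lia).
      rewrite !v_vanish by (assumption || lia); ring. }
  pose proof (cp_psi n u Hu) as Cp; pose proof (cp_dpsi n u Hu) as Cd.
  pose proof (D_psi n u Hu) as Dp; set (q := Derive_n (vfun n u) (pred n)).
  assert (Cq : forall x, continuity_pt q x) by (apply (Ck_cont_n (2 * n + 4)); [assumption | lia]).
  assert (Dq : forall x, is_derive q x (psi n u x)).
  { apply (Ck_is_derive_pred (2 * n + 4)); [assumption | lia]. }
  rewrite (Int_ext _ (fun x => dpsi n u x * (w x * dpsi n u x - 2 * (INR n + 1) * x * psi n u x
                        - (INR n + 1) * INR n * q x))).
  2:{ intros x _; rewrite Derive_n_S_comm, Derive_n_wmul by (apply Hvk; lia).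
      rewrite S_INR; unfold psi, dpsi, q; simpl pred; ring. }
  assert (E : Int (fun x => 1 * (dpsi n u x * (w x * dpsi n u x - 2 * (INR n + 1) * x * psi n u x
                        - (INR n + 1) * INR n * q x))
                    + -1 * (w x * dpsi n u x ^ 2) + - (INR n + 1) ^ 2 * psi n u x ^ 2) = 0).
  { rewrite (Int_ftc (fun x => psi n u x * (- (INR n + 1) * (x * psi n u x)
                                 + - (INR n + 1) * INR n * q x))).
    - rewrite !(psi_end n u) by (assumption || apply w_1 || apply w_m1); ring.
    - intros x; evar_last.
      + deriv.
      + unfold zero, one; simpl; ring.
    - intros x _; cntw. }
  rewrite Int_lin3 in E by (intros x _; cntw).
  fold (E0 n u) in E; fold (E1 n u) in E.
  f_equal; lra.
Qed.

(** [dfct] is the integral of F x v, so the equation is tested with x v. The sign (-1)^n of the form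
    cancels against that of [coef], and E0 enters with a positive factor. *)
Lemma energy1 (n : nat) (al : R) (u F : R -> R) :
  (1 <= n)%nat -> axial n al u F ->
  dfct n u F = Int (fun x => x * vfun n u x)
    + al / INR (fact (2 * n + 1)) * ((INR n + / 2) * E0 n u).
Proof.
  intros Hn H.
  pose proof (Ck_cont _ _ (Ck_v n u (ax_u _ _ _ _ H))) as Hv.
  assert (E : dfct n u F = Int (fun x => F x * (x * vfun n u x))).
  { apply Int_ext; intros; rewrite vfun_G; ring. }
  rewrite E, (EF_split n al u F) by (try assumption; intros x _; cntw).
  rewrite Int_x_form by (try assumption; apply (ax_u _ _ _ _ H)).
  f_equal; pose proof (coef_fact n al) as Hc.
  pose proof (INR_fact_neq_0 (2 * n + 1)).
  transitivity (- (coef n al * ((-1) ^ n * INR (fact (2 * n + 1))))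
                / INR (fact (2 * n + 1)) * ((INR n + / 2) * E0 n u)).
  - field; assumption.
  - rewrite Hc; field; assumption.
Qed.

(** [EF_derive] with xi = G turns the left side into minus the integral of F (w v)'. The constant
    part of F contributes nothing because w v vanishes at the poles. *)
Lemma energy2 (n : nat) (al : R) (u F : R -> R) :
  (1 <= n)%nat -> axial n al u F ->
  2 * INR (S n) * EF n F (fun x => Gfun u x ^ 2)
  = al / INR (fact (2 * n + 1)) * (E1 n u + (INR n + 1) ^ 2 * E0 n u).
Proof.
  intros Hn H.
  pose proof (ax_u _ _ _ _ H) as Hu.
  pose proof (Ck_v n u Hu) as Hv.
  pose proof (cp_F _ _ _ _ H) as HF.
  pose proof (Ck_G n u Hu) as HG.
  pose proof (Ck_cont _ _ HG) as CG.
  assert (DG : forall x, is_derive (Gfun u) x (Derive (Gfun u) x)).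
  { apply (Ck_is_derive (2 * n + 4) 0); [assumption | lia]. }
  assert (CdG : forall x, continuity_pt (Derive (Gfun u)) x).
  { apply (Ck_cont_n (2 * n + 4) 1); [assumption | lia]. }
  assert (Ddv : forall x, is_derive (fun y => w y * vfun n u y) x
                  (w x ^ S n * Derive (Gfun u) x - 2 * INR (S n) * x * vfun n u x)).
  { intros x; apply (is_derive_ext (fun y => w y ^ S n * Gfun u y)).
    - intros t; rewrite vfun_G; simpl; ring.
    - evar_last; [deriv |].
      rewrite vfun_G; simpl pred; ring. }
  pose proof (EF_derive n al u F (Gfun u) (Derive (Gfun u)) H DG CdG) as E.
  assert (E2 : 2 * INR (S n) * EF n F (fun x => Gfun u x ^ 2)
               = - Int (fun x => F x * Derive (fun y => w y * vfun n u y) x)).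
  { assert (Es : EF n F (fun x => (x - Gfun u x) * Gfun u x)
                 = EF n F (fun x => x * Gfun u x) - EF n F (fun x => Gfun u x ^ 2)).
    { rewrite (EF_ext n F _ (fun x => 1 * (x * Gfun u x) + -1 * Gfun u x ^ 2)) by (intros; ring).
      rewrite EF_lin by (intros x _; cntw); ring. }
    rewrite Es in E.
    rewrite (Int_ext _ (fun x => 1 * (w x ^ n * F x * (w x * Derive (Gfun u) x))
                         + - (2 * INR (S n)) * (w x ^ n * F x * (x * Gfun u x)))).
    - rewrite Int_lin by (intros x _; cntw).
      unfold EF in *; lra.
    - intros x _; rd (Ddv x); rewrite vfun_G; simpl; ring. }
  assert (Cdv : forall x, continuity_pt (Derive (fun y => w y * vfun n u y)) x).
  { apply (Ck_cont_n (2 * n + 4) 1); [| lia]; ckw. }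
  rewrite E2, (EF_split n al u F) by (try assumption; intros x _; cntw).
  rewrite Int_w_form by assumption.
  assert (Ez : Int (Derive (fun y => w y * vfun n u y)) = 0).
  { rewrite (Int_ftc (fun y => w y * vfun n u y)).
    - rewrite w_1, w_m1; ring.
    - intros x; apply Derive_correct; eexists; apply Ddv.
    - intros x _; cntw. }
  rewrite Ez; pose proof (coef_fact n al) as Hc.
  pose proof (INR_fact_neq_0 (2 * n + 1)).
  transitivity (- (coef n al * ((-1) ^ n * INR (fact (2 * n + 1))))
                / INR (fact (2 * n + 1)) * (E1 n u + (INR n + 1) ^ 2 * E0 n u)).
  - field; assumption.
  - rewrite Hc; field; assumption.
Qed.

(** * Weighted Poincare inequalities *)

Lemma cp_squeeze (f g : R -> R) (C a : R) :
  (forall x, Rabs (f x) <= C * Rabs (g x)) -> g a = 0 -> f a = 0 ->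
  continuity_pt g a -> continuity_pt f a.
Proof.
  intros Hb Hg Hf Hc eps Heps.
  assert (HC : 0 < Rabs C + 1) by (pose proof (Rabs_pos C); lra).
  destruct (Hc (eps / (Rabs C + 1))) as [d [Hd H]]; [now apply Rdiv_lt_0_compat |].
  exists d; split; [exact Hd |]; intros x Hx; specialize (H x Hx).
  simpl in *; unfold Rdist in *; rewrite Hg, Rminus_0_r in H; rewrite Hf, Rminus_0_r.
  apply (Rmult_lt_compat_r (Rabs C + 1)) in H; [| exact HC].
  replace (eps / (Rabs C + 1) * (Rabs C + 1)) with eps in H by (field; lra).
  pose proof (Hb x); pose proof (Rle_abs C); pose proof (Rabs_pos (g x)); nra.
Qed.

Lemma contI_bounded (f : R -> R) :
  contI f -> exists C, 0 <= C /\ forall x, -1 <= x <= 1 -> Rabs (f x) <= C.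
Proof.
  intros Hf.
  destruct (continuity_ab_maj (fun x => Rabs (f x)) (-1) 1) as [m [Hm Hm1]]; [lra | |].
  - intros x Hx; apply (cp_comp f Rabs); [now apply Hf | apply Rcontinuity_abs].
  - exists (Rabs (f m)); split; [apply Rabs_pos | exact Hm].
Qed.

Lemma le_of_deriv_nonneg (f df : R -> R) (a b : R) :
  a <= b -> (forall x, a <= x <= b -> is_derive f x (df x)) ->
  (forall x, a <= x <= b -> 0 <= df x) -> f a <= f b.
Proof.
  intros Hab Hd Hp.
  destruct (MVT_gen f a b df) as [c [Hc E]]; rewrite ?Rmin_left, ?Rmax_right in * by assumption.
  - intros x Hx; apply Hd; lra.
  - intros x Hx; eapply cp_derive; now apply Hd.
  - pose proof (Hp c Hc); nra.
Qed.

(** The primitive is compared with (1 + x)^(j+1) starting from -1 and with (1 - x)^(j+1) starting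
    from 1; it is 0 at both ends since the total integral vanishes. For x <= 0 the factor 1 + x is
    at most w, for x >= 0 the factor 1 - x is. *)
Lemma prim_bound (j : nat) (g : R -> R) (C : R) :
  (forall x, continuity_pt g x) -> (forall x, -1 <= x <= 1 -> Rabs (g x) <= C) ->
  Int (fun x => w x ^ j * g x) = 0 -> forall x, -1 <= x <= 1 ->
  Rabs (RI (fun y => w y ^ j * g y) (-1) x) <= 2 ^ j * C * w x ^ S j.
Proof.
  intros Hg HC H0.
  set (P := fun x => RI (fun y => w y ^ j * g y) (-1) x).
  assert (HD : forall x, is_derive P x (w x ^ j * g x)).
  { intros x; apply (derive_RI (fun y => w y ^ j * g y)); intros; cntw. }
  assert (HCpos : 0 <= C) by (eapply Rle_trans; [apply Rabs_pos | apply (HC 0); lra]).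
  assert (Hm : P (-1) = 0) by apply RI_point.
  assert (H1 : P 1 = 0) by exact H0.
  assert (Hj1 : 1 <= INR (S j)) by (rewrite S_INR; pose proof (pos_INR j); lra).
  assert (H2 : 0 <= 2 ^ j) by (apply pow_le; lra).
  assert (Hw1 : forall x, -1 <= x <= 1 -> Rabs (w x ^ j * g x) <= 2 ^ j * C * (1 + x) ^ j).
  { intros x Hx; rewrite Rabs_mult, (Rabs_right (w x ^ j)) by (apply Rle_ge, pow_le, w_nonneg; lra).
    replace (2 ^ j * C * (1 + x) ^ j) with ((2 * (1 + x)) ^ j * C) by (rewrite Rpow_mult_distr; ring).
    apply Rmult_le_compat; [apply pow_le, w_nonneg; lra | apply Rabs_pos | | now apply HC].
    apply pow_incr; split; [apply w_nonneg; lra | unfold w; nra]. }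
  assert (Hw2 : forall x, -1 <= x <= 1 -> Rabs (w x ^ j * g x) <= 2 ^ j * C * (1 - x) ^ j).
  { intros x Hx; rewrite Rabs_mult, (Rabs_right (w x ^ j)) by (apply Rle_ge, pow_le, w_nonneg; lra).
    replace (2 ^ j * C * (1 - x) ^ j) with ((2 * (1 - x)) ^ j * C) by (rewrite Rpow_mult_distr; ring).
    apply Rmult_le_compat; [apply pow_le, w_nonneg; lra | apply Rabs_pos | | now apply HC].
    apply pow_incr; split; [apply w_nonneg; lra | unfold w; nra]. }
  assert (Dp : forall s x, is_derive (fun y => 2 ^ j * C * (1 + y) ^ S j + s * P y) x
                 (2 ^ j * C * (INR (S j) * (1 + x) ^ j) + s * (w x ^ j * g x))).
  { intros s x; evar_last; [deriv | simpl pred; ring]. }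
  assert (Dm : forall s x, is_derive (fun y => - (2 ^ j * C * (1 - y) ^ S j) + s * P y) x
                 (2 ^ j * C * (INR (S j) * (1 - x) ^ j) + s * (w x ^ j * g x))).
  { intros s x; evar_last; [deriv | simpl pred; ring]. }
  assert (Pos1 : forall s x, Rabs s = 1 -> -1 <= x <= 1 ->
            0 <= 2 ^ j * C * (INR (S j) * (1 + x) ^ j) + s * (w x ^ j * g x)).
  { intros s x Hs Hx; specialize (Hw1 x Hx).
    pose proof (Rle_abs (- (s * (w x ^ j * g x)))) as Ha.
    rewrite Rabs_Ropp, Rabs_mult, Hs in Ha.
    assert (0 <= 2 ^ j * C * (1 + x) ^ j) by (apply Rmult_le_pos; [nra | apply pow_le; lra]).
    nra. }
  assert (Pos2 : forall s x, Rabs s = 1 -> -1 <= x <= 1 ->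
            0 <= 2 ^ j * C * (INR (S j) * (1 - x) ^ j) + s * (w x ^ j * g x)).
  { intros s x Hs Hx; specialize (Hw2 x Hx).
    pose proof (Rle_abs (- (s * (w x ^ j * g x)))) as Ha.
    rewrite Rabs_Ropp, Rabs_mult, Hs in Ha.
    assert (0 <= 2 ^ j * C * (1 - x) ^ j) by (apply Rmult_le_pos; [nra | apply pow_le; lra]).
    nra. }
  assert (R1 : Rabs 1 = 1) by apply Rabs_R1.
  assert (Rm1 : Rabs (-1) = 1) by (rewrite Rabs_left; lra).
  intros x Hx; change (Rabs (P x) <= 2 ^ j * C * w x ^ S j).
  assert (B1 : forall s, Rabs s = 1 -> 0 <= 2 ^ j * C * (1 + x) ^ S j + s * P x).
  { intros s Hs.
    pose proof (le_of_deriv_nonneg _ _ (-1) x ltac:(lra) (fun y _ => Dp s y)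
                  (fun y Hy => Pos1 s y Hs ltac:(lra))) as E.
    cbv beta in E; rewrite Hm in E; replace (1 + -1) with 0 in E by ring.
    rewrite pow_i in E by lia; lra. }
  assert (B2 : forall s, Rabs s = 1 -> 0 <= 2 ^ j * C * (1 - x) ^ S j - s * P x).
  { intros s Hs.
    pose proof (le_of_deriv_nonneg _ _ x 1 ltac:(lra) (fun y _ => Dm s y)
                  (fun y Hy => Pos2 s y Hs ltac:(lra))) as E.
    cbv beta in E; rewrite H1 in E; replace (1 - 1) with 0 in E by ring.
    rewrite pow_i in E by lia; lra. }
  assert (HA : 0 <= 2 ^ j * C) by nra.
  apply Rabs_le.
  destruct (Rle_dec x 0) as [Hx0 | Hx0].
  - assert ((1 + x) ^ S j <= w x ^ S j) by (apply pow_incr; unfold w; nra).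
    pose proof (B1 1 R1); pose proof (B1 (-1) Rm1); nra.
  - assert ((1 - x) ^ S j <= w x ^ S j) by (apply pow_incr; unfold w; nra).
    pose proof (B2 1 R1); pose proof (B2 (-1) Rm1); nra.
Qed.

Lemma locally_inside (P : R -> Prop) (x : R) :
  -1 < x < 1 -> (forall y, -1 < y < 1 -> P y) -> locally x P.
Proof.
  intros Hx H.
  assert (He : 0 < Rmin (x + 1) (1 - x)) by (apply Rmin_case; lra).
  exists (mkposreal _ He); intros y Hy; apply H.
  unfold ball in Hy; simpl in Hy; unfold AbsRing_ball, abs, minus, plus, opp in Hy; simpl in Hy.
  apply Rabs_def2 in Hy.
  pose proof (Rmin_l (x + 1) (1 - x)); pose proof (Rmin_r (x + 1) (1 - x)); lra.
Qed.

(** The primitive is O(w^(j+1)) by [prim_bound], so its quotient by w^j extends continuously by 0 to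
    the poles. *)
Lemma weighted_primitive (j : nat) (g : R -> R) :
  (forall x, continuity_pt g x) -> Int (fun x => w x ^ j * g x) = 0 ->
  exists e : R -> R,
    contI e /\ e 1 = 0 /\ e (-1) = 0 /\
    (forall x, -1 <= x <= 1 -> w x ^ j * e x = RI (fun y => w y ^ j * g y) (-1) x) /\
    (forall x, -1 < x < 1 -> is_derive e x (g x + 2 * INR j * x * e x / w x)).
Proof.
  intros Hg H0.
  destruct (contI_bounded g ltac:(intros x _; apply Hg)) as [C [HC HCg]].
  set (P := fun x => RI (fun y => w y ^ j * g y) (-1) x).
  assert (HD : forall x, is_derive P x (w x ^ j * g x)).
  { intros x; apply (derive_RI (fun y => w y ^ j * g y)); intros; cntw. }
  assert (HB : forall x, -1 <= x <= 1 -> Rabs (P x) <= 2 ^ j * C * w x ^ S j)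
    by (now apply prim_bound).
  set (q := fun x => P x / w x ^ j).
  set (e := fun x => if Rlt_dec (-1) x then if Rlt_dec x 1 then q x else 0 else 0).
  assert (He : forall x, -1 < x < 1 -> e x = q x).
  { intros x Hx; unfold e; destruct Rlt_dec; [destruct Rlt_dec |]; (reflexivity || lra). }
  assert (He1 : e 1 = 0) by (unfold e; destruct Rlt_dec; [destruct Rlt_dec |]; (reflexivity || lra)).
  assert (Hem1 : e (-1) = 0) by (unfold e; destruct Rlt_dec; (reflexivity || lra)).
  assert (HqD : forall x, -1 < x < 1 -> is_derive e x (g x + 2 * INR j * x * e x / w x)).
  { intros x Hx; pose proof (w_pos x Hx) as Hw.
    apply (is_derive_ext_loc (V := R_NormedModule) q).
    - apply locally_inside; [exact Hx | intros y Hy; now rewrite He].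
    - rewrite He by exact Hx; unfold q.
      evar_last.
      + apply is_derive_div; [apply HD | apply is_derive_wpow | apply pow_nonzero; lra].
      + destruct j as [|j]; [simpl; field; lra |].
        simpl pred; simpl pow; field; split; [apply pow_nonzero; lra | lra]. }
  assert (Hbd : forall x, Rabs (e x) <= 2 ^ j * C * Rabs (w x)).
  { intros x; assert (0 <= 2 ^ j * C) by (apply Rmult_le_pos; [apply pow_le; lra | exact HC]).
    pose proof (Rabs_pos (w x)).
    destruct (Rlt_dec (-1) x) as [Hx1 | Hx1]; [destruct (Rlt_dec x 1) as [Hx2 | Hx2] |].
    - rewrite He by lra; unfold q; specialize (HB x ltac:(lra)).
      pose proof (w_pos x ltac:(lra)) as Hw.
      assert (Hwj : 0 < w x ^ j) by (now apply pow_lt).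
      unfold Rdiv; rewrite Rabs_mult, Rabs_inv, (Rabs_right (w x ^ j)), (Rabs_right (w x)) by lra.
      apply (Rmult_le_reg_r (w x ^ j)); [exact Hwj |].
      rewrite Rmult_assoc, Rinv_l, Rmult_1_r by lra.
      simpl pow in HB; lra.
    - unfold e; destruct Rlt_dec; [destruct Rlt_dec; [lra |] |]; rewrite Rabs_R0; nra.
    - unfold e; destruct Rlt_dec; [lra |]; rewrite Rabs_R0; nra. }
  exists e; refine (conj _ (conj He1 (conj Hem1 (conj _ HqD)))).
  - intros x Hx.
    destruct (Req_dec x 1) as [-> | Hx1];
      [apply (cp_squeeze e w (2 ^ j * C)); (assumption || apply w_1 || apply cp_w) |].
    destruct (Req_dec x (-1)) as [-> | Hx2];
      [apply (cp_squeeze e w (2 ^ j * C)); (assumption || apply w_m1 || apply cp_w) |].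
    eapply cp_derive; apply HqD; lra.
  - intros x Hx; fold (P x).
    destruct (Req_dec x 1) as [-> | Hx1]; [rewrite He1, Rmult_0_r; symmetry; exact H0 |].
    destruct (Req_dec x (-1)) as [-> | Hx2]; [rewrite Hem1, Rmult_0_r; symmetry; apply RI_point |].
    pose proof (w_pos x ltac:(lra)).
    rewrite He by lra; unfold q; field; apply pow_nonzero; lra.
Qed.

(* Sum of squares: with [w^(j+1) e] the primitive of [w^(j+1) f],
   w^(j+2) (f' + l e / w)^2 + l w^(j+1) (f + l x e / w)^2 equals w^j d^2 - l w^(j+1) f^2 up to the
   derivative of 2 l w^(j+1) f e + l^2 x w^j e^2, where l = 2 j + 4. *)
Lemma poincare (j : nat) (f d : R -> R) :
  (forall x, continuity_pt f x) -> contI d ->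
  (forall x, -1 < x < 1 -> is_derive f x (d x / w x)) ->
  Int (fun x => w x ^ S j * f x) = 0 ->
  (2 * INR j + 4) * Int (fun x => w x ^ S j * f x ^ 2) <= Int (fun x => w x ^ j * d x ^ 2).
Proof.
  intros Hf Hd HD H0.
  destruct (weighted_primitive (S j) f Hf H0) as [e [Ce [E1 [Em1 [_ De]]]]].
  set (l := 2 * INR j + 4).
  assert (H : 0 <= Int (fun x => 1 * (w x ^ j * d x ^ 2) + - l * (w x ^ S j * f x ^ 2))
                + (2 * l * (w 1 ^ S j * f 1 * e 1) + l ^ 2 * (1 * w 1 ^ j * e 1 ^ 2))
                - (2 * l * (w (-1) ^ S j * f (-1) * e (-1)) + l ^ 2 * (-1 * w (-1) ^ j * e (-1) ^ 2))).
  { apply (Int_plus_incr _ (fun x => 2 * l * (w x ^ S j * f x * e x) + l ^ 2 * (x * w x ^ j * e x ^ 2))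
             (fun x =>
                2 * l * (- 2 * INR (S j) * x * w x ^ j * f x * e x + w x ^ S j * (d x / w x) * e x
                         + w x ^ S j * f x * (f x + 2 * INR (S j) * x * e x / w x))
                + l ^ 2 * (w x ^ j * e x ^ 2 - 2 * INR j * x ^ 2 * (w x ^ j / w x) * e x ^ 2
                           + 2 * x * w x ^ j * e x * (f x + 2 * INR (S j) * x * e x / w x)))).
    - intros x Hx; cntw.
    - intros x Hx; cntw.
    - intros x Hx; pose proof (w_pos x Hx) as Hw.
      evar_last.
      + deriv.
      + unfold zero, one; simpl pred.
        destruct j as [|j].
        * simpl; field; lra.
        * simpl pred; change (INR 2) with 2; simpl pow; unfold zero, one; simpl; field; lra.
    - intros x Hx; pose proof (w_pos x Hx) as Hw.
      match goal with |- 0 <= ?t =>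
        replace t with (w x ^ j * ((d x + l * e x) ^ 2 + l * w x * (f x + l * x * e x / w x) ^ 2)) end.
      + apply Rmult_le_pos; [apply pow_le; lra |].
        assert (0 < l) by (unfold l; pose proof (pos_INR j); lra).
        apply Rplus_le_le_0_compat; [apply pow2_ge_0 |].
        apply Rmult_le_pos; [nra | apply pow2_ge_0].
      + assert (Hl : INR j = (l - 4) / 2) by (unfold l; field).
        rewrite S_INR, Hl; simpl pow; field; lra. }
  rewrite E1, Em1, Int_lin in H by (intros x Hx; cntw).
  lra.
Qed.

(* [lower k e] is w^(-k) (w^(k+1) e)'. *)
Definition lower (k : nat) (e : R -> R) (x : R) : R :=
  w x * Derive e x - 2 * INR (S k) * x * e x.

Lemma lower_D (k : nat) (e : R -> R) (x : R) :
  ex_derive e x -> is_derive (fun y => w y ^ S k * e y) x (w x ^ k * lower k e x).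
Proof.
  intros H; evar_last.
  - apply (D_mult (fun y => w y ^ S k)); [apply is_derive_wpow | now apply Derive_correct].
  - unfold lower; simpl pred; simpl pow; ring.
Qed.

Lemma Ck_lower (j k : nat) (e : R -> R) : Ck (S j) e -> Ck j (lower k e).
Proof.
  intros H; pose proof (Ck_pred _ _ H); pose proof (Ck_Derive _ _ H).
  unfold lower; ckw.
Qed.

Lemma lower_norm (k : nat) (e : R -> R) :
  Ck 1 e ->
  Int (fun x => w x ^ k * lower k e x ^ 2)
  = Int (fun x => w x ^ S (S k) * Derive e x ^ 2)
    + 2 * INR (S k) * Int (fun x => w x ^ S k * e x ^ 2).
Proof.
  intros H.
  pose proof (Ck_cont _ _ H) as Ce; pose proof (Ck_cont_n 1 1 e H ltac:(lia)) as Cd.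
  pose proof (Ck_is_derive 1 0 e H ltac:(lia)) as De; simpl Derive_n in *.
  change (fun x => e x) with e in *; change (fun x => Derive e x) with (Derive e) in *.
  assert (E : Int (fun x => 1 * (w x ^ k * lower k e x ^ 2)
                + -1 * (w x ^ S (S k) * Derive e x ^ 2)
                + - (2 * INR (S k)) * (w x ^ S k * e x ^ 2)) = 0).
  { rewrite (Int_ftc (fun x => - (2 * INR (S k)) * (x * w x ^ S k * e x ^ 2))).
    - rewrite w_1, w_m1; simpl; ring.
    - intros x; evar_last.
      + deriv.
      + unfold lower, zero, one; simpl pred; change (INR 2) with 2; simpl; ring.
    - intros x _; unfold lower; cntw. }
  rewrite Int_lin3 in E by (intros x _; unfold lower; cntw).
  lra.
Qed.

(** Expand the square of (lower e)' + L e; integration by parts turns the cross term into minus the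
    norm of lower e. Equality means (lower e)' = - L e, so L should be the eigenvalue of the
    component for which no loss is wanted. *)
Lemma lower_step (k : nat) (L : R) (e : R -> R) :
  Ck 2 e ->
  2 * L * Int (fun x => w x ^ k * lower k e x ^ 2) - L ^ 2 * Int (fun x => w x ^ S k * e x ^ 2)
  <= Int (fun x => w x ^ S k * Derive (lower k e) x ^ 2).
Proof.
  intros H.
  pose proof (Ck_lower 1 k e H) as Hl.
  pose proof (Ck_cont _ _ Hl) as Cl; pose proof (Ck_cont_n 1 1 _ Hl ltac:(lia)) as Cd.
  pose proof (Ck_cont _ _ H) as Ce.
  assert (E : Int (fun x => 1 * (w x ^ k * lower k e x ^ 2)
                     + 1 * (w x ^ S k * (e x * Derive (lower k e) x))) = 0).
  { rewrite (Int_ftc (fun x => w x ^ S k * e x * lower k e x)).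
    - rewrite w_1, w_m1; simpl; ring.
    - intros x; evar_last.
      + apply D_mult; [apply lower_D; now destruct H |].
        apply Derive_correct; now destruct Hl.
      + simpl; ring.
    - intros x _; cntw. }
  rewrite Int_lin in E by (intros x _; cntw).
  assert (P : 0 <= Int (fun x => 1 * (w x ^ S k * Derive (lower k e) x ^ 2)
                + 2 * L * (w x ^ S k * (e x * Derive (lower k e) x))
                + L ^ 2 * (w x ^ S k * e x ^ 2))).
  { apply Int_ge_0; [intros x _; cntw |].
    intros x Hx; pose proof (pow_le _ (S k) (Rlt_le _ _ (w_pos x Hx))) as Hw.
    replace (_ + _) with (w x ^ S k * (Derive (lower k e) x + L * e x) ^ 2) by ring.
    apply Rmult_le_pos; [exact Hw | apply pow2_ge_0]. }
  rewrite Int_lin3 in P by (intros x _; cntw).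
  nra.
Qed.

(** Take L = mu + 2(k+1) in [lower_step]. By [lower_norm] and the assumed gap, L int w^(k+1) e^2 <=
    int w^k (lower e)^2, which absorbs half of the term linear in L. *)
Lemma lower_gap (k : nat) (mu : R) (e : R -> R) :
  Ck 2 e -> 0 <= mu ->
  mu * Int (fun x => w x ^ S k * e x ^ 2) <= Int (fun x => w x ^ S (S k) * Derive e x ^ 2) ->
  (mu + 2 * INR (S k)) * Int (fun x => w x ^ k * lower k e x ^ 2)
  <= Int (fun x => w x ^ S k * Derive (lower k e) x ^ 2).
Proof.
  intros H Hmu Hgap.
  pose proof (lower_norm k e (Ck_pred 1 e H)) as E1.
  pose proof (lower_step k (mu + 2 * INR (S k)) e H) as E2.
  pose proof (pos_INR (S k)); nra.
Qed.

(** Rung j is v^(j) / w^(n-j), a formula without division: it starts at G and ends at psi for j =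
    n. *)
Fixpoint ladder (n : nat) (u : R -> R) (j : nat) : R -> R :=
  match j with
  | O => Gfun u
  | S j' => lower (n - S j') (ladder n u j')
  end.

Lemma Ck_ladder (n : nat) (u : R -> R) (j : nat) :
  Ck (2 * n + 5) u -> (j <= 2 * n + 4)%nat -> Ck (2 * n + 4 - j) (ladder n u j).
Proof.
  intros Hu; induction j as [|j IH]; intros Hj.
  - rewrite Nat.sub_0_r; now apply Ck_G.
  - apply Ck_lower; replace (S (2 * n + 4 - S j)) with (2 * n + 4 - j)%nat by lia.
    apply IH; lia.
Qed.

Lemma ladder_v (n : nat) (u : R -> R) (j : nat) :
  Ck (2 * n + 5) u -> (j <= n)%nat ->
  forall x, w x ^ (n - j) * ladder n u j x = Derive_n (vfun n u) j x.
Proof.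
  intros Hu; induction j as [|j IH]; intros Hj x.
  - rewrite Nat.sub_0_r; symmetry; apply vfun_G.
  - assert (Hd : ex_derive (ladder n u j) x).
    { pose proof (Ck_ladder n u j Hu ltac:(lia)) as Hc.
      apply (Ck_le 1) in Hc; [| lia]; now destruct Hc. }
    simpl ladder; rewrite <- (is_derive_unique _ _ _ (lower_D (n - S j) (ladder n u j) x Hd)).
    simpl Derive_n; apply Derive_ext; intros t.
    replace (S (n - S j)) with (n - j)%nat by lia; apply IH; lia.
Qed.

(** On G the gap 2n + 2 is [poincare], since the mean of G against w^n is the integral of v. Passing
    from rung j to rung j + 1 adds 2(n - j) by [lower_gap]. *)
Lemma ladder_gap (n : nat) (u : R -> R) :
  (1 <= n)%nat -> Ck (2 * n + 5) u -> Int (vfun n u) = 0 ->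
  forall j k, (k + j)%nat = n ->
  (2 * INR n + 2 + INR j * (2 * INR n - INR j + 1))
    * Int (fun x => w x ^ k * ladder n u j x ^ 2)
  <= Int (fun x => w x ^ S k * Derive (ladder n u j) x ^ 2).
Proof.
  intros Hn Hu Hv; induction j as [|j IH]; intros k Hk.
  - rewrite Nat.add_0_r in Hk; subst k; simpl ladder.
    destruct n as [|p]; [lia |].
    pose proof (Ck_G (S p) u Hu) as HG.
    pose proof (Ck_cont _ _ HG) as CG.
    pose proof (Ck_cont_n _ 1 _ HG ltac:(lia)) as CdG.
    pose proof (poincare p (Gfun u) (fun x => w x * Derive (Gfun u) x) CG) as P.
    replace (2 * INR (S p) + 2 + INR 0 * (2 * INR (S p) - INR 0 + 1)) with (2 * INR p + 4)
      by (rewrite S_INR; simpl; ring).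
    rewrite (Int_ext (fun x => w x ^ S (S p) * _) (fun x => w x ^ p * (w x * Derive (Gfun u) x) ^ 2))
      by (intros; simpl; ring).
    apply P.
    + intros x _; cntw.
    + intros x Hx; pose proof (w_pos x Hx); evar_last.
      * apply (Ck_is_derive _ 0 _ HG); lia.
      * change (Derive_n (Gfun u) 1 x) with (Derive (Gfun u) x); field; lra.
    + rewrite <- Hv; apply Int_ext; intros; now rewrite vfun_G.
  - simpl ladder; replace (n - S j)%nat with k by lia.
    specialize (IH (S k) ltac:(lia)).
    assert (Hj : INR n = INR k + INR j + 1).
    { rewrite <- Hk, plus_INR, S_INR; ring. }
    replace (2 * INR n + 2 + INR (S j) * (2 * INR n - INR (S j) + 1))
      with ((2 * INR n + 2 + INR j * (2 * INR n - INR j + 1)) + 2 * INR (S k))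
      by (rewrite !S_INR, Hj; ring).
    apply lower_gap; [| | exact IH].
    + apply (Ck_le 2 (2 * n + 4 - j)); [lia | apply Ck_ladder; (assumption || lia)].
    + pose proof (pos_INR k); pose proof (pos_INR j); rewrite Hj; nra.
Qed.

Lemma psi_gap (n : nat) (u : R -> R) :
  (1 <= n)%nat -> Ck (2 * n + 5) u -> Int (vfun n u) = 0 ->
  (INR n + 1) * (INR n + 2) * E0 n u <= E1 n u.
Proof.
  intros Hn Hu Hv.
  pose proof (ladder_gap n u Hn Hu Hv n 0 eq_refl) as H.
  assert (E : ladder n u n = psi n u).
  { apply functional_extensionality; intros x; unfold psi.
    rewrite <- ladder_v by (assumption || lia); rewrite Nat.sub_diag; simpl; ring. }
  rewrite E in H.
  unfold E0, E1.
  rewrite (Int_ext (fun x => psi n u x ^ 2) (fun x => w x ^ 0 * psi n u x ^ 2)) by (intros; simpl; ring).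
  rewrite (Int_ext (fun x => w x * dpsi n u x ^ 2) (fun x => w x ^ 1 * Derive (psi n u) x ^ 2)).
  - eapply Rle_trans; [| exact H]; right; f_equal; ring.
  - intros x _; unfold dpsi, psi; simpl; ring.
Qed.

(** * Splitting a binomial power at the diagonal *)

Lemma Derive_n_add (k : nat) : forall f g x,
  Ck k f -> Ck k g -> Derive_n (fun y => f y + g y) k x = Derive_n f k x + Derive_n g k x.
Proof.
  induction k as [|k IH]; intros f g x Hf Hg; [reflexivity |].
  simpl; rewrite (Derive_ext _ (fun y => Derive_n f k y + Derive_n g k y))
    by (intros; apply IH; now apply Ck_pred).
  apply is_derive_unique, D_plus; apply (Ck_is_derive (S k)); (assumption || lia).
Qed.

Lemma Derive_n_lmul (k : nat) : forall c f x,
  Derive_n (fun y => c * f y) k x = c * Derive_n f k x.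
Proof.
  induction k as [|k IH]; intros c f x; [reflexivity |].
  simpl; rewrite (Derive_ext _ (fun y => c * Derive_n f k y)) by (intros; apply IH).
  apply Derive_scal.
Qed.

(** Polynomials of degree at most d, encoded by the vanishing derivative because this is the form in
    which integration by parts uses them. *)
Definition polydeg (d : nat) (f : R -> R) : Prop :=
  (forall k, Ck k f) /\ forall x, Derive_n f (S d) x = 0.

Lemma polydeg_over (d k : nat) (f : R -> R) :
  polydeg d f -> (d < k)%nat -> forall x, Derive_n f k x = 0.
Proof.
  intros [_ H]; induction 1 as [|k Hk IH]; [exact H |].
  intros x; simpl; rewrite (Derive_ext _ (fun _ => 0)) by exact IH.
  apply Derive_const.
Qed.

Lemma polydeg_const (c : R) : polydeg 0 (fun _ => c).
Proof. split; [intros k; apply Ck_const | intros x; simpl; apply Derive_const]. Qed.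

Lemma polydeg_linmul (a b : R) (d : nat) (f : R -> R) :
  polydeg d f -> polydeg (S d) (fun y => (a + b * y) * f y).
Proof.
  intros H; pose proof H as [Hc H0]; split.
  - intros k; specialize (Hc k); ckw.
  - intros x; rewrite Derive_n_linmul by apply Hc.
    rewrite (polydeg_over d _ f H) by lia; simpl pred; rewrite H0; ring.
Qed.

Lemma polydeg_linpow (a b : R) (p d : nat) (f : R -> R) :
  polydeg d f -> polydeg (p + d) (fun y => (a + b * y) ^ p * f y).
Proof.
  intros H; induction p as [|p IH].
  - simpl; replace (fun y => 1 * f y) with f by (apply functional_extensionality; intros; ring).
    exact H.
  - simpl plus; replace (fun y => (a + b * y) ^ S p * f y)
      with (fun y => (a + b * y) * ((a + b * y) ^ p * f y))
      by (apply functional_extensionality; intros; simpl; ring).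
    now apply polydeg_linmul.
Qed.

Lemma polydeg_sum (d m : nat) (f : nat -> R -> R) :
  (forall j, (j <= m)%nat -> polydeg d (f j)) ->
  polydeg d (fun y => sum_f_R0 (fun j => f j y) m).
Proof.
  intros H; induction m as [|m IH]; simpl; [apply H; lia |].
  destruct IH as [C1 Z1]; [intros; apply H; lia |].
  destruct (H (S m) ltac:(lia)) as [C2 Z2]; split.
  - intros k; apply Ck_plus; [apply C1 | apply C2].
  - intros x; rewrite (Derive_n_add (S d)) by (apply C1 || apply C2).
    rewrite Z1, Z2; ring.
Qed.

Lemma Derive_n_linpow_vanish (a b : R) (p k : nat) : forall (f : R -> R) (x : R),
  Ck k f -> a + b * x = 0 -> (k < p)%nat ->
  Derive_n (fun y => (a + b * y) ^ p * f y) k x = 0.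
Proof.
  revert k; induction p as [|p IH]; intros k f x Hf Hx Hk; [lia |].
  replace (fun y => (a + b * y) ^ S p * f y)
    with (fun y => (a + b * y) * ((a + b * y) ^ p * f y))
    by (apply functional_extensionality; intros; simpl; ring).
  rewrite Derive_n_linmul, Hx by ckw.
  destruct k as [|k]; [simpl; ring |].
  simpl pred; rewrite (IH k) by (first [assumption | lia | now apply Ck_pred]); ring.
Qed.

Lemma Derive_n_linpow_top (a b : R) (p : nat) : forall (f : R -> R) (x : R),
  Ck p f -> a + b * x = 0 ->
  Derive_n (fun y => (a + b * y) ^ p * f y) p x = INR (fact p) * b ^ p * f x.
Proof.
  induction p as [|p IH]; intros f x Hf Hx; [simpl; ring |].
  replace (fun y => (a + b * y) ^ S p * f y)
    with (fun y => (a + b * y) * ((a + b * y) ^ p * f y))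
    by (apply functional_extensionality; intros; simpl; ring).
  rewrite Derive_n_linmul, Hx by ckw.
  simpl pred; rewrite IH by (first [assumption | now apply Ck_pred]).
  rewrite fact_simpl, mult_INR; simpl pow; ring.
Qed.

(** [Xl] is (1 + x)(1 - y) and [Yl] is (1 - x)(1 + y), written as affine functions of y to match the
    lemmas on powers of such functions. Their difference is 2x - 2y, their sum 2(1 - x y), their
    product w(x) w(y). *)
Definition Xl (x y : R) : R := (1 + x) + - (1 + x) * y.
Definition Yl (x y : R) : R := (1 - x) + (1 - x) * y.

(** In (X - Y)^M the terms of index below n contain X^(M-n+1) and the others Y^n. These powers are
    taken out: they carry the vanishing at y = 1 and at y = -1. *)
Definition lo_part (M n : nat) (X Y : R) : R :=
  sum_f_R0 (fun j => (-1) ^ j * Binomial.C M j * (X ^ (pred n - j) * Y ^ j)) (pred n).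

Definition hi_part (M n : nat) (X Y : R) : R :=
  sum_f_R0 (fun i => (-1) ^ (n + i) * Binomial.C M (n + i) * (X ^ (M - n - i) * Y ^ i)) (M - n).

(* [(X - Y)^M] cut after its first [n] terms. *)
Definition Bp (M n : nat) (x y : R) : R := Xl x y ^ (S (M - n)) * lo_part M n (Xl x y) (Yl x y).
Definition Ap (M n : nat) (x y : R) : R := Yl x y ^ n * hi_part M n (Xl x y) (Yl x y).

Lemma split_binomial (M n : nat) (X Y : R) :
  (1 <= n <= M)%nat ->
  Y ^ n * hi_part M n X Y + X ^ (S (M - n)) * lo_part M n X Y = (X - Y) ^ M.
Proof.
  intros Hn; replace (X - Y) with (- Y + X) by ring.
  rewrite binomial, (tech2 _ (pred n) M) by lia.
  rewrite Rplus_comm; f_equal.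
  - unfold lo_part; rewrite scal_sum; apply sum_eq; intros i Hi.
    replace (- Y) with (-1 * Y) by ring; rewrite Rpow_mult_distr.
    replace (M - i)%nat with (S (M - n) + (pred n - i))%nat by lia.
    rewrite pow_add; ring.
  - unfold hi_part; rewrite scal_sum.
    replace (M - S (pred n))%nat with (M - n)%nat by lia.
    apply sum_eq; intros i Hi.
    replace (S (pred n) + i)%nat with (n + i)%nat by lia.
    replace (- Y) with (-1 * Y) by ring; rewrite Rpow_mult_distr, (pow_add Y).
    replace (M - (n + i))%nat with (M - n - i)%nat by lia; ring.
Qed.

Lemma Ap_Bp (M n : nat) (x y : R) :
  (1 <= n <= M)%nat -> Ap M n x y + Bp M n x y = (2 * x + -2 * y) ^ M.
Proof.
  intros Hn; unfold Ap, Bp; rewrite split_binomial by assumption.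
  f_equal; unfold Xl, Yl; ring.
Qed.

Lemma polydeg_le (d d' : nat) (f : R -> R) : (d <= d')%nat -> polydeg d f -> polydeg d' f.
Proof.
  intros Hd H; pose proof H as [Hc _]; split; [exact Hc |].
  intros x; apply (polydeg_over d); (assumption || lia).
Qed.

Lemma polydeg_mono (x c : R) (a b : nat) :
  polydeg (a + b) (fun y => c * (Xl x y ^ a * Yl x y ^ b)).
Proof.
  replace (fun y => c * (Xl x y ^ a * Yl x y ^ b))
    with (fun y => Xl x y ^ a * (Yl x y ^ b * c))
    by (apply functional_extensionality; intros; ring).
  apply (polydeg_linpow (1 + x) (- (1 + x)) a b).
  apply (polydeg_le (b + 0)); [lia |].
  apply (polydeg_linpow (1 - x) (1 - x)), polydeg_const.
Qed.

Lemma polydeg_lo (M n : nat) (x : R) :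
  (1 <= n)%nat -> polydeg (pred n) (fun y => lo_part M n (Xl x y) (Yl x y)).
Proof.
  intros Hn; apply polydeg_sum; intros j Hj.
  apply (polydeg_le (pred n - j + j)); [lia | apply polydeg_mono].
Qed.

Lemma polydeg_hi (M n : nat) (x : R) :
  polydeg (M - n) (fun y => hi_part M n (Xl x y) (Yl x y)).
Proof.
  apply polydeg_sum; intros j Hj.
  apply (polydeg_le (M - n - j + j)); [lia | apply polydeg_mono].
Qed.

Lemma polydeg_Ap (M n : nat) (x : R) : (1 <= n <= M)%nat -> polydeg M (Ap M n x).
Proof.
  intros Hn; apply (polydeg_le (n + (M - n))); [lia |].
  apply (polydeg_linpow (1 - x) (1 - x)), polydeg_hi.
Qed.

Lemma polydeg_Bp (M n : nat) (x : R) : (1 <= n <= M)%nat -> polydeg M (Bp M n x).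
Proof.
  intros Hn; apply (polydeg_le (S (M - n) + pred n)); [lia |].
  apply (polydeg_linpow (1 + x) (- (1 + x))), polydeg_lo; lia.
Qed.

Lemma Ap_vanish (M n k : nat) (x : R) : (k < n)%nat -> Derive_n (Ap M n x) k (-1) = 0.
Proof.
  intros Hk; apply (Derive_n_linpow_vanish (1 - x) (1 - x) n k
    (fun y => hi_part M n (Xl x y) (Yl x y))); [| ring | assumption].
  apply polydeg_hi.
Qed.

Lemma Bp_vanish (M n k : nat) (x : R) :
  (1 <= n <= M)%nat -> (k <= M - n)%nat -> Derive_n (Bp M n x) k 1 = 0.
Proof.
  intros Hn Hk; apply (Derive_n_linpow_vanish (1 + x) (- (1 + x)) (S (M - n)) k
    (fun y => lo_part M n (Xl x y) (Yl x y))); [| ring | lia].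
  apply polydeg_lo; lia.
Qed.

Lemma Derive_n_diag (M k : nat) (x : R) :
  (k <= M)%nat ->
  Derive_n (fun y => (2 * x + -2 * y) ^ M) k x = if Nat.eq_dec k M then (-2) ^ M * INR (fact M) else 0.
Proof.
  intros Hk.
  replace (fun y => (2 * x + -2 * y) ^ M) with (fun y => (2 * x + -2 * y) ^ M * 1)
    by (apply functional_extensionality; intros; ring).
  destruct Nat.eq_dec as [-> | Hne].
  - rewrite (Derive_n_linpow_top (2 * x) (-2) M (fun _ => 1)) by (try apply Ck_const; ring); ring.
  - apply (Derive_n_linpow_vanish (2 * x) (-2) M k (fun _ => 1)); [apply Ck_const | ring | lia].
Qed.

Lemma Derive_n_ApBp (M n k : nat) (x : R) :
  (1 <= n <= M)%nat -> (k <= M)%nat ->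
  Derive_n (Ap M n x) k x + Derive_n (Bp M n x) k x
  = if Nat.eq_dec k M then (-2) ^ M * INR (fact M) else 0.
Proof.
  intros Hn Hk; rewrite <- (Derive_n_diag M k x Hk), <- (Derive_n_add k (Ap M n x) (Bp M n x) x)
    by (now apply polydeg_Ap || now apply polydeg_Bp).
  apply Derive_n_ext; intros y; now apply Ap_Bp.
Qed.

(** * The Green representation obtained from the two parts *)

Lemma bdry_add_r (k : nat) : forall f g h x,
  Ck k g -> Ck k h -> bdry k f (fun y => g y + h y) x = bdry k f g x + bdry k f h x.
Proof.
  induction k as [|k IH]; intros f g h x Hg Hh; cbn [bdry]; [ring |].
  replace (Derive (fun y => g y + h y)) with (fun y => Derive g y + Derive h y).
  - rewrite IH by (now apply Ck_Derive); ring.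
  - apply functional_extensionality; intros y; symmetry; destruct Hg, Hh.
    now apply Derive_plus.
Qed.

Lemma bdry_add_l (k : nat) : forall f g h x,
  Ck k f -> Ck k g -> bdry k (fun y => f y + g y) h x = bdry k f h x + bdry k g h x.
Proof.
  induction k as [|k IH]; intros f g h x Hf Hg; [cbn [bdry]; ring |].
  change (Derive_n (fun y => f y + g y) (S k) x * h x - bdry k (fun y => f y + g y) (Derive h) x
    = Derive_n f (S k) x * h x - bdry k f (Derive h) x
      + (Derive_n g (S k) x * h x - bdry k g (Derive h) x)).
  rewrite Derive_n_add, IH by (assumption || now apply Ck_pred); ring.
Qed.

Lemma Ck_Derive_n_poly (d : nat) (f : R -> R) (l k : nat) : polydeg d f -> Ck k (Derive_n f l).
Proof. intros [H _]; apply Ck_Derive_n, H. Qed.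

(** The two parts add up to (2x - 2y)^M, of whose derivatives up to order M only the last is nonzero
    at y = x. *)
Lemma bdry_diag (M n k l : nat) (f : R -> R) (x : R) :
  (1 <= n <= M)%nat -> (k + l)%nat = M ->
  bdry k f (Derive_n (Ap M n x) l) x + bdry k f (Derive_n (Bp M n x) l) x
  = (-1) ^ k * (f x * ((-2) ^ M * INR (fact M))).
Proof.
  intros Hn Hkl.
  pose proof (polydeg_Ap M n x Hn) as PA; pose proof (polydeg_Bp M n x Hn) as PB.
  rewrite <- bdry_add_r by (eapply Ck_Derive_n_poly; eassumption).
  replace (fun y => Derive_n (Ap M n x) l y + Derive_n (Bp M n x) l y)
    with (Derive_n (fun y => (2 * x + -2 * y) ^ M) l).
  2:{ apply functional_extensionality; intros y; rewrite <- Derive_n_add by (apply PA || apply PB).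
      apply Derive_n_ext; intros t; symmetry; now apply Ap_Bp. }
  rewrite (bdry_single k k) by
    (first [lia | intros i Hi Hne; rewrite Derive_n_comp, Derive_n_diag by lia;
      destruct Nat.eq_dec; [lia | ring]]).
  rewrite Nat.sub_diag, Derive_n_comp, Derive_n_diag by lia.
  destruct Nat.eq_dec; [reflexivity | lia].
Qed.

(* The Green function of the (k+1)-st derivative, written with the two parts of
   [(2x - 2y)^M]: all boundary terms at [x] but one cancel. *)
Lemma split_rep (M n k l : nat) (f : R -> R) (x : R) :
  (1 <= n <= M)%nat -> (k + l)%nat = M -> -1 <= x <= 1 -> Ck (S k) f ->
  RI (fun y => Derive_n f (S k) y * Derive_n (Ap M n x) l y) (-1) x
  - RI (fun y => Derive_n f (S k) y * Derive_n (Bp M n x) l y) x 1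
  = (-1) ^ k * (f x * ((-2) ^ M * INR (fact M)))
    - bdry k f (Derive_n (Ap M n x) l) (-1) - bdry k f (Derive_n (Bp M n x) l) 1.
Proof.
  intros Hn Hkl Hx Hf.
  pose proof (polydeg_Ap M n x Hn) as PA; pose proof (polydeg_Bp M n x Hn) as PB.
  rewrite !parts by (first [lra | assumption | eapply Ck_Derive_n_poly; eassumption]).
  rewrite <- (bdry_diag M n k l f x Hn Hkl).
  (* Since k + l = M, the order k + 1 + l exceeds the degree of either part. *)
  assert (Z : forall g a b, a <= b -> polydeg M g ->
    RI (fun y => f y * Derive_n (Derive_n g l) (S k) y) a b = 0).
  { intros g a b Hab Hg; rewrite (RI_ext _ (fun y => 0 * 0)) by
      (first [assumption | intros y _; rewrite Derive_n_comp, (polydeg_over M _ g Hg) by lia; ring]).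
    rewrite RI_scal; [ring | apply ex_RInt_const]. }
  rewrite !Z by (assumption || lra); ring.
Qed.

Lemma alt_binomial (M k : nat) :
  (k <= M)%nat ->
  sum_f_R0 (fun i => (-1) ^ i * Binomial.C (S M) i) k = (-1) ^ k * Binomial.C M k.
Proof.
  induction k as [|k IH]; intros Hk.
  - simpl; rewrite !C_n_0; reflexivity.
  - rewrite tech5, IH, <- pascal by lia; simpl pow; ring.
Qed.

(** On the diagonal X = Y = w(x), so [Bp] is a power of w times a partial alternating sum of
    binomial coefficients, and [Ap] is its opposite because their sum vanishes there. *)
Lemma Ap_diag (n : nat) (x : R) :
  Ap (2 * n + 1) (S n) x x = (-1) ^ S n * Binomial.C (2 * n) n * w x ^ (2 * n + 1).
Proof.
  pose proof (Ap_Bp (2 * n + 1) (S n) x x ltac:(lia)) as E.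
  replace (2 * x + -2 * x) with 0 in E by ring; rewrite pow_i in E by lia.
  enough (EB : Bp (2 * n + 1) (S n) x x = (-1) ^ n * Binomial.C (2 * n) n * w x ^ (2 * n + 1)).
  { rewrite EB in E; rewrite <- (tech_pow_Rmult (-1) n); lra. }
  unfold Bp, lo_part; replace (Xl x x) with (w x) by (unfold w, Xl; ring).
  replace (Yl x x) with (w x) by (unfold w, Yl; ring).
  rewrite <- (alt_binomial (2 * n) n) by lia.
  replace (2 * n + 1 - S n)%nat with n by lia; replace (2 * n + 1)%nat with (S (2 * n)) by lia.
  simpl pred; replace (S (2 * n)) with (S n + n)%nat by lia; rewrite pow_add.
  rewrite (sum_eq _ (fun j => (-1) ^ j * Binomial.C (S n + n) j * w x ^ n)).
  - rewrite <- scal_sum; ring.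
  - intros i Hi; rewrite <- pow_add; do 2 f_equal; lia.
Qed.

(** Each squared norm reduces to its boundary term at x. Derivatives of A + B of order at most 2p
    vanish there, so the B-B term may be replaced by minus the A-B term; the A-A and A-B terms
    together are then given by [bdry_diag]. *)
Lemma split_norm (p : nat) (x : R) :
  -1 <= x <= 1 ->
  RI (fun y => Derive_n (Ap (2 * p + 1) (S p) x) (S p) y ^ 2) (-1) x
  + RI (fun y => Derive_n (Bp (2 * p + 1) (S p) x) (S p) y ^ 2) x 1
  = (-1) ^ p * (Ap (2 * p + 1) (S p) x x * ((-2) ^ (2 * p + 1) * INR (fact (2 * p + 1)))).
Proof.
  intros Hx.
  set (M := (2 * p + 1)%nat); assert (Hn : (1 <= S p <= M)%nat) by (unfold M; lia).
  pose proof (polydeg_Ap M (S p) x Hn) as PA; pose proof (polydeg_Bp M (S p) x Hn) as PB.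
  set (A := Ap M (S p) x) in *; set (B := Bp M (S p) x) in *.
  assert (Z : forall g a b, a <= b -> polydeg M g ->
    RI (fun y => Derive_n g (S p) y ^ 2) a b
    = bdry p g (Derive_n g (S p)) b - bdry p g (Derive_n g (S p)) a).
  { intros g a b Hab Hg.
    rewrite (RI_ext _ (fun y => Derive_n g (S p) y * Derive_n g (S p) y)) by (intros; (assumption || ring)).
    rewrite parts by (first [assumption | apply Hg | eapply Ck_Derive_n_poly; eassumption]).
    rewrite (RI_ext (fun y => g y * _) (fun y => 0 * 0)) by
      (first [assumption | intros y _; rewrite Derive_n_comp, (polydeg_over M _ g Hg) by (unfold M; lia); ring]).
    rewrite RI_scal; [ring | apply ex_RInt_const]. }
  rewrite !Z by (assumption || lra).
  rewrite (bdry_zero p A _ (-1)) by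
    (intros i Hi; unfold A; rewrite Ap_vanish by lia; ring).
  rewrite (bdry_zero p B _ 1) by
    (intros i Hi; unfold B; rewrite Bp_vanish by (unfold M; lia); ring).
  pose proof (bdry_diag M (S p) p (S p) A x Hn ltac:(unfold M; lia)) as E.
  fold A B in E; rewrite <- E.
  assert (E2 : bdry p A (Derive_n B (S p)) x + bdry p B (Derive_n B (S p)) x = 0).
  { rewrite <- bdry_add_l by (apply PA || apply PB).
    apply bdry_zero; intros i Hi; rewrite Derive_n_add by (apply PA || apply PB).
    unfold A, B; rewrite Derive_n_ApBp by (unfold M; lia).
    destruct Nat.eq_dec; [unfold M in *; lia | ring]. }
  lra.
Qed.

(** Up to a factor, A to the left of x and -B to its right form the reproducing kernel at x for the
    norm int (f^(p+1))^2 on functions vanishing with p derivatives at the poles. *)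
Lemma split_half (p : nat) (f : R -> R) (x : R) :
  -1 <= x <= 1 -> Ck (S p) f ->
  (forall i a, (i <= p)%nat -> w a = 0 -> Derive_n f i a = 0) ->
  RI (fun y => Derive_n f (S p) y * Derive_n (Ap (2 * p + 1) (S p) x) (S p) y) (-1) x
  - RI (fun y => Derive_n f (S p) y * Derive_n (Bp (2 * p + 1) (S p) x) (S p) y) x 1
  = (-1) ^ p * (f x * ((-2) ^ (2 * p + 1) * INR (fact (2 * p + 1)))).
Proof.
  intros Hx Hf H0; rewrite split_rep by (assumption || lia).
  rewrite !bdry_zero by
    (intros i Hi; rewrite H0 by (first [lia | apply w_1 | apply w_m1]); ring).
  ring.
Qed.

(** * Pointwise control of v by its energy *)

Lemma sign_even (p : nat) : (-1) ^ p * (-2) ^ (2 * p + 1) = - ((-1) ^ p * 2 ^ (2 * p + 1)).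
Proof.
  replace (-2) with (-1 * 2) by ring; rewrite Rpow_mult_distr.
  replace (2 * p + 1)%nat with (S (2 * p)) at 1 by lia; rewrite pow_1_odd; ring.
Qed.

Lemma sign_sq (p : nat) : (-1) ^ p * (-1) ^ p = 1.
Proof. rewrite <- Rpow_mult_distr; replace (-1 * -1) with 1 by ring; apply pow1. Qed.

Lemma RI_sq3 (f g h : R -> R) (a b c d : R) :
  a <= b -> (forall x, continuity_pt f x) -> (forall x, continuity_pt g x) ->
  (forall x, continuity_pt h x) ->
  0 <= RI (fun y => f y ^ 2) a b + c ^ 2 * RI (fun y => g y ^ 2) a b
    + d ^ 2 * RI (fun y => h y ^ 2) a b + 2 * c * RI (fun y => f y * g y) a b
    + 2 * d * RI (fun y => f y * h y) a b + 2 * (c * d) * RI (fun y => h y * g y) a b.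
Proof.
  intros Hab Hf Hg Hh.
  assert (X : forall k, (forall x, continuity_pt k x) -> ex_RInt k a b)
    by (intros; apply ex_RInt_cont; auto).
  assert (P : 0 <= RI (fun y => (f y + c * g y + d * h y) ^ 2) a b).
  { apply RInt_ge_0; [assumption | apply X; intros; cnt | intros; apply pow2_ge_0]. }
  rewrite (RI_ext _ (fun y => f y ^ 2 + c ^ 2 * g y ^ 2 + d ^ 2 * h y ^ 2 + 2 * c * (f y * g y)
            + 2 * d * (f y * h y) + 2 * (c * d) * (h y * g y))) in P by (intros; (assumption || ring)).
  rewrite !RI_plus, !RI_scal in P by (apply X; intros; cnt).
  exact P.
Qed.

Lemma RI_split (f : R -> R) (x : R) :
  (forall y, continuity_pt f y) -> -1 <= x <= 1 -> RI f (-1) x + RI f x 1 = Int f.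
Proof.
  intros Hf Hx; apply RI_Chasles; apply ex_RInt_cont; auto; lra.
Qed.

(* Cauchy-Schwarz for the representation of [v x], with the kernel projected
   orthogonally to [(w^n)^(n)]; the latter is orthogonal to [psi] because [Int v = 0]. *)
Lemma trace_bound (p : nat) (u : R -> R) (x : R) :
  Ck (2 * S p + 5) u -> Int (vfun (S p) u) = 0 -> 0 < E0 (S p) u -> -1 <= x <= 1 ->
  vfun (S p) u x ^ 2
  <= E0 (S p) u * (Binomial.C (2 * p) p / (2 ^ (2 * p + 1) * INR (fact (2 * p + 1)))
                     * w x ^ (2 * p + 1)
                   - w x ^ (2 * p + 2) / (INR (fact (2 * p + 2)) * mass (S p))).
Proof.
  intros Hu Hv HE Hx.
  pose proof (Ck_v (S p) u Hu) as Hvk.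
  assert (Cv : Ck (S p) (vfun (S p) u)) by (apply (Ck_le _ (2 * S p + 4)); [lia | assumption]).
  set (f0 := fun y => w y ^ S p).
  assert (C0 : forall k, Ck k f0) by (intros k; unfold f0; ckw).
  assert (V0 : forall i a, (i <= p)%nat -> w a = 0 -> Derive_n f0 i a = 0).
  { intros i a Hi Ha; unfold f0.
    replace (fun y => w y ^ S p) with (fun y => w y ^ S p * 1)
      by (apply functional_extensionality; intros; ring).
    apply Derive_n_wpow_vanish; [apply Ck_const | assumption | lia]. }
  assert (VV : forall i a, (i <= p)%nat -> w a = 0 -> Derive_n (vfun (S p) u) i a = 0)
    by (intros; apply v_vanish; (assumption || lia)).
  set (K := 2 ^ (2 * p + 1) * INR (fact (2 * p + 1))).
  assert (HK : 0 < K) by (apply Rmult_lt_0_compat; [apply pow_lt; lra | apply INR_fact_lt_0]).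
  set (N0 := INR (fact (2 * p + 2)) * mass (S p)).
  assert (HN : 0 < N0) by (apply Rmult_lt_0_compat; [apply INR_fact_lt_0 | apply mass_pos]).
  set (e := - (-1) ^ p).
  assert (He : e * e = 1) by (unfold e; rewrite <- (sign_sq p); ring).
  assert (Hsg : forall t, (-1) ^ p * (t * ((-2) ^ (2 * p + 1) * INR (fact (2 * p + 1)))) = e * K * t).
  { intros t; transitivity ((-1) ^ p * (-2) ^ (2 * p + 1) * (t * INR (fact (2 * p + 1)))); [ring |].
    rewrite sign_even; unfold e, K; ring. }
  pose proof (split_half p _ x Hx Cv VV) as S1.
  pose proof (split_half p _ x Hx (C0 _) V0) as S2.
  pose proof (split_norm p x Hx) as S3.
  rewrite Hsg in S1, S2, S3; rewrite Ap_diag in S3.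
  replace (e * K * ((-1) ^ S p * Binomial.C (2 * p) p * w x ^ (2 * p + 1)))
    with (K * Binomial.C (2 * p) p * w x ^ (2 * p + 1)) in S3
    by (rewrite <- tech_pow_Rmult; replace ((-1) ^ p) with (- e) by (unfold e; ring);
        transitivity (e * e * (K * Binomial.C (2 * p) p * w x ^ (2 * p + 1))); [rewrite He; ring | ring]).
  set (A := Derive_n (Ap (2 * p + 1) (S p) x) (S p)) in *.
  set (B := Derive_n (Bp (2 * p + 1) (S p) x) (S p)) in *.
  set (q := psi (S p) u); set (q0 := Derive_n f0 (S p)) in *.
  change (Derive_n (vfun (S p) u) (S p)) with q in S1.
  assert (CA : forall y, continuity_pt A y).
  { apply (Ck_cont 0), (Ck_Derive_n_poly (2 * p + 1)), polydeg_Ap; lia. }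
  assert (CB : forall y, continuity_pt B y).
  { apply (Ck_cont 0), (Ck_Derive_n_poly (2 * p + 1)), polydeg_Bp; lia. }
  assert (Cq : forall y, continuity_pt q y) by (now apply cp_psi).
  assert (Cq0 : forall y, continuity_pt q0 y) by (apply (Ck_cont_n (S p)); [apply C0 | lia]).
  (* Moving n = p + 1 derivatives onto q0 produces (w^n)^(2n), a constant; pairing with q0 therefore
     gives a multiple of the mean, which is 0 for v. *)
  assert (Ptop : forall g, Ck (S p) g -> (forall i a, (i <= p)%nat -> w a = 0 -> Derive_n g i a = 0) ->
    Int (fun y => Derive_n g (S p) y * q0 y) = INR (fact (2 * p + 2)) * Int g).
  { intros g Cg Vg; unfold q0; rewrite Int_parts.
    - rewrite (Int_ext _ (fun y => (-1) ^ S p * INR (fact (2 * p + 2)) * g y)).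
      + rewrite Int_scal by (intros y _; apply (Ck_cont _ _ Cg)).
        rewrite <- !Rmult_assoc, sign_sq; ring.
      + intros y _; rewrite Derive_n_comp; replace (S p + S p)%nat with (2 * S p)%nat by lia.
        unfold f0; rewrite Derive_n_wpow_top; replace (2 * S p)%nat with (2 * p + 2)%nat by lia; ring.
    - assumption.
    - apply Ck_Derive_n, C0.
    - intros i a Hi Ha; rewrite Vg by (assumption || lia); ring. }
  pose proof (Ptop _ (C0 _) V0) as T0; pose proof (Ptop _ Cv VV) as T1.
  rewrite Hv, Rmult_0_r in T1; fold N0 in T0; change (Derive_n f0 (S p)) with q0 in T0.
  change (Derive_n (vfun (S p) u) (S p)) with q in T1.
  change (INR (fact (2 * p + 2)) * Int f0) with N0 in T0.
  assert (T0' : Int (fun y => q0 y ^ 2) = N0) by (rewrite <- T0; apply Int_ext; intros; ring).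
  (* The integral of (psi + c k + d q0)^2, where the kernel k is A to the left of x and -B to its
     right; this is why c changes sign between [P1] and [P2]. *)
  assert (Q : forall c d, 0 <= E0 (S p) u + c ^ 2 * (K * Binomial.C (2 * p) p * w x ^ (2 * p + 1))
     + d ^ 2 * N0 + 2 * c * (e * K * vfun (S p) u x) + 2 * (c * d) * (e * K * f0 x)).
  { intros c d.
    pose proof (RI_sq3 q A q0 (-1) x c d ltac:(lra) Cq CA Cq0) as P1.
    pose proof (RI_sq3 q B q0 x 1 (- c) d ltac:(lra) Cq CB Cq0) as P2.
    pose proof (RI_split (fun y => q y ^ 2) x ltac:(intros; cnt) Hx) as I1.
    pose proof (RI_split (fun y => q0 y ^ 2) x ltac:(intros; cnt) Hx) as I2.
    pose proof (RI_split (fun y => q y * q0 y) x ltac:(intros; cnt) Hx) as I3.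
    change (Int (fun y => q y ^ 2)) with (E0 (S p) u) in I1.
    rewrite T0' in I2; rewrite T1 in I3.
    rewrite <- S1, <- S2, <- S3, <- I1, <- I2.
    replace (RI (fun y => q y * q0 y) x 1) with (- RI (fun y => q y * q0 y) (-1) x) in P2 by lra.
    lra. }
  set (CC := Binomial.C (2 * p) p) in *; set (E := E0 (S p) u) in *; set (v := vfun (S p) u x) in *.
  assert (Hf0 : f0 x ^ 2 = w x ^ (2 * p + 2)).
  { unfold f0; rewrite <- pow_mult; f_equal; lia. }
  rewrite <- Hf0; set (W := w x ^ (2 * p + 1)) in *; set (f := f0 x) in *.
  (* If v(x) = 0 the claim is that the bracket is nonnegative: a negative one would contradict [Q]
     for large c. Otherwise c = - e E / (K v), which avoids dividing by the bracket, and d is the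
     minimiser for this c. *)
  destruct (Req_dec v 0) as [Hv0 | Hv0].
  - rewrite Hv0, pow_i by lia.
    assert (HQ : forall s, 0 <= E + s ^ 2 * (K ^ 2 * (CC / K * W - f ^ 2 / N0))).
    { intros s; pose proof (Q s (- (s * e * K * f / N0))) as H.
      rewrite Hv0 in H; match goal with |- 0 <= ?t => replace t with
        (E + s ^ 2 * (K * CC * W) + (e * e) * (s ^ 2 * K ^ 2 * f ^ 2 / N0 - 2 * (s ^ 2 * K ^ 2 * f ^ 2 / N0)))
        by (rewrite He; field; lra) end.
      eapply Rle_trans; [exact H | right; field; lra]. }
    set (r := CC / K * W - f ^ 2 / N0) in *.
    destruct (Rle_dec 0 r) as [Hr | Hr]; [nra |].
    exfalso; pose proof (HQ (sqrt ((E + 1) / (K ^ 2 * - r)))) as H.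
    assert (0 < K ^ 2 * - r) by (apply Rmult_lt_0_compat; [nra | lra]).
    rewrite pow2_sqrt in H by (apply Rlt_le, Rdiv_lt_0_compat; lra).
    replace ((E + 1) / (K ^ 2 * - r) * (K ^ 2 * r)) with (- (E + 1)) in H by (field; split; nra).
    lra.
  - pose proof (Q (- (e * E) / (K * v)) (E * f / (N0 * v))) as H.
    replace (E + (- (e * E) / (K * v)) ^ 2 * (K * CC * W) + (E * f / (N0 * v)) ^ 2 * N0
      + 2 * (- (e * E) / (K * v)) * (e * K * v)
      + 2 * (- (e * E) / (K * v) * (E * f / (N0 * v))) * (e * K * f))
      with (E + (e * e) * (E ^ 2 * CC * W / (K * v ^ 2)) + E ^ 2 * f ^ 2 / (N0 * v ^ 2)
            - (e * e) * (2 * E) - (e * e) * (2 * E ^ 2 * f ^ 2 / (N0 * v ^ 2))) in H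
      by (field; repeat split; lra).
    rewrite He in H.
    assert (Hv2 : 0 < v ^ 2) by nra.
    apply (Rmult_le_compat_r (v ^ 2 / E)) in H; [| apply Rlt_le, Rdiv_lt_0_compat; lra].
    rewrite Rmult_0_l in H.
    match type of H with 0 <= ?t =>
      replace t with (E * (CC / K * W - f ^ 2 / N0) - v ^ 2) in H by (field; repeat split; nra) end.
    lra.
Qed.

(** * The Green function *)

(* For [M = 2n] the two parts of the split binomial, divided by [(-1)^n C(2n, n) (X Y)^n], are
   [Hpol (Y / X)] and [Hpol (X / Y) - 1]; [phip] is [2 Hpol - 1] as a function of
   [T = (X - Y) / (X + Y)]. *)
Definition hco (n i : nat) : R := (-1) ^ i * Binomial.C (2 * n) (n + i) / Binomial.C (2 * n) n.
Definition Hpol (n : nat) (z : R) : R := sum_f_R0 (fun i => hco n i * z ^ i) n.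
Definition dHpol (n : nat) (z : R) : R := sum_f_R0 (fun i => hco n i * (INR i * z ^ pred i)) n.

Lemma C_pos (n k : nat) : (k <= n)%nat -> 0 < Binomial.C n k.
Proof.
  intros H; unfold Binomial.C; apply Rdiv_lt_0_compat;
    [| apply Rmult_lt_0_compat]; apply INR_fact_lt_0.
Qed.

Lemma hco_0 (n : nat) : hco n 0 = 1.
Proof.
  unfold hco; rewrite Nat.add_0_r; simpl; field.
  apply Rgt_not_eq, C_pos; lia.
Qed.

(** The ratio of consecutive binomial coefficients; it is the source of the differential equation
    for [Hpol]. *)
Lemma hco_S (n i : nat) :
  (i < n)%nat -> (INR n + INR i + 1) * hco n (S i) = - ((INR n - INR i) * hco n i).
Proof.
  intros Hi; pose proof (C_pos (2 * n) n ltac:(lia)).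
  assert (E : (INR n + INR i + 1) * Binomial.C (2 * n) (n + S i)
              = (INR n - INR i) * Binomial.C (2 * n) (n + i)).
  { unfold Binomial.C.
    replace (n + S i)%nat with (S (n + i)) by lia.
    replace (2 * n - (n + i))%nat with (S (2 * n - S (n + i))) by lia.
    rewrite !fact_simpl, !mult_INR, (S_INR (_ - _)), minus_INR, mult_INR by lia.
    change (INR 2) with 2; rewrite !S_INR, plus_INR.
    pose proof (INR_fact_neq_0 (n + i)); pose proof (INR_fact_neq_0 (2 * n - S (n + i))).
    apply lt_INR in Hi; pose proof (pos_INR i).
    field; repeat split; try assumption; lra. }
  unfold hco; rewrite <- tech_pow_Rmult.
  replace ((INR n + INR i + 1) * (-1 * (-1) ^ i * Binomial.C (2 * n) (n + S i) / Binomial.C (2 * n) n))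
    with (- (-1) ^ i / Binomial.C (2 * n) n * ((INR n + INR i + 1) * Binomial.C (2 * n) (n + S i)))
    by (field; lra).
  rewrite E; field; lra.
Qed.

Lemma Hpol_D (n : nat) (z : R) : is_derive (Hpol n) z (dHpol n z).
Proof.
  unfold Hpol, dHpol; generalize n at 2 4; intros m; induction m as [|m IH].
  - simpl; evar_last; [apply is_derive_const | unfold zero; simpl; ring].
  - simpl sum_f_R0; apply D_plus; [exact IH |].
    evar_last; [apply (D_mult (fun _ => hco n (S m))); [apply is_derive_const |] |].
    + apply (is_derive_pow (fun z => z) (S m) z 1); auto_derive; [exact I | ring].
    + unfold zero; simpl; ring.
Qed.

(** For the sum truncated at k the recurrence leaves the remainder (n - k) hco(k) z^(k+1), which
    disappears at k = n. *)
Lemma Hpol_ode (n : nat) (z : R) :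
  z * (1 - z) * dHpol n z + INR n * (1 + z) * Hpol n z = INR n.
Proof.
  assert (E : forall k, (k <= n)%nat ->
    z * (1 - z) * sum_f_R0 (fun i => hco n i * (INR i * z ^ pred i)) k
    + INR n * (1 + z) * sum_f_R0 (fun i => hco n i * z ^ i) k
    = INR n + (INR n - INR k) * hco n k * z ^ S k).
  { induction k as [|k IH]; intros Hk.
    - simpl; rewrite hco_0; ring.
    - rewrite !tech5; specialize (IH ltac:(lia)); pose proof (hco_S n k ltac:(lia)) as Hh.
      simpl pred.
      match goal with |- z * (1 - z) * (?a + ?b) + INR n * (1 + z) * (?c + ?d) = _ =>
        transitivity ((z * (1 - z) * a + INR n * (1 + z) * c)
                      + z ^ S k * ((INR n + INR k + 1) * hco n (S k))
                      + (INR n - INR k - 1) * hco n (S k) * z ^ S (S k))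
      end.
      + rewrite S_INR; simpl pow; ring.
      + rewrite IH, Hh, S_INR; ring. }
  unfold dHpol, Hpol; rewrite (E n (Nat.le_refl n)); ring.
Qed.

Definition spol (n : nat) (z : R) : R := 2 * Hpol n z - 1.

Lemma spol_0 (n : nat) : spol n 0 = 1.
Proof.
  unfold spol, Hpol.
  assert (E : forall m, sum_f_R0 (fun i => hco n i * 0 ^ i) m = 1).
  { induction m as [|m IHm]; [simpl; rewrite hco_0; ring |].
    rewrite tech5, IHm, pow_i by lia; ring. }
  rewrite E; ring.
Qed.

Lemma spol_1 (n : nat) : (1 <= n)%nat -> spol n 1 = 0.
Proof.
  intros Hn; pose proof (Hpol_ode n 1) as E; apply le_INR in Hn; simpl in Hn; unfold spol.
  assert (INR n * (2 * Hpol n 1 - 1) = 0) as Z by lra.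
  apply Rmult_integral in Z; destruct Z; [lra | assumption].
Qed.

Definition phip (n : nat) (T : R) : R := spol n ((1 - T) / (1 + T)).

Lemma phip_cont (n : nat) (T : R) : -1 < T -> continuity_pt (phip n) T.
Proof.
  intros HT; unfold phip, spol.
  apply (cp_minus (fun T => 2 * Hpol n ((1 - T) / (1 + T))) (fun _ => 1)); [| apply cp_const].
  apply (cp_mult (fun _ => 2)); [apply cp_const |].
  apply (cp_comp (fun T => (1 - T) / (1 + T)) (Hpol n)).
  - apply (cp_div (fun T => 1 - T) (fun T => 1 + T)); [cnt | cnt | lra].
  - eapply cp_derive, Hpol_D.
Qed.

Lemma phip_0 (n : nat) : (1 <= n)%nat -> phip n 0 = 0.
Proof. intros Hn; unfold phip; replace ((1 - 0) / (1 + 0)) with 1 by field; now apply spol_1. Qed.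

Lemma phip_1 (n : nat) : phip n 1 = 1.
Proof. unfold phip; replace ((1 - 1) / (1 + 1)) with 0 by field; apply spol_0. Qed.

Lemma phip_D (n : nat) (T : R) :
  0 < T < 1 -> is_derive (phip n) T (2 * INR n * (phip n T - T) / (T * (1 - T ^ 2))).
Proof.
  intros HT; set (z := (1 - T) / (1 + T)).
  assert (Dz : is_derive (fun T => (1 - T) / (1 + T)) T (- 2 / (1 + T) ^ 2)).
  { auto_derive; [lra | field; lra]. }
  pose proof (is_derive_comp (Hpol n) (fun T => (1 - T) / (1 + T)) T _ _ (Hpol_D n z) Dz) as DH.
  unfold scal in DH; simpl in DH; unfold mult in DH; simpl in DH.
  evar_last.
  - apply (D_plus (fun T => 2 * Hpol n ((1 - T) / (1 + T))) (fun _ => - (1))); [| apply is_derive_const].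
    apply (D_mult (fun _ => 2)); [apply is_derive_const | exact DH].
  - unfold zero; simpl.
    pose proof (Hpol_ode n z) as E.
    unfold phip, spol; fold z.
    assert (Hz : dHpol n z = (INR n - INR n * (1 + z) * Hpol n z) / (z * (1 - z))).
    { assert (Hz0 : z * (1 - z) = 2 * T * (1 - T) / (1 + T) ^ 2) by (unfold z; field; lra).
      assert (0 < z * (1 - z)) by (rewrite Hz0; apply Rdiv_lt_0_compat; nra).
      apply (Rmult_eq_reg_l (z * (1 - z))); [| lra].
      transitivity (INR n - INR n * (1 + z) * Hpol n z); [lra | field; split; nra]. }
    rewrite Hz; generalize (Hpol n z); intros h; unfold z; field; repeat split; nra.
Qed.

(** * Lower barrier and slope of the profile *)

Lemma le_of_deriv_nonneg_open (f df : R -> R) (a b : R) :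
  a <= b -> (forall x, a < x < b -> is_derive f x (df x)) ->
  (forall x, a <= x <= b -> continuity_pt f x) ->
  (forall x, a < x < b -> 0 <= df x) -> f a <= f b.
Proof.
  intros Hab Hd Hc Hp.
  set (g := fun x => if Rlt_dec a x then if Rlt_dec x b then df x else 0 else 0).
  destruct (MVT_gen f a b g) as [c [_ E]]; rewrite ?Rmin_left, ?Rmax_right in * by assumption.
  - intros x Hx; unfold g; do 2 (destruct Rlt_dec; [| lra]); now apply Hd.
  - exact Hc.
  - assert (0 <= g c).
    { unfold g; destruct Rlt_dec; [destruct Rlt_dec |]; try lra; apply Hp; lra. }
    nra.
Qed.

(** Lower barrier for [phip]: the correction to T is such that phip >= sig, inserted in the equation
    for phip', gives exactly the slope n / (n + 1). *)
Definition sig (n : nat) (T : R) : R := T + T * (1 - T ^ 2) / (2 * INR n + 2).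

Lemma sig_D (n : nat) (t : R) :
  is_derive (sig n) t (1 + (1 - 3 * t ^ 2) / (2 * INR n + 2)).
Proof.
  assert (D : forall r, is_derive (fun t => t + t * (1 - t ^ 2) * r) t (1 + (1 - 3 * t ^ 2) * r))
    by (intros r; auto_derive; [exact I | ring]).
  exact (D (/ (2 * INR n + 2))).
Qed.

(* [(phip - sig) ((1 - t^2) / t^2)^n] decreases to [0] as t increases to 1. *)
Lemma phip_ge_sig (n : nat) (T : R) : (1 <= n)%nat -> 0 < T < 1 -> sig n T <= phip n T.
Proof.
  intros Hn HT.
  pose proof (pos_INR n) as Hn0.
  set (q := fun t => (1 - t ^ 2) / t ^ 2).
  set (f := fun t => (phip n t - sig n t) * q t ^ n).
  assert (Hq : forall t, 0 < t < 1 -> 0 < q t) by (intros t Ht; apply Rdiv_lt_0_compat; nra).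
  assert (Cq : forall t, 0 < t -> continuity_pt q t).
  { intros t Ht; apply (cp_div (fun t => 1 - t ^ 2) (fun t => t ^ 2)); [cnt | cnt | nra]. }
  assert (E : - f T <= - f 1).
  { apply (le_of_deriv_nonneg_open (fun t => - f t)
      (fun t => - (- (3 * (1 - t ^ 2) / (2 * INR n + 2)) * q t ^ n))); [lra | | |].
    - intros t Ht; apply D_opp.
      (* q^n is the integrating factor of the equation for [phip], so [phip] itself cancels from the
         derivative of f. *)
      assert (Dq : is_derive q t (- 2 * q t / (t * (1 - t ^ 2)))).
      { unfold q; auto_derive; [nra | field; split; nra]. }
      evar_last.
      + apply (D_mult (fun t => phip n t - sig n t)).
        * apply D_minus; [apply phip_D; lra | apply sig_D].
        * apply (is_derive_pow q n t); exact Dq.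
      + unfold minus, plus, opp; simpl; unfold sig.
        destruct n as [|p]; [lia |]; simpl pred; rewrite <- tech_pow_Rmult.
        field; repeat split; nra.
    - intros t Ht; apply cp_opp, (cp_mult (fun t => phip n t - sig n t) (fun t => q t ^ n)).
      + apply cp_minus; [apply phip_cont; lra | eapply cp_derive, sig_D].
      + apply cp_pow, Cq; lra.
    - intros t Ht; pose proof (pow_lt _ n (Hq t ltac:(lra))).
      assert (0 <= 3 * (1 - t ^ 2) / (2 * INR n + 2)).
      { apply Rmult_le_pos; [nra | apply Rlt_le, Rinv_0_lt_compat; lra]. }
      nra. }
  assert (Hf1 : f 1 = 0) by (unfold f, q; replace ((1 - 1 ^ 2) / 1 ^ 2) with 0 by field; rewrite pow_i by lia; ring).
  assert (Hf : 0 <= f T) by lra.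
  unfold f in Hf; pose proof (pow_lt _ n (Hq T HT)); nra.
Qed.

Lemma phip_ge_id (n : nat) (T : R) : (1 <= n)%nat -> 0 <= T <= 1 -> T <= phip n T.
Proof.
  intros Hn HT.
  destruct (Req_dec T 0) as [-> | H0]; [rewrite phip_0 by assumption; lra |].
  destruct (Req_dec T 1) as [-> | H1]; [rewrite phip_1; lra |].
  eapply Rle_trans; [| apply phip_ge_sig; (assumption || lra)]; unfold sig.
  assert (0 <= T * (1 - T ^ 2) / (2 * INR n + 2)); [| lra].
  pose proof (pos_INR n); apply Rmult_le_pos; [nra | apply Rlt_le, Rinv_0_lt_compat; lra].
Qed.

Lemma phip_slope (n : nat) (T1 T2 : R) :
  (1 <= n)%nat -> 0 <= T1 -> T1 <= T2 -> T2 <= 1 ->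
  INR n / (INR n + 1) * (T2 - T1) <= phip n T2 - phip n T1.
Proof.
  intros Hn H1 H12 H2; pose proof (pos_INR n).
  set (r := INR n / (INR n + 1)).
  enough (phip n T1 - r * T1 <= phip n T2 - r * T2) by lra.
  apply (le_of_deriv_nonneg_open (fun t => phip n t - r * t)
    (fun t => 2 * INR n * (phip n t - t) / (t * (1 - t ^ 2)) - r)); [assumption | | |].
  - intros t Ht; apply (D_minus (phip n) (fun t => r * t)).
    + apply phip_D; lra.
    + generalize r; intros; auto_derive; [exact I | ring].
  - intros t Ht; apply (cp_minus (phip n) (fun t => r * t)); [apply phip_cont; lra | cnt].
  - intros t Ht; pose proof (phip_ge_sig n t Hn ltac:(lra)) as Hs; unfold sig in Hs.
    assert (Hd : 0 < t * (1 - t ^ 2)) by (apply Rmult_lt_0_compat; nra).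
    apply Rge_le, Rge_minus, Rle_ge.
    replace r with (2 * INR n * (t * (1 - t ^ 2) / (2 * INR n + 2)) / (t * (1 - t ^ 2)))
      by (unfold r; field; split; [| split]; nra).
    apply Rmult_le_compat_r; [apply Rlt_le, Rinv_0_lt_compat, Hd |].
    apply Rmult_le_compat_l; lra.
Qed.

(** Odd extension of [phip] from [0, 1]. The maxima replace a case distinction: the inactive term is
    [phip n 0], which is 0. *)
Definition phi (n : nat) (T : R) : R := phip n (Rmax T 0) - phip n (Rmax (- T) 0).

Lemma phi_pos (n : nat) (T : R) : (1 <= n)%nat -> 0 <= T -> phi n T = phip n T.
Proof.
  intros Hn HT; unfold phi; rewrite Rmax_left, Rmax_right, phip_0 by (assumption || lra); ring.
Qed.

Lemma phi_opp (n : nat) (T : R) : phi n (- T) = - phi n T.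
Proof. unfold phi; rewrite Ropp_involutive; ring. Qed.

Lemma phi_neg (n : nat) (T : R) : (1 <= n)%nat -> T <= 0 -> phi n T = - phip n (- T).
Proof. intros Hn HT; rewrite <- phi_pos, phi_opp by (assumption || lra); ring. Qed.

Lemma phi_cont (n : nat) (T : R) : continuity_pt (phi n) T.
Proof.
  assert (Cm : forall x, continuity_pt (fun T => Rmax T 0) x).
  { intros x eps Heps; exists eps; split; [exact Heps |]; intros y [_ Hy].
    simpl in *; unfold Rdist in *; eapply Rle_lt_trans; [| exact Hy].
    unfold Rmax; repeat destruct Rle_dec; unfold Rabs; repeat destruct Rcase_abs; lra. }
  unfold phi; apply cp_minus.
  - apply (cp_comp (fun T => Rmax T 0) (phip n)); [apply Cm | apply phip_cont].
    pose proof (Rmax_r T 0); lra.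
  - apply (cp_comp (fun T => Rmax (- T) 0) (phip n)).
    + apply (cp_comp (fun T => - T) (fun T => Rmax T 0)); [cnt | apply Cm].
    + apply phip_cont; pose proof (Rmax_r (- T) 0); lra.
Qed.

Lemma phi_slope (n : nat) (T1 T2 : R) :
  (1 <= n)%nat -> -1 <= T1 -> T1 <= T2 -> T2 <= 1 ->
  INR n / (INR n + 1) * (T2 - T1) <= phi n T2 - phi n T1.
Proof.
  intros Hn H1 H12 H2.
  destruct (Rle_dec 0 T1).
  - rewrite !phi_pos by (assumption || lra); apply phip_slope; (assumption || lra).
  - destruct (Rle_dec 0 T2).
    + rewrite phi_pos, phi_neg by (assumption || lra).
      pose proof (phip_slope n 0 T2 Hn ltac:(lra) ltac:(lra) ltac:(lra)).
      pose proof (phip_slope n 0 (- T1) Hn ltac:(lra) ltac:(lra) ltac:(lra)).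
      rewrite phip_0 in * by assumption; lra.
    + rewrite !phi_neg by (assumption || lra).
      pose proof (phip_slope n (- T2) (- T1) Hn ltac:(lra) ltac:(lra) ltac:(lra)); lra.
Qed.

Lemma phi_ge_id (n : nat) (T : R) : (1 <= n)%nat -> -1 <= T <= 1 -> 0 <= T * (phi n T - T).
Proof.
  intros Hn HT; destruct (Rle_dec 0 T).
  - rewrite phi_pos by assumption; pose proof (phip_ge_id n T Hn ltac:(lra)); nra.
  - rewrite phi_neg by (assumption || lra); pose proof (phip_ge_id n (- T) Hn ltac:(lra)); nra.
Qed.

Lemma phi_bound (n : nat) (T : R) : (1 <= n)%nat -> -1 <= T <= 1 -> Rabs (phi n T) <= 1.
Proof.
  intros Hn HT.
  assert (Hr : 0 <= INR n / (INR n + 1)).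
  { pose proof (pos_INR n); apply Rmult_le_pos; [lra | apply Rlt_le, Rinv_0_lt_compat; lra]. }
  pose proof (phi_slope n T 1 Hn ltac:(lra) ltac:(lra) ltac:(lra)) as U.
  pose proof (phi_slope n (-1) T Hn ltac:(lra) ltac:(lra) ltac:(lra)) as L.
  assert (P1 : phi n 1 = 1) by (rewrite phi_pos, phip_1 by (assumption || lra); reflexivity).
  replace (-1) with (- (1)) in L by ring; rewrite phi_opp in L.
  apply Rabs_le; nra.
Qed.

(** Closed form of the mass, which clears the binomial coefficient and the powers of 2 left by the
    Green representation. *)
Lemma mass_binomial (n : nat) :
  (2 * INR n + 1) * Binomial.C (2 * n) n * mass n = 2 * 4 ^ n.
Proof.
  induction n as [|n IH].
  - unfold mass; simpl Nat.mul; rewrite C_n_0.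
    rewrite (Int_ext _ (fun _ => 1)) by (intros; simpl; ring); rewrite Int_const; simpl; ring.
  - assert (E : Binomial.C (2 * S n) (S n) * (INR n + 1) = 2 * (2 * INR n + 1) * Binomial.C (2 * n) n).
    { unfold Binomial.C; replace (2 * S n - S n)%nat with (S n) by lia.
      replace (2 * n - n)%nat with n by lia; replace (2 * S n)%nat with (S (S (2 * n))) by lia.
      rewrite !fact_simpl, !mult_INR, !S_INR, mult_INR; change (INR 2) with 2.
      pose proof (INR_fact_neq_0 n); pose proof (pos_INR n); field; split; [assumption | lra]. }
    pose proof (mass_S n) as M; pose proof (pos_INR n).
    rewrite S_INR, <- tech_pow_Rmult.
    apply (Rmult_eq_reg_r (INR n + 1)); [| lra].
    transitivity ((Binomial.C (2 * S n) (S n) * (INR n + 1)) * ((2 * INR n + 3) * mass (S n))); [ring |].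
    rewrite E, M; transitivity (4 * (INR n + 1) * (2 * 4 ^ n)); [rewrite <- IH |]; ring.
Qed.

Lemma sum_rev (f : nat -> R) (m : nat) : sum_f_R0 (fun j => f (m - j)%nat) m = sum_f_R0 f m.
Proof.
  induction m as [|m IH]; [reflexivity |].
  rewrite decomp_sum by lia; simpl pred; rewrite tech5, <- IH, Nat.sub_0_r; simpl; ring.
Qed.

Lemma hi_Hpol (n : nat) (X Y : R) :
  X <> 0 -> Y ^ n * hi_part (2 * n) n X Y = (-1) ^ n * Binomial.C (2 * n) n * (X * Y) ^ n * Hpol n (Y / X).
Proof.
  intros HX; pose proof (C_pos (2 * n) n ltac:(lia)).
  unfold hi_part, Hpol; replace (2 * n - n)%nat with n by lia.
  rewrite Rpow_mult_distr, !scal_sum; apply sum_eq; intros i Hi.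
  unfold hco, Rdiv; rewrite Rpow_mult_distr, (pow_add (-1)), pow_inv.
  replace (X ^ n) with (X ^ (n - i) * X ^ i) by (rewrite <- pow_add; f_equal; lia).
  field; split; first [lra | now apply pow_nonzero].
Qed.

Lemma lo_Hpol (n : nat) (X Y : R) :
  (1 <= n)%nat -> Y <> 0 ->
  X ^ (S (2 * n - n)) * lo_part (2 * n) n X Y
  = (-1) ^ n * Binomial.C (2 * n) n * (X * Y) ^ n * (Hpol n (X / Y) - 1).
Proof.
  intros Hn HY; pose proof (C_pos (2 * n) n ltac:(lia)).
  unfold Hpol; rewrite decomp_sum by lia; rewrite hco_0.
  unfold lo_part; rewrite <- sum_rev.
  rewrite Rpow_mult_distr; simpl (_ ^ 0).
  match goal with |- _ = ?c * (1 * 1 + ?s - 1) => replace (1 * 1 + s - 1) with s by ring end.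
  rewrite !scal_sum; apply sum_eq; intros k Hk.
  replace (pred n - (pred n - k))%nat with k by lia.
  rewrite (pascal_step1 (2 * n) (pred n - k)) by lia.
  replace (2 * n - (pred n - k))%nat with (n + S k)%nat by lia.
  unfold hco, Rdiv; rewrite Rpow_mult_distr, pow_inv.
  replace (Y ^ n) with (Y ^ (pred n - k) * Y ^ S k) by (rewrite <- pow_add; f_equal; lia).
  replace (S (2 * n - n)) with (n + 1)%nat by lia; rewrite pow_add, pow_1.
  replace ((-1) ^ n) with ((-1) ^ (pred n - k) * (-1) ^ S k) by (rewrite <- pow_add; f_equal; lia).
  rewrite <- (tech_pow_Rmult X).
  transitivity ((-1) ^ (pred n - k) * Binomial.C (2 * n) (n + S k) * (X ^ k * Y ^ (pred n - k)) * (X ^ n * X)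
                * ((-1) ^ S k * (-1) ^ S k)); [rewrite sign_sq; ring |].
  field; split; first [lra | now apply pow_nonzero].
Qed.

(** Subtraction law of tanh, and the quotient (X - Y) / (X + Y) of [Xl] and [Yl]. *)
Definition Tk (x y : R) : R := (x - y) / (1 - x * y).

Lemma Tk_den (x y : R) : -1 < x < 1 -> -1 <= y <= 1 -> 0 < 1 - x * y.
Proof. intros; destruct (Rle_dec 0 y); [assert (x * y <= y \/ x * y <= 0) by (destruct (Rle_dec 0 x); [left | right]; nra) |]; nra. Qed.

Lemma Tk_bound (x y : R) : -1 < x < 1 -> -1 <= y <= 1 -> -1 <= Tk x y <= 1.
Proof.
  intros Hx Hy; pose proof (Tk_den x y Hx Hy) as Hd; unfold Tk; split.
  - apply Rle_div_r; [exact Hd | nra].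
  - apply Rle_div_l; [exact Hd | nra].
Qed.

Lemma contI_green (n : nat) (F : R -> R) (x : R) :
  -1 < x < 1 -> (forall y, continuity_pt F y) -> contI (fun y => w y ^ n * F y * phi n (Tk x y)).
Proof.
  intros Hx HF y Hy; apply cp_mult; [cntw |].
  apply (cp_comp (Tk x) (phi n)); [| apply phi_cont].
  apply (cp_div (fun y => x - y) (fun y => 1 - x * y)); [cnt | cnt |].
  pose proof (Tk_den x y Hx Hy); lra.
Qed.

Lemma XY_w (x y : R) : Xl x y * Yl x y = w x * w y.
Proof. unfold Xl, Yl, w; ring. Qed.

Lemma Ap_phi (n : nat) (x y : R) :
  (1 <= n)%nat -> -1 < x < 1 -> -1 <= y <= x ->
  Ap (2 * n) n x y = (-1) ^ n * Binomial.C (2 * n) n * (w x * w y) ^ n * ((phi n (Tk x y) + 1) / 2).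
Proof.
  intros Hn Hx Hy; pose proof (Tk_den x y Hx ltac:(lra)) as Hd.
  assert (HX : 0 < Xl x y) by (unfold Xl; nra).
  unfold Ap; rewrite hi_Hpol, XY_w by lra; f_equal.
  assert (HT : 0 <= Tk x y) by (apply Rle_div_r; [exact Hd | lra]).
  rewrite phi_pos by assumption; unfold phip, spol.
  replace ((1 - Tk x y) / (1 + Tk x y)) with (Yl x y / Xl x y); [field |].
  unfold Tk; replace (Yl x y / Xl x y) with (((1 - x * y) - (x - y)) / ((1 - x * y) + (x - y)))
    by (unfold Xl, Yl; f_equal; ring).
  field; split; lra.
Qed.

Lemma Bp_phi (n : nat) (x y : R) :
  (1 <= n)%nat -> -1 < x < 1 -> x <= y <= 1 ->
  Bp (2 * n) n x y = - ((-1) ^ n * Binomial.C (2 * n) n * (w x * w y) ^ n * ((phi n (Tk x y) + 1) / 2)).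
Proof.
  intros Hn Hx Hy; pose proof (Tk_den x y Hx ltac:(lra)) as Hd.
  assert (HY : 0 < Yl x y) by (unfold Yl; nra).
  unfold Bp; rewrite lo_Hpol, XY_w by (assumption || lra).
  assert (HT : Tk x y <= 0) by (apply Rle_div_l; [exact Hd | lra]).
  rewrite phi_neg by assumption; unfold phip, spol.
  replace ((1 - - Tk x y) / (1 + - Tk x y)) with (Xl x y / Yl x y); [field |].
  unfold Tk; replace (Xl x y / Yl x y) with (((1 - x * y) + (x - y)) / ((1 - x * y) - (x - y)))
    by (unfold Xl, Yl; f_equal; ring).
  field; split; lra.
Qed.

Lemma Derive_n_xwpow_m1 (n : nat) :
  Derive_n (fun y => y * w y ^ n) n (-1) = - (INR (fact n) * 2 ^ n).
Proof.
  replace (fun y => y * w y ^ n) with (fun y => (1 + 1 * y) ^ n * ((1 - y) ^ n * y)).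
  - rewrite Derive_n_linpow_top by (first [ring | ck]).
    rewrite pow1; replace (1 - -1) with 2 by ring; ring.
  - apply functional_extensionality; intros y.
    replace (w y) with ((1 + 1 * y) * (1 - y)) by (unfold w; ring); rewrite Rpow_mult_distr; ring.
Qed.

Lemma Ap_top_m1 (n : nat) (x : R) :
  Derive_n (Ap (2 * n) n x) n (-1) = (-1) ^ n * Binomial.C (2 * n) n * INR (fact n) * 2 ^ n * w x ^ n.
Proof.
  unfold Ap, Yl.
  rewrite (Derive_n_linpow_top (1 - x) (1 - x) n
    (fun y => hi_part (2 * n) n (Xl x y) ((1 - x) + (1 - x) * y))) by (first [ring | apply polydeg_hi]).
  replace (1 - x + (1 - x) * -1) with 0 by ring.
  replace (hi_part (2 * n) n (Xl x (-1)) 0) with ((-1) ^ n * Binomial.C (2 * n) n * Xl x (-1) ^ n).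
  - replace (Xl x (-1)) with (2 * (1 + x)) by (unfold Xl; ring).
    replace (w x) with ((1 - x) * (1 + x)) by (unfold w; ring).
    rewrite !Rpow_mult_distr; ring.
  - unfold hi_part; replace (2 * n - n)%nat with n by lia.
    destruct n as [|p]; [simpl; ring |].
    rewrite decomp_sum by lia.
    rewrite (sum_eq _ (fun _ => 0)) by (intros i Hi; rewrite (pow_i (S i)) by lia; ring).
    rewrite sum_cte, Nat.add_0_r, Nat.sub_0_r; simpl (0 ^ 0); ring.
Qed.

(** V = y w^n - al v satisfies V^(2n+1) = (-1)^n (2n+1)! F, so [split_rep] with l = 0 recovers V(x)
    from F. At -1 both V and [Ap] vanish to order n, and one boundary term survives; it balances the
    mass coming from the 1 in (phi + 1) / 2. *)
Lemma green (n : nat) (al : R) (u F : R -> R) (x : R) :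
  (1 <= n)%nat -> axial n al u F -> -1 < x < 1 ->
  Int (fun y => w y ^ n * F y * phi n (Tk x y)) = mass n * (x - al * Gfun u x).
Proof.
  intros Hn H Hx.
  pose proof (ax_u _ _ _ _ H) as Hu.
  pose proof (Ck_v n u Hu) as Hv.
  pose proof (cp_F _ _ _ _ H) as HF.
  set (V := fun y => y * w y ^ n + - al * vfun n u y).
  assert (CV : Ck (S (2 * n)) V).
  { unfold V; ckw; apply (Ck_le _ (2 * n + 4)); [lia | assumption]. }
  assert (DV : forall k y, (k <= 2 * n + 1)%nat ->
    Derive_n V k y = Derive_n (fun y => y * w y ^ n) k y + - al * Derive_n (vfun n u) k y).
  { intros k y Hk; unfold V; rewrite Derive_n_add, Derive_n_lmul; [reflexivity | ckw |].
    apply (Ck_mult k (fun _ => - al)); [apply Ck_const | apply (Ck_le _ (2 * n + 4)); [lia | assumption]]. }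
  assert (EV : forall y, -1 <= y <= 1 ->
    Derive_n V (S (2 * n)) y = (-1) ^ n * INR (fact (2 * n + 1)) * F y).
  { intros y Hy; rewrite DV by lia; replace (S (2 * n)) with (2 * n + 1)%nat by lia.
    rewrite Derive_n_xwpow, (ax_eq _ _ _ _ H) by assumption.
    rewrite <- (coef_fact n al); ring. }
  assert (Vs : forall k a, (k < n)%nat -> w a = 0 -> Derive_n V k a = 0).
  { intros k a Hk Ha; rewrite DV, v_vanish by (assumption || lia).
    replace (fun y => y * w y ^ n) with (fun y => w y ^ n * y)
      by (apply functional_extensionality; intros; ring).
    rewrite Derive_n_wpow_vanish by (first [assumption | ck]); ring. }
  pose proof (split_rep (2 * n) n (2 * n) 0 V x ltac:(lia) ltac:(lia) ltac:(lra) CV) as E.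
  change (Derive_n (Ap (2 * n) n x) 0) with (Ap (2 * n) n x) in E.
  change (Derive_n (Bp (2 * n) n x) 0) with (Bp (2 * n) n x) in E.
  assert (B1 : bdry (2 * n) V (Bp (2 * n) n x) 1 = 0).
  { apply bdry_zero; intros i Hi; destruct (Nat.le_gt_cases i n) as [Hin | Hin].
    - rewrite Bp_vanish by lia; ring.
    - rewrite Vs by (first [lia | apply w_1]); ring. }
  rewrite B1, (bdry_single (2 * n) n V (Ap (2 * n) n x) (-1)) in E.
  2: lia.
  2:{ intros i Hi Hne; destruct (Nat.le_gt_cases i n) as [Hin | Hin].
      - rewrite Ap_vanish by lia; ring.
      - rewrite Vs by (first [lia | apply w_m1]); ring. }
  replace (2 * n - n)%nat with n in E by lia.
  rewrite Ap_top_m1, DV, v_vanish, Derive_n_xwpow_m1 in E by (first [assumption | lia | apply w_m1]).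
  set (C := Binomial.C (2 * n) n) in *.
  set (k := fun y => w y ^ n * F y * phi n (Tk x y)) in *.
  assert (Ck : contI k) by (now apply contI_green).
  assert (Xk : forall a b, -1 <= a -> a <= b -> b <= 1 -> ex_RInt k a b)
    by (intros; apply ex_RInt_cont; [assumption | intros; apply Ck; lra]).
  assert (Xw : forall a b, a <= b -> ex_RInt (fun y => w y ^ n * F y) a b)
    by (intros; apply ex_RInt_cont; [assumption | intros; cntw]).
  assert (Lin : forall c a b, -1 <= a -> a <= b -> b <= 1 ->
    RI (fun y => c * k y + c * (w y ^ n * F y)) a b
    = c * RI k a b + c * RI (fun y => w y ^ n * F y) a b).
  { intros c' a b Ha Hab Hb; rewrite <- 2!RI_scal by (first [now apply Xk | now apply Xw]).
    apply RI_plus; apply (ex_RInt_scal (V := R_NormedModule)); [now apply Xk | now apply Xw]. }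
  assert (sg : forall t, (-1) ^ n * ((-1) ^ n * t) = t) by (intros; rewrite <- Rmult_assoc, sign_sq; ring).
  remember (INR (fact (2 * n + 1)) * C * w x ^ n / 2) as c eqn:Ec.
  assert (EA : RI (fun y => Derive_n V (S (2 * n)) y * Ap (2 * n) n x y) (-1) x
               = c * RI k (-1) x + c * RI (fun y => w y ^ n * F y) (-1) x).
  { rewrite <- Lin by lra; apply RI_ext; [lra |]; intros y Hy.
    rewrite EV, Ap_phi by (first [assumption | lra]); rewrite Ec; unfold k; fold C; rewrite Rpow_mult_distr.
    transitivity ((-1) ^ n * ((-1) ^ n * (INR (fact (2 * n + 1)) * F y * (C * (w x ^ n * w y ^ n) * ((phi n (Tk x y) + 1) / 2)))));
      [ring | rewrite sg; field]. }
  assert (EB : RI (fun y => Derive_n V (S (2 * n)) y * Bp (2 * n) n x y) x 1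
               = - c * RI k x 1 + - c * RI (fun y => w y ^ n * F y) x 1).
  { rewrite <- Lin by lra; apply RI_ext; [lra |]; intros y Hy.
    rewrite EV, Bp_phi by (first [assumption | lra]); rewrite Ec; unfold k; fold C; rewrite Rpow_mult_distr.
    transitivity (- ((-1) ^ n * ((-1) ^ n * (INR (fact (2 * n + 1)) * F y * (C * (w x ^ n * w y ^ n) * ((phi n (Tk x y) + 1) / 2))))));
      [ring | rewrite sg; field]. }
  rewrite EA, EB in E.
  assert (Ik : RI k (-1) x + RI k x 1 = Int k) by (apply RI_Chasles; apply Xk; lra).
  assert (Iw : RI (fun y => w y ^ n * F y) (-1) x + RI (fun y => w y ^ n * F y) x 1 = mass n).
  { rewrite RI_Chasles by (apply Xw; lra); rewrite <- (EF_1 n al u F H).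
    apply Int_ext; intros; ring. }
  assert (E2 : c * (Int k + mass n)
    = (-2) ^ (2 * n) * INR (fact (2 * n)) * V x + C * INR (fact n) ^ 2 * 2 ^ n * 2 ^ n * w x ^ n).
  { rewrite <- Ik, <- Iw.
    match type of E with ?l = ?r => transitivity l; [ring |] end; rewrite E, pow_1_even.
    match goal with |- _ - ?t - 0 = _ => replace t with
       (- ((-1) ^ n * ((-1) ^ n * (C * INR (fact n) ^ 2 * 2 ^ n * 2 ^ n * w x ^ n)))) by ring end.
    rewrite sg; ring. }
  assert (Hpow : (-2) ^ (2 * n) = 4 ^ n) by (rewrite pow_mult; f_equal; ring).
  assert (Hpow2 : 2 ^ n * 2 ^ n = 4 ^ n) by (rewrite <- Rpow_mult_distr; f_equal; ring).
  assert (HC : C * INR (fact n) ^ 2 = INR (fact (2 * n))).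
  { unfold C, Binomial.C; replace (2 * n - n)%nat with n by lia.
    field; apply INR_fact_neq_0. }
  assert (HV : V x = w x ^ n * (x - al * Gfun u x)) by (unfold V; rewrite vfun_G; ring).
  rewrite Hpow, HV, HC, (Rmult_assoc _ (2 ^ n) (2 ^ n)), Hpow2 in E2.
  pose proof (mass_binomial n) as MB; fold C in MB.
  assert (Hwx : 0 < w x ^ n) by (apply pow_lt, w_pos; lra).
  pose proof (INR_fact_lt_0 (2 * n)) as Hf.
  rewrite Ec in E2; replace (2 * n + 1)%nat with (S (2 * n)) in E2 by lia.
  rewrite fact_simpl, mult_INR, S_INR, mult_INR in E2; change (INR 2) with 2 in E2.
  assert (E3 : Int k + mass n = mass n * (x - al * Gfun u x + 1)); [| lra].
  apply (Rmult_eq_reg_l (INR (fact (2 * n)) * w x ^ n / 2 * ((2 * INR n + 1) * C))).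
  - transitivity (((2 * INR n + 1) * INR (fact (2 * n)) * C * w x ^ n / 2) * (Int k + mass n)); [field |].
    rewrite E2.
    transitivity (INR (fact (2 * n)) * w x ^ n / 2 * (x - al * Gfun u x + 1) * (2 * 4 ^ n)); [field |].
    rewrite <- MB; ring.
  - assert (0 < C) by (apply C_pos; lia); pose proof (pos_INR n).
    apply Rgt_not_eq, Rmult_lt_0_compat; [apply Rdiv_lt_0_compat; nra | nra].
Qed.

(** * Double integrals *)

Definition cont2 (k : R -> R -> R) : Prop := forall x y, continuity_2d_pt k x y.

Lemma cont2_l (k : R -> R -> R) (y : R) : cont2 k -> forall x, continuity_pt (fun x => k x y) x.
Proof.
  intros H x eps Heps; destruct (H x y (mkposreal _ Heps)) as [d Hd].
  exists d; split; [apply cond_pos |]; intros z [_ Hz]; simpl in *; unfold Rdist in *.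
  apply Hd; [exact Hz | rewrite Rminus_eq_0, Rabs_R0; apply cond_pos].
Qed.

Lemma cont2_flip (k : R -> R -> R) : cont2 k -> cont2 (fun x y => k y x).
Proof.
  intros H x y eps; destruct (H y x eps) as [d Hd]; exists d; intros u v Hu Hv; now apply Hd.
Qed.

Lemma cont2_r (k : R -> R -> R) (x : R) : cont2 k -> forall y, continuity_pt (fun y => k x y) y.
Proof. intros H; exact (cont2_l (fun x y => k y x) x (cont2_flip k H)). Qed.

Lemma cont2_plus (f g : R -> R -> R) : cont2 f -> cont2 g -> cont2 (fun x y => f x y + g x y).
Proof. intros Hf Hg x y; now apply continuity_2d_pt_plus. Qed.

Lemma cont2_mult (f g : R -> R -> R) : cont2 f -> cont2 g -> cont2 (fun x y => f x y * g x y).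
Proof. intros Hf Hg x y; now apply continuity_2d_pt_mult. Qed.

Lemma cont2_fst (f : R -> R) : (forall x, continuity_pt f x) -> cont2 (fun x _ => f x).
Proof. intros Hf x y; apply continuity_1d_2d_pt_comp; [apply Hf | apply continuity_2d_pt_id1]. Qed.

Lemma cont2_snd (f : R -> R) : (forall x, continuity_pt f x) -> cont2 (fun _ y => f y).
Proof. intros Hf; exact (cont2_flip _ (cont2_fst f Hf)). Qed.

Lemma ex_RI_all (f : R -> R) (a b : R) : (forall x, continuity_pt f x) -> ex_RInt f a b.
Proof.
  intros H; apply (ex_RInt_continuous (V := R_CompleteNormedModule)).
  intros z _; apply continuity_pt_filterlim, H.
Qed.

Lemma cp_RI_param_le (k : R -> R -> R) (a b : R) :
  a <= b -> cont2 k -> forall x, continuity_pt (fun x => RI (fun y => k x y) a b) x.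
Proof.
  intros Hab Hk x eps Heps.
  assert (He : 0 < eps / (b - a + 1)) by (apply Rdiv_lt_0_compat; lra).
  destruct (uniform_continuity_2d_1d' k a b x (fun y _ => Hk x y) (mkposreal _ He)) as [d Hd].
  exists d; split; [apply cond_pos |]; intros z [_ Hz]; simpl in *; unfold Rdist in *.
  assert (E : RI (fun y => k z y) a b - RI (fun y => k x y) a b = RI (fun y => k z y + -1 * k x y) a b).
  { rewrite (RI_plus (fun y => k z y) (fun y => -1 * k x y)), (RI_scal (-1) (fun y => k x y)); [ring | | |].
    1, 2: apply ex_RI_all; intros; now apply cont2_r.
    apply ex_RI_all; intros y; apply (cp_mult (fun _ => -1)); [apply cp_const | now apply cont2_r]. }
  rewrite E; eapply Rle_lt_trans.
  - apply (abs_RInt_le_const _ _ _ (eps / (b - a + 1))); [assumption | |].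
    + apply ex_RI_all; intros y; apply cp_plus; [now apply cont2_r |].
      apply (cp_mult (fun _ => -1)); [apply cp_const | now apply cont2_r].
    + intros t Ht; apply Rlt_le.
      replace (k z t + -1 * k x t) with (k z t - k x t) by ring.
      pose proof (cond_pos d).
      apply Hd; try lra; [apply Rabs_def2 in Hz; lra | rewrite Rminus_eq_0, Rabs_R0; assumption].
  - replace ((b - a) * (eps / (b - a + 1))) with (eps - eps / (b - a + 1)) by (field; lra); lra.
Qed.

Lemma RI_swap_bounds (f : R -> R) (a b : R) :
  (forall x, continuity_pt f x) -> RI f a b = - RI f b a.
Proof.
  intros Hf; symmetry; exact (opp_RInt_swap (V := R_CompleteNormedModule) f b a (ex_RI_all f b a Hf)).
Qed.

Lemma cp_RI_param (k : R -> R -> R) (a b : R) :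
  cont2 k -> forall x, continuity_pt (fun x => RI (fun y => k x y) a b) x.
Proof.
  intros Hk x; destruct (Rle_dec a b); [now apply cp_RI_param_le |].
  replace (fun x => RI (fun y => k x y) a b) with (fun x => - RI (fun y => k x y) b a).
  - apply cp_opp, cp_RI_param_le; (assumption || lra).
  - apply functional_extensionality; intros z; symmetry; apply RI_swap_bounds; now apply cont2_r.
Qed.

(** Fubini through the upper limit s of the x-integral: P(s) vanishes at -1 and its derivative is
    the inner integral of the other order. *)
Lemma Int_swap (k : R -> R -> R) :
  cont2 k -> Int (fun x => Int (fun y => k x y)) = Int (fun y => Int (fun x => k x y)).
Proof.
  intros Hk.
  set (P := fun s => RInt (fun y => RI (fun x => k x y) (-1) s) (-1) 1).
  assert (DP : forall s, is_derive P s (Int (fun y => k s y))).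
  { intros s; unfold P.
    assert (D : forall u v, Derive (fun z => RI (fun x => k x v) (-1) z) u = k u v).
    { intros u v; apply is_derive_unique, (derive_RI (fun x => k x v)); now apply cont2_l. }
    replace (Int (fun y => k s y))
      with (RInt (fun t => Derive (fun u => RI (fun x => k x t) (-1) u) s) (-1) 1)
      by (apply RInt_ext; intros; apply D).
    apply (is_derive_RInt_param (fun s y => RI (fun x => k x y) (-1) s) (-1) 1 s).
    - apply filter_forall; intros u t _; eexists.
      apply (derive_RI (fun x => k x t)); now apply cont2_l.
    - intros t _; apply (continuity_2d_pt_ext k); [intros; now rewrite D | apply Hk].
    - apply filter_forall; intros y; apply ex_RI_all.
      apply (cp_RI_param (fun t x => k x t)); now apply cont2_flip. }
  assert (E : Int (fun s => Int (fun y => k s y)) = P 1 - P (-1)).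
  { apply Int_ftc; [exact DP |]; intros s _; now apply cp_RI_param. }
  rewrite E; unfold P at 2.
  rewrite (RInt_ext _ (fun _ => 0)) by (intros; apply RI_point).
  rewrite RInt_const; unfold scal; simpl; unfold mult; simpl.
  unfold P, Int, RI; ring.
Qed.

(** By [Int_swap] the double integral is half of that of the symmetrised kernel. *)
Lemma Int2_ge_0 (k : R -> R -> R) :
  cont2 k -> (forall x y, -1 < x < 1 -> -1 < y < 1 -> 0 <= k x y + k y x) ->
  0 <= Int (fun x => Int (fun y => k x y)).
Proof.
  intros Hk Hp.
  pose proof (cont2_flip k Hk) as Hk'.
  assert (E : Int (fun x => Int (fun y => k x y + k y x))
              = 2 * Int (fun x => Int (fun y => k x y))).
  { transitivity (Int (fun x => Int (fun y => k x y)) + Int (fun x => Int (fun y => k y x))).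
    - rewrite <- Int_plus by (intros x _; now apply cp_RI_param).
      apply Int_ext; intros x _.
      rewrite (Int_plus (fun y => k x y) (fun y => k y x)); [reflexivity | |]; intros y _;
        [now apply cont2_r | now apply cont2_l].
    - rewrite <- (Int_swap k Hk); ring. }
  enough (0 <= Int (fun x => Int (fun y => k x y + k y x))) by lra.
  pose proof (cont2_plus _ _ Hk Hk') as Hs.
  apply Int_ge_0.
  - intros x _; now apply (cp_RI_param (fun x y => k x y + k y x)).
  - intros x Hx; apply Int_ge_0.
    + intros y _; now apply (cont2_r (fun x y => k x y + k y x)).
    + intros y Hy; now apply Hp.
Qed.

Lemma Int_ext_open (f g : R -> R) :
  (forall x, -1 < x < 1 -> f x = g x) -> Int f = Int g.
Proof.
  intros H; apply RInt_ext; rewrite Rmin_left, Rmax_right by lra; exact H.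
Qed.

Lemma Tk_opp (x y : R) : Tk y x = - Tk x y.
Proof. unfold Tk; replace (y * x) with (x * y) by ring; unfold Rdiv; ring. Qed.

Definition kern (n a b : nat) (x y : R) : R :=
  w (clamp x) ^ a * w (clamp y) ^ b * phi n (Tk (clamp x) (clamp y)).

Lemma clamp_prod (x y : R) : clamp x * clamp y = 1 -> clamp x = clamp y /\ w (clamp x) = 0.
Proof.
  intros H; pose proof (clamp_in x); pose proof (clamp_in y).
  unfold w; assert ((clamp x - clamp y) ^ 2 <= 0) by nra.
  assert (E : clamp x = clamp y) by nra.
  split; [exact E | rewrite <- E in H; lra].
Qed.

Lemma cont2_wclamp (a b : nat) : cont2 (fun x y => w (clamp x) ^ a * w (clamp y) ^ b).
Proof.
  assert (H : forall k x, continuity_pt (fun x => w (clamp x) ^ k) x).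
  { intros k x; apply cp_pow, (cp_comp clamp w); [apply cp_clamp | apply cp_w]. }
  apply cont2_mult; [apply (cont2_fst (fun x => w (clamp x) ^ a)) | apply (cont2_snd (fun x => w (clamp x) ^ b))];
    apply H.
Qed.

(* [phi n (Tk x y)] is bounded but discontinuous at the corners where [x y = 1];
   the powers of [w] remove the discontinuity. *)
Lemma cont2_kern (n a b : nat) : (1 <= n)%nat -> (1 <= a + b)%nat -> cont2 (kern n a b).
Proof.
  intros Hn Hab x y.
  pose proof (cont2_wclamp a b x y) as Hw.
  destruct (Req_dec (clamp x * clamp y) 1) as [E | E].
  - intros eps; destruct (Hw eps) as [d Hd]; exists d; intros u v Hu Hv.
    specialize (Hd u v Hu Hv).
    destruct (clamp_prod x y E) as [E1 E2].
    assert (Z : w (clamp x) ^ a * w (clamp y) ^ b = 0).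
    { rewrite <- E1, E2, <- pow_add; apply pow_i; lia. }
    unfold kern at 2; rewrite Z in *; rewrite Rmult_0_l, Rminus_0_r in *.
    eapply Rle_lt_trans; [| exact Hd].
    unfold kern; rewrite Rabs_mult.
    rewrite <- (Rmult_1_r (Rabs (w (clamp u) ^ a * w (clamp v) ^ b))) at 2.
    apply Rmult_le_compat_l; [apply Rabs_pos |].
    apply phi_bound; [assumption |].
    pose proof (clamp_in u); pose proof (clamp_in v).
    destruct (Req_dec (clamp u * clamp v) 1) as [E' | E'].
    + destruct (clamp_prod u v E') as [E3 _]; unfold Tk; rewrite E3, Rminus_eq_0; unfold Rdiv; lra.
    + assert (Hd' : 0 < 1 - clamp u * clamp v) by nra.
      unfold Tk; split; [apply Rle_div_r | apply Rle_div_l]; try exact Hd'; nra.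
  - unfold kern; apply continuity_2d_pt_mult; [exact Hw |].
    apply continuity_1d_2d_pt_comp; [apply phi_cont |].
    pose proof (cont2_fst clamp cp_clamp x y) as C1; pose proof (cont2_snd clamp cp_clamp x y) as C2.
    unfold Tk, Rdiv; apply continuity_2d_pt_mult.
    + now apply continuity_2d_pt_minus.
    + apply continuity_2d_pt_inv; [| lra].
      apply continuity_2d_pt_minus; [apply continuity_2d_pt_const |].
      now apply continuity_2d_pt_mult.
Qed.

(** [green] is multiplied by x w^a F and integrated, with phi replaced by a simpler Q. The
    comparison of phi with Q is only demanded after exchanging x and y and adding, where the factor
    x becomes a difference such as x - y. *)
Lemma green_test (n a : nat) (al : R) (u F : R -> R) (Q : R -> R -> R) :
  (1 <= n)%nat -> axial n al u F -> cont2 Q ->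
  (forall x y, -1 < x < 1 -> -1 < y < 1 ->
    0 <= x * w x ^ a * w y ^ n * (phi n (Tk x y) - Q x y)
         + y * w y ^ a * w x ^ n * (phi n (Tk y x) - Q y x)) ->
  Int (fun x => x * w x ^ a * F x * Int (fun y => w y ^ n * F y * Q x y))
  <= Int (fun x => x * w x ^ a * F x * (mass n * (x - al * Gfun u x))).
Proof.
  intros Hn H HQ Hp.
  pose proof (cp_F _ _ _ _ H) as HF.
  pose proof (ax_pos _ _ _ _ H) as PF.
  pose proof (Ck_cont _ _ (Ck_G n u (ax_u _ _ _ _ H))) as HG.
  set (p := fun x y => x * F x * F y * (w x ^ a * w y ^ n * Q x y)).
  set (k := fun x y => x * F x * F y * kern n a n x y + -1 * p x y).
  assert (C0 : cont2 (fun x y => x * F x * F y)).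
  { apply (cont2_mult (fun x y => x * F x) (fun x y => F y));
      [apply (cont2_fst (fun x => x * F x)); intros; cnt | now apply cont2_snd]. }
  assert (Cp : cont2 p).
  { apply (cont2_mult (fun x y => x * F x * F y)); [exact C0 |].
    apply (cont2_mult (fun x y => w x ^ a * w y ^ n)); [| exact HQ].
    apply (cont2_mult (fun x y => w x ^ a) (fun x y => w y ^ n));
      [apply (cont2_fst (fun x => w x ^ a)) | apply (cont2_snd (fun x => w x ^ n))]; intros; cntw. }
  assert (C1 : cont2 (fun x y => x * F x * F y * kern n a n x y)).
  { apply (cont2_mult (fun x y => x * F x * F y)); [exact C0 | apply cont2_kern; lia]. }
  assert (Ck : cont2 k).
  { apply cont2_plus; [exact C1 |].
    apply (cont2_mult (fun x y => -1)); [intros x y; apply continuity_2d_pt_const | exact Cp]. }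
  assert (Hk : forall x y, -1 < x < 1 -> -1 <= y <= 1 ->
    k x y = x * w x ^ a * F x * (w y ^ n * F y * phi n (Tk x y))
            + - (x * w x ^ a * F x) * (w y ^ n * F y * Q x y)).
  { intros x y Hx Hy; unfold k, p, kern; rewrite !clamp_id by lra; ring. }
  assert (P : 0 <= Int (fun x => Int (fun y => k x y))).
  { apply Int2_ge_0; [exact Ck |]; intros x y Hx Hy; rewrite !Hk by lra.
    specialize (Hp x y Hx Hy); pose proof (Rmult_lt_0_compat _ _ (PF x) (PF y)).
    match goal with |- 0 <= ?t => replace t with (F x * F y * (x * w x ^ a * w y ^ n * (phi n (Tk x y) - Q x y)
         + y * w y ^ a * w x ^ n * (phi n (Tk y x) - Q y x))) by ring end.
    apply Rmult_le_pos; lra. }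
  assert (CQ : forall x, contI (fun y => w y ^ n * F y * Q x y)).
  { intros x y _; apply cp_mult; [cntw | now apply cont2_r]. }
  assert (CI : forall x, continuity_pt (fun x => Int (fun y => w y ^ n * F y * Q x y)) x).
  { apply (cp_RI_param (fun x y => w y ^ n * F y * Q x y)).
    apply (cont2_mult (fun x y => w y ^ n * F y)); [| exact HQ].
    apply (cont2_snd (fun x => w x ^ n * F x)); intros; cntw. }
  enough (E : Int (fun x => Int (fun y => k x y))
    = Int (fun x => x * w x ^ a * F x * (mass n * (x - al * Gfun u x)))
      - Int (fun x => x * w x ^ a * F x * Int (fun y => w y ^ n * F y * Q x y))) by lra.
  transitivity (Int (fun x => 1 * (x * w x ^ a * F x * (mass n * (x - al * Gfun u x)))
      + -1 * (x * w x ^ a * F x * Int (fun y => w y ^ n * F y * Q x y)))).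
  2:{ rewrite Int_lin by (intros x _; cntw); ring. }
  apply Int_ext_open; intros x Hx.
  rewrite (Int_ext (fun y => k x y) _ (fun y Hy => Hk x y Hx Hy)).
  rewrite Int_lin, (green n al u F x Hn H Hx); [ring | now apply contI_green | apply CQ].
Qed.

Lemma phi_Tk_ge (n : nat) (x y : R) :
  (1 <= n)%nat -> -1 < x < 1 -> -1 < y < 1 ->
  (x - y) ^ 2 / (1 - x * y) <= (x - y) * phi n (Tk x y).
Proof.
  intros Hn Hx Hy.
  pose proof (Tk_den x y Hx ltac:(lra)) as Hd.
  pose proof (phi_ge_id n _ Hn (Tk_bound x y Hx ltac:(lra))) as E.
  assert (ET : x - y = (1 - x * y) * Tk x y) by (unfold Tk; field; lra).
  replace ((x - y) ^ 2 / (1 - x * y)) with ((x - y) * Tk x y) by (unfold Tk; field; lra).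
  rewrite ET; nra.
Qed.

(** * Bounds on the second moment *)

Lemma EF_quad (n : nat) (al : R) (u F : R -> R) (a b c : R) :
  axial n al u F -> al <> 1 ->
  EF n F (fun y => a + b * y + c * y ^ 2) = a * mass n + c * mom2 n F.
Proof.
  intros H Hal; pose proof (cp_F _ _ _ _ H) as HF.
  rewrite (EF_ext n F _ (fun y => 1 * (a * 1 + b * y) + c * y ^ 2)) by (intros; ring).
  rewrite !EF_lin by (intros x _; cntw).
  rewrite (EF_1 n al u F H); destruct (center_of_mass n al u F H Hal) as [_ ->].
  unfold mom2; ring.
Qed.

Lemma mom2_pos (n : nat) (al : R) (u F : R -> R) : axial n al u F -> 0 < mom2 n F < mass n.
Proof.
  intros H; pose proof (cp_F _ _ _ _ H) as HF; pose proof (ax_pos _ _ _ _ H) as PF.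
  assert (P : 0 <= mom2 n F).
  { apply Int_ge_0; [intros x _; cntw |]; intros x Hx.
    apply Rmult_le_pos; [apply Rmult_le_pos; [apply pow_le, Rlt_le, w_pos, Hx | apply Rlt_le, PF] | apply pow2_ge_0]. }
  split.
  - destruct P as [P | P]; [exact P | exfalso].
    assert (Z : w (1/2) ^ n * F (1/2) * (1/2) ^ 2 = 0).
    { apply (Int_zero (fun x => w x ^ n * F x * x ^ 2)); [intros x _; cntw | | symmetry; exact P | lra].
      intros x Hx.
      apply Rmult_le_pos; [apply Rmult_le_pos; [apply pow_le, Rlt_le, w_pos, Hx | apply Rlt_le, PF] | apply pow2_ge_0]. }
    assert (0 < w (1/2) ^ n) by (apply pow_lt, w_pos; lra).
    specialize (PF (1/2)); nra.
  - assert (Q : 0 < EF n F (fun x => 1 * 1 + -1 * x ^ 2)).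
    { apply Int_gt_0; [intros x _; cntw |]; intros x Hx.
      apply Rmult_lt_0_compat; [apply Rmult_lt_0_compat; [apply pow_lt, w_pos, Hx | apply PF] | nra]. }
    rewrite EF_lin, (EF_1 n al u F H) in Q by (intros x _; cntw).
    unfold mom2; lra.
Qed.

(** The factor 1 / (1 - x y) of [phi_Tk_ge] is replaced by its tangent 2l - l^2 (1 - x y), the error
    being a square over 1 - x y. Only W and m remain after integration, and l = W / (W + m)
    maximises 2 l W - l^2 (W + m). *)
Lemma dfct_upper (n : nat) (al : R) (u F : R -> R) :
  (1 <= n)%nat -> axial n al u F -> al <> 1 ->
  al * dfct n u F <= mom2 n F ^ 2 / (mass n + mom2 n F).
Proof.
  intros Hn H Hal.
  pose proof (cp_F _ _ _ _ H) as HF.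
  pose proof (Ck_cont _ _ (Ck_G n u (ax_u _ _ _ _ H))) as HG.
  destruct (mom2_pos n al u F H) as [Hm _]; pose proof (mass_pos n) as HM.
  set (m := mom2 n F) in *; set (W := mass n) in *; set (l := W / (W + m)).
  assert (E : Int (fun x => x * w x ^ n * F x * Int (fun y => w y ^ n * F y * ((x - y) * (2 * l - l ^ 2 * (1 - x * y)))))
    <= Int (fun x => x * w x ^ n * F x * (W * (x - al * Gfun u x)))).
  { apply (green_test n n al u F (fun x y => (x - y) * (2 * l - l ^ 2 * (1 - x * y)))); try assumption.
    - intros x y; repeat first [apply continuity_2d_pt_mult | apply continuity_2d_pt_minus
        | apply continuity_2d_pt_const | apply continuity_2d_pt_id1 | apply continuity_2d_pt_id2].
    - intros x y Hx Hy; rewrite (Tk_opp x y), phi_opp.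
      pose proof (phi_Tk_ge n x y Hn Hx Hy) as P.
      pose proof (Tk_den x y Hx ltac:(lra)) as Hd.
      match goal with |- 0 <= ?t => replace t with (w x ^ n * w y ^ n *
        ((x - y) * phi n (Tk x y) - (x - y) ^ 2 / (1 - x * y)
          + ((x - y) * (1 - l * (1 - x * y))) ^ 2 / (1 - x * y))) by (field; lra) end.
      apply Rmult_le_pos; [apply Rmult_le_pos; apply pow_le, Rlt_le, w_pos; assumption |].
      apply Rplus_le_le_0_compat; [lra |].
      apply Rmult_le_pos; [apply pow2_ge_0 | now apply Rlt_le, Rinv_0_lt_compat]. }
  rewrite (Int_ext _ (fun x => ((2 * l - l ^ 2) * W - l ^ 2 * m) * (w x ^ n * F x * x ^ 2))) in E.
  2:{ intros x _.
      replace (Int (fun y => w y ^ n * F y * ((x - y) * (2 * l - l ^ 2 * (1 - x * y)))))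
        with (EF n F (fun y => (2 * l - l ^ 2) * x + (l ^ 2 * x ^ 2 - (2 * l - l ^ 2)) * y + - (l ^ 2 * x) * y ^ 2))
        by (apply Int_ext; intros; ring).
      rewrite (EF_quad n al u F) by assumption; fold m W; ring. }
  rewrite (Int_ext (fun x => x * w x ^ n * F x * (W * (x - al * Gfun u x)))
     (fun x => W * (w x ^ n * F x * x ^ 2) + - (W * al) * (w x ^ n * F x * (x * Gfun u x)))) in E
    by (intros; ring).
  rewrite Int_scal, Int_lin in E by (intros x _; cntw).
  change (Int (fun x => w x ^ n * F x * x ^ 2)) with m in E.
  change (Int (fun x => w x ^ n * F x * (x * Gfun u x))) with (dfct n u F) in E.
  replace (((2 * l - l ^ 2) * W - l ^ 2 * m) * m) with (W * (m * W / (W + m))) in E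
    by (unfold l; field; lra).
  apply (Rmult_le_reg_l W); [exact HM |].
  replace (W * (m ^ 2 / (W + m))) with (W * m - W * (m * W / (W + m))) by (field; lra).
  lra.
Qed.

Lemma E0_nonneg (n : nat) (u : R -> R) : Ck (2 * n + 5) u -> 0 <= E0 n u.
Proof.
  intros Hu; pose proof (cp_psi n u Hu); apply Int_ge_0; [intros x _; cnt | intros; apply pow2_ge_0].
Qed.

(** Eliminating int x v between [energy1] and [first_harmonic] gives (1 - 1 / (al (2n+3))) dfct >=
    0, and al (2n+3) > 1. *)
Lemma dfct_nonneg (n : nat) (al : R) (u F : R -> R) :
  (1 <= n)%nat -> axial n al u F -> 1 / 2 <= al -> 0 <= dfct n u F.
Proof.
  intros Hn H Hal.
  pose proof (energy1 n al u F Hn H) as E1; pose proof (first_harmonic n al u F H) as E2.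
  pose proof (E0_nonneg n u (ax_u _ _ _ _ H)) as HE; pose proof (pos_INR n) as Hi.
  assert (0 <= al / INR (fact (2 * n + 1)) * ((INR n + / 2) * E0 n u)).
  { apply Rmult_le_pos; [| apply Rmult_le_pos; lra].
    apply Rmult_le_pos; [lra | apply Rlt_le, Rinv_0_lt_compat, INR_fact_lt_0]. }
  apply le_INR in Hn; simpl in Hn.
  assert (1 < al * (2 * INR n + 3)) by nra.
  nra.
Qed.

(** As [dfct] is nonnegative, al may be lowered to 1/2 in [dfct_upper]. Expressed through m, the
    result factors as (W - m)(W - (2n+1) m) >= 0, and m < W. *)
Lemma mom2_bound (n : nat) (al : R) (u F : R -> R) :
  (1 <= n)%nat -> axial n al u F -> 1 / 2 <= al -> al <> 1 ->
  (2 * INR n + 1) * mom2 n F <= mass n.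
Proof.
  intros Hn H Hal Hal1.
  pose proof (dfct_upper n al u F Hn H Hal1) as U.
  pose proof (dfct_mom2 n al u F H) as D1; rewrite S_INR in D1.
  destruct (mom2_pos n al u F H) as [Hm Hm1]; pose proof (pos_INR n) as Hi.
  set (m := mom2 n F) in *; set (W := mass n) in *; set (d := dfct n u F) in *.
  assert (U2 : d / 2 * (W + m) <= m ^ 2).
  { apply (Rmult_le_compat_r (W + m)) in U; [| lra].
    replace (m ^ 2 / (W + m) * (W + m)) with (m ^ 2) in U by (field; lra); nra. }
  nra.
Qed.

(** * Total mass of F for the weaker weight w^(n-1) *)

Lemma EF_low_derive (p : nat) (al : R) (u F : R -> R) :
  axial (S p) al u F ->
  2 * (INR p + 1) * EF p F (fun _ => 1)
  = (2 * INR p + 3) * mass (S p) + 2 * (INR p + 2) * EF p F (fun x => x * Gfun u x).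
Proof.
  intros H.
  pose proof (cp_F _ _ _ _ H) as HF; pose proof (ax_F _ _ _ _ H) as DF.
  pose proof (Ck_cont _ _ (Ck_G _ u (ax_u _ _ _ _ H))) as HG.
  assert (E : Int (fun x => - (2 * (INR p + 1)) * (w x ^ p * F x * 1)
     + (2 * INR p + 3) * (w x ^ S p * F x * 1) + 2 * (INR p + 2) * (w x ^ p * F x * (x * Gfun u x))) = 0).
  { rewrite (Int_ftc (fun x => w x ^ S p * F x * x)).
    - rewrite w_1, w_m1; simpl; ring.
    - intros x; evar_last.
      + deriv.
      + unfold Gfun, one; simpl pred; rewrite !S_INR; simpl; unfold w; ring.
    - intros x _; cntw. }
  rewrite Int_lin3 in E by (intros x _; cntw).
  pose proof (EF_1 _ al u F H) as E1; unfold EF in *; rewrite E1 in E; lra.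
Qed.

(** The outer weight w^p is one power below the inner one, so symmetrising produces x w(y) - y w(x)
    = (x - y)(1 + x y). The minorant uses the tangent of 1 / (1 - x y) at x y = 0, which is 1 + x
    y. *)
Lemma EF_low_upper (p : nat) (al : R) (u F : R -> R) :
  axial (S p) al u F -> al <> 1 ->
  al * mass (S p) * EF p F (fun x => x * Gfun u x)
  <= mom2 (S p) F * (EF p F (fun _ => 1) - mass (S p)).
Proof.
  intros H Hal.
  pose proof (cp_F _ _ _ _ H) as HF.
  pose proof (Ck_cont _ _ (Ck_G _ u (ax_u _ _ _ _ H))) as HG.
  assert (E : Int (fun x => x * w x ^ p * F x * Int (fun y => w y ^ S p * F y * ((x - y) * (1 + x * y))))
    <= Int (fun x => x * w x ^ p * F x * (mass (S p) * (x - al * Gfun u x)))).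
  { apply (green_test (S p) p al u F (fun x y => (x - y) * (1 + x * y))); try (assumption || lia).
    - intros x y; repeat first [apply continuity_2d_pt_mult | apply continuity_2d_pt_minus
        | apply continuity_2d_pt_plus
        | apply continuity_2d_pt_const | apply continuity_2d_pt_id1 | apply continuity_2d_pt_id2].
    - intros x y Hx Hy; rewrite (Tk_opp x y), phi_opp.
      pose proof (phi_Tk_ge (S p) x y ltac:(lia) Hx Hy) as P.
      pose proof (Tk_den x y Hx ltac:(lra)) as Hd.
      match goal with |- 0 <= ?t => replace t with (w x ^ p * w y ^ p * ((1 + x * y) *
        ((x - y) * phi (S p) (Tk x y) - (x - y) ^ 2 / (1 - x * y)
          + ((x - y) * (x * y)) ^ 2 / (1 - x * y)))) by (simpl pow; unfold w; field; lra) end.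
      apply Rmult_le_pos; [apply Rmult_le_pos; apply pow_le, Rlt_le, w_pos; assumption |].
      apply Rmult_le_pos; [nra |].
      apply Rplus_le_le_0_compat; [lra |].
      apply Rmult_le_pos; [apply pow2_ge_0 | now apply Rlt_le, Rinv_0_lt_compat]. }
  set (m := mom2 (S p) F) in *; set (W := mass (S p)) in *.
  rewrite (Int_ext _ (fun x => (W - m) * (w x ^ p * F x * 1) + - (W - m) * (w x ^ S p * F x * 1))) in E.
  2:{ intros x _.
      replace (Int (fun y => w y ^ S p * F y * ((x - y) * (1 + x * y))))
        with (EF (S p) F (fun y => x + (x ^ 2 - 1) * y + - x * y ^ 2))
        by (apply Int_ext; intros; ring).
      rewrite (EF_quad (S p) al u F) by assumption; fold m W; simpl; unfold w; ring. }
  rewrite (Int_ext (fun x => x * w x ^ p * F x * (W * (x - al * Gfun u x)))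
     (fun x => W * (w x ^ p * F x * 1) + - W * (w x ^ S p * F x * 1)
               + - (W * al) * (w x ^ p * F x * (x * Gfun u x)))) in E
    by (intros; simpl; unfold w; ring).
  rewrite Int_lin, Int_lin3 in E by (intros x _; cntw).
  pose proof (EF_1 _ al u F H) as E1; fold W in E1; unfold EF in *; rewrite E1 in E; lra.
Qed.

(** Needed because the trace bound, divided by w^n, leaves the weight w^p with p = n - 1. The two
    preceding lemmas bound int w^p F and int w^p F x G through each other, and m <= W / (2p+3)
    closes the loop. *)
Lemma EF_low_bound (p : nat) (al : R) (u F : R -> R) :
  axial (S p) al u F -> 1 / 2 <= al -> al <> 1 ->
  (4 * INR p ^ 2 + 6 * INR p - 2) * EF p F (fun _ => 1)
  <= (4 * INR p ^ 2 + 8 * INR p + 1) * mass (S p).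
Proof.
  intros H Hal Hal1.
  pose proof (cp_F _ _ _ _ H) as HF; pose proof (ax_pos _ _ _ _ H) as PF.
  pose proof (EF_low_derive p al u F H) as E1.
  pose proof (EF_low_upper p al u F H Hal1) as E2.
  pose proof (mom2_bound (S p) al u F ltac:(lia) H Hal Hal1) as E3; rewrite S_INR in E3.
  destruct (mom2_pos (S p) al u F H) as [Hm _]; pose proof (mass_pos (S p)) as HW; pose proof (pos_INR p) as Hp.
  assert (HZ : mass (S p) <= EF p F (fun _ => 1)).
  { rewrite <- (EF_1 _ al u F H); apply Int_le; [intros x _; cntw | intros x _; cntw |].
    intros x Hx; pose proof (w_pos x Hx); pose proof (PF x); pose proof (pow_lt _ p (w_pos x Hx)).
    assert (w x <= 1) by (unfold w; nra).
    rewrite <- tech_pow_Rmult; assert (0 < w x ^ p * F x) by nra; nra. }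
  set (e := EF p F (fun x => x * Gfun u x)) in *; set (Z := EF p F (fun _ => 1)) in *.
  set (m := mom2 (S p) F) in *; set (W := mass (S p)) in *.
  assert (E4 : (2 * INR p + 3) * e <= 2 * (Z - W)).
  { destruct (Rle_dec e 0) as [He | He]; [nra |].
    assert (W * e / 2 <= m * (Z - W)) by (assert (0 < W * e) by nra; nra).
    apply (Rmult_le_reg_l W); [assumption |].
    nra. }
  nra.
Qed.

(** Expresses the constant of the trace bound through the mass, so that no factorial or binomial
    coefficient is left in the final comparison. *)
Lemma trace_const (p : nat) :
  Binomial.C (2 * p) p / (2 ^ (2 * p + 1) * INR (fact (2 * p + 1))) * mass (S p) * INR (fact (2 * p + 3))
  * (2 * INR p + 1) = (2 * INR p + 2) ^ 2.
Proof.
  pose proof (mass_binomial p) as E; pose proof (mass_S p) as E2; pose proof (pos_INR p).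
  pose proof (INR_fact_lt_0 (2 * p + 1)) as Hf.
  replace (2 * p + 3)%nat with (S (S (2 * p + 1))) by lia.
  rewrite !(fact_simpl (S _)), (fact_simpl (2 * p + 1)), !mult_INR, !S_INR, plus_INR, mult_INR.
  change (INR 2) with 2; change (INR 1) with 1.
  assert (Hp : 0 < 2 ^ (2 * p + 1)) by (apply pow_lt; lra).
  assert (Hp2 : 2 ^ (2 * p + 1) = 2 * 4 ^ p).
  { rewrite pow_add, pow_mult; replace (2 ^ 2) with 4 by ring; ring. }
  set (C := Binomial.C (2 * p) p) in *; set (f := INR (fact (2 * p + 1))) in *.
  apply (Rmult_eq_reg_r (2 ^ (2 * p + 1))); [| lra].
  transitivity (((2 * INR p + 1) * C) * (2 * INR p + 2) * ((2 * INR p + 3) * mass (S p))).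
  - field; lra.
  - rewrite E2; transitivity (((2 * INR p + 1) * C * mass p) * (2 * INR p + 2) ^ 2); [ring |].
    rewrite E, Hp2; ring.
Qed.

(** If E0 > 0, the integral of w^n F G^2 is bounded above by [trace_bound] and below by [energy2]
    with [psi_gap]. Both bounds are proportional to E0, which cancels and leaves an inequality in q
    = p alone. *)
Lemma energy_zero_large (p : nat) (al : R) (u F : R -> R) :
  (2 <= p)%nat -> axial (S p) al u F -> 1 / 2 <= al -> al <> 1 -> E0 (S p) u = 0.
Proof.
  intros Hp H Hal Hal1.
  pose proof (ax_u _ _ _ _ H) as Hu.
  destruct (E0_nonneg _ u Hu) as [HE | HE]; [exfalso | now symmetry].
  destruct (center_of_mass _ al u F H Hal1) as [Hv _].
  pose proof (cp_F _ _ _ _ H) as HF; pose proof (ax_pos _ _ _ _ H) as PF.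
  pose proof (Ck_cont _ _ (Ck_G _ u Hu)) as HG.
  pose proof (energy2 (S p) al u F ltac:(lia) H) as E2.
  pose proof (psi_gap (S p) u ltac:(lia) Hu Hv) as Eg.
  pose proof (EF_low_bound p al u F H Hal Hal1) as EZ.
  pose proof (trace_const p) as Et.
  pose proof (mass_pos (S p)) as HW.
  set (c := Binomial.C (2 * p) p / (2 ^ (2 * p + 1) * INR (fact (2 * p + 1)))) in *.
  set (N0 := INR (fact (2 * p + 2)) * mass (S p)).
  pose proof (INR_fact_lt_0 (2 * p + 2)) as Hf.
  assert (HN : 0 < N0) by (apply Rmult_lt_0_compat; assumption).
  set (E := E0 (S p) u) in *.
  assert (B : EF (S p) F (fun x => Gfun u x ^ 2)
     <= Int (fun x => E * c * (w x ^ p * F x * 1) + - (E / N0) * (w x ^ S p * F x * 1))).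
  { apply Int_le; [intros x _; cntw | intros x _; cntw |].
    intros x Hx; pose proof (trace_bound p u x Hu Hv HE ltac:(lra)) as T.
    fold c N0 E in T; rewrite vfun_G in T; pose proof (pow_lt _ (S p) (w_pos x Hx)) as Hw.
    replace (w x ^ (2 * p + 1)) with (w x ^ S p * w x ^ p) in T by (rewrite <- pow_add; f_equal; lia).
    replace (w x ^ (2 * p + 2)) with (w x ^ S p * w x ^ S p) in T by (rewrite <- pow_add; f_equal; lia).
    apply (Rmult_le_reg_l (w x ^ S p)); [exact Hw |].
    apply (Rmult_le_compat_r (F x)) in T; [| apply Rlt_le, PF].
    eapply Rle_trans; [| eapply Rle_trans; [exact T |]]; right; [ring |].
    field; lra. }
  rewrite Int_lin in B by (intros x _; cntw).
  change (Int (fun x => w x ^ p * F x * 1)) with (EF p F (fun _ => 1)) in B.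
  change (Int (fun x => w x ^ S p * F x * 1)) with (EF (S p) F (fun _ => 1)) in B.
  rewrite (EF_1 _ al u F H) in B.
  set (g := EF (S p) F (fun x => Gfun u x ^ 2)) in *; set (Z := EF p F (fun _ => 1)) in *.
  replace (2 * S p + 1)%nat with (2 * p + 3)%nat in E2 by lia.
  set (W := mass (S p)) in *.
  assert (Hf3 : INR (fact (2 * p + 3)) = (2 * INR p + 3) * INR (fact (2 * p + 2))).
  { replace (2 * p + 3)%nat with (S (2 * p + 2)) by lia.
    rewrite fact_simpl, mult_INR, S_INR, plus_INR, mult_INR; simpl (INR 2); ring. }
  assert (Hf3p : 0 < INR (fact (2 * p + 3))) by apply INR_fact_lt_0.
  rewrite !S_INR in *; apply le_INR in Hp; change (INR 2) with 2 in Hp.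
  set (q := INR p) in *.
  assert (L : (2 * q + 5) / 4 * E <= INR (fact (2 * p + 3)) * g).
  { assert (Ea : 1 / 2 * ((q + 2) * (2 * q + 5) * E) <= al * (E1 (S p) u + (q + 1 + 1) ^ 2 * E)).
    { assert ((q + 2) * (2 * q + 5) * E <= E1 (S p) u + (q + 1 + 1) ^ 2 * E) by lra.
      assert (0 <= (q + 2) * (2 * q + 5) * E) by (apply Rmult_le_pos; nra).
      nra. }
    assert (Eb : INR (fact (2 * p + 3)) * (2 * (q + 1 + 1) * g) = al * (E1 (S p) u + (q + 1 + 1) ^ 2 * E))
      by (rewrite E2; field; lra).
    rewrite <- Eb in Ea; apply (Rmult_le_reg_l (2 * (q + 2))); [lra |]; lra. }
  assert (U : INR (fact (2 * p + 3)) * g <= E * (INR (fact (2 * p + 3)) * c * Z - (2 * q + 3))).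
  { apply (Rmult_le_compat_l (INR (fact (2 * p + 3)))) in B; [| lra].
    eapply Rle_trans; [exact B |]; right; unfold N0; rewrite Hf3; field; lra. }
  assert (U2 : (2 * q + 5) / 4 <= INR (fact (2 * p + 3)) * c * Z - (2 * q + 3)).
  { apply (Rmult_le_reg_l E); [exact HE | lra]. }
  set (k := INR (fact (2 * p + 3)) * c) in *.
  assert (Et2 : k * W * (2 * q + 1) = (2 * q + 2) ^ 2) by (rewrite <- Et; unfold k; ring).
  assert (Hk : 0 < k).
  { assert (0 < W * (2 * q + 1)) by (apply Rmult_lt_0_compat; lra).
    apply (Rmult_lt_reg_r (W * (2 * q + 1))); [assumption | nra]. }
  assert (Ez2 : (4 * q ^ 2 + 6 * q - 2) * (k * Z * (2 * q + 1)) <= (4 * q ^ 2 + 8 * q + 1) * (2 * q + 2) ^ 2).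
  { rewrite <- Et2; apply (Rmult_le_compat_l (k * (2 * q + 1))) in EZ; [lra | apply Rlt_le, Rmult_lt_0_compat; lra]. }
  assert (U3 : (10 * q + 17) / 4 * (2 * q + 1) <= k * Z * (2 * q + 1)) by nra.
  assert (U4 : (4 * q ^ 2 + 6 * q - 2) * ((10 * q + 17) / 4 * (2 * q + 1))
               <= (4 * q ^ 2 + 8 * q + 1) * (2 * q + 2) ^ 2).
  { eapply Rle_trans; [| exact Ez2]; apply Rmult_le_compat_l; [nra | exact U3]. }
  assert (0 <= q - 2) by lra.
  (* [U4] says that this quartic is at most 0, while in powers of q - 2 >= 0 all its coefficients
     are positive. *)
  replace (16 * q ^ 4 + 40 * q ^ 3 - 44 * q ^ 2 - 146 * q - 50)
    with (16 * (q - 2) ^ 4 + 168 * (q - 2) ^ 3 + 580 * (q - 2) ^ 2 + 670 * (q - 2) + 58) by ring.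
  pose proof (pow_le (q - 2) 4 H0); pose proof (pow_le (q - 2) 3 H0); pose proof (pow_le (q - 2) 2 H0).
  lra.
Qed.

(** * Pointwise bound on G' and the low-dimensional cases *)

Lemma derive_nonneg_of_incr (f : R -> R) (x l : R) :
  -1 < x < 1 -> is_derive f x l ->
  (forall y z, -1 < y -> y <= z -> z < 1 -> f y <= f z) -> 0 <= l.
Proof.
  intros Hx Hd Hm; apply is_derive_Reals in Hd.
  destruct (Rle_dec 0 l) as [H | H]; [exact H | exfalso].
  destruct (Hd (- l) ltac:(lra)) as [d Hdd].
  set (h := Rmin (d / 2) ((1 - x) / 2)); pose proof (cond_pos d).
  assert (Hh : 0 < h) by (unfold h; apply Rmin_case; lra).
  assert (Hh1 : h < d) by (pose proof (Rmin_l (d / 2) ((1 - x) / 2)); unfold h; lra).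
  assert (Hh2 : h < 1 - x) by (pose proof (Rmin_r (d / 2) ((1 - x) / 2)); unfold h; lra).
  specialize (Hdd h ltac:(lra) ltac:(rewrite Rabs_right; lra)).
  apply Rabs_def2 in Hdd.
  assert (0 <= (f (x + h) - f x) / h); [| lra].
  pose proof (Hm x (x + h) ltac:(lra) ltac:(lra) ltac:(lra)).
  apply Rmult_le_pos; [lra | now apply Rlt_le, Rinv_0_lt_compat].
Qed.

(** A minorant quadratic in y, so that its integral against w^n F is known from the moments. With t
    = (x1 + x2) y / 2 the denominator is at most (1 - t)^2, which reduces the claim to (1 + 2t -
    3y^2)(1 - t)^2 <= 1 - y^2. *)
Lemma Tk_slope (x1 x2 y : R) :
  -1 < x1 -> x1 <= x2 -> x2 < 1 -> -1 <= y <= 1 ->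
  (x2 - x1) * (1 + (x1 + x2) * y - 3 * y ^ 2) <= Tk x2 y - Tk x1 y.
Proof.
  intros H1 H12 H2 Hy.
  pose proof (Tk_den x1 y ltac:(lra) Hy) as D1; pose proof (Tk_den x2 y ltac:(lra) Hy) as D2.
  replace (Tk x2 y - Tk x1 y) with ((x2 - x1) * ((1 - y ^ 2) / ((1 - x1 * y) * (1 - x2 * y))))
    by (unfold Tk; field; split; lra).
  apply Rmult_le_compat_l; [lra |].
  assert (HD : 0 < (1 - x1 * y) * (1 - x2 * y)) by (now apply Rmult_lt_0_compat).
  apply Rle_div_r; [exact HD |].
  set (t := (x1 + x2) / 2 * y).
  assert (Ht : Rabs t <= Rabs y).
  { unfold t; rewrite Rabs_mult; pose proof (Rabs_pos y).
    assert (Rabs ((x1 + x2) / 2) <= 1) by (apply Rabs_le; lra); nra. }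
  replace (1 + (x1 + x2) * y - 3 * y ^ 2) with (1 + 2 * t - 3 * y ^ 2) by (unfold t; field).
  assert (Ha : (1 - x1 * y) * (1 - x2 * y) <= (1 - t) ^ 2).
  { unfold t; pose proof (pow2_ge_0 ((x1 - x2) * y)); nra. }
  destruct (Rle_dec (1 + 2 * t - 3 * y ^ 2) 0) as [Hs | Hs]; [nra |].
  assert (Hb : (1 + 2 * t - 3 * y ^ 2) * (1 - t) ^ 2 <= 1 - y ^ 2).
  { assert (Ht2 : t ^ 2 <= y ^ 2) by (rewrite <- (pow2_abs t), <- (pow2_abs y); apply pow_incr; split; [apply Rabs_pos | exact Ht]).
    (* The difference of the two sides is affine in y^2 on [t^2, 1]; the sign of its slope decides
       which endpoint to compare with. *)
    destruct (Rle_dec 0 (3 * (1 - t) ^ 2 - 1)) as [Hc | Hc].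
    - assert (0 <= (y ^ 2 - t ^ 2) * (3 * (1 - t) ^ 2 - 1)) by (apply Rmult_le_pos; lra); nra.
    - assert (0 <= (1 - y ^ 2) * (1 - 3 * (1 - t) ^ 2)) by (apply Rmult_le_pos; lra); nra. }
  eapply Rle_trans; [| exact Hb]; apply Rmult_le_compat_l; lra.
Qed.

(** Instead of differentiating under the integral, W (x - al G) - r (W - 3m) x with r = n / (n + 1)
    is shown to be nondecreasing: [green] is compared at two points, using [phi_slope] and
    [Tk_slope]. *)
Lemma dG_bound (n : nat) (al : R) (u F : R -> R) (x : R) :
  (1 <= n)%nat -> axial n al u F -> al <> 1 -> -1 < x < 1 ->
  al * mass n * Derive (Gfun u) x <= mass n - INR n / (INR n + 1) * (mass n - 3 * mom2 n F).
Proof.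
  intros Hn H Hal Hx.
  pose proof (cp_F _ _ _ _ H) as HF; pose proof (ax_pos _ _ _ _ H) as PF.
  pose proof (Ck_G n u (ax_u _ _ _ _ H)) as HG.
  pose proof (Ck_is_derive _ 0 _ HG ltac:(lia)) as DG.
  change (forall x, is_derive (Gfun u) x (Derive (Gfun u) x)) in DG.
  set (r := INR n / (INR n + 1)).
  assert (Hr : 0 <= r).
  { pose proof (pos_INR n); apply Rmult_le_pos; [lra | apply Rlt_le, Rinv_0_lt_compat; lra]. }
  set (W := mass n); set (m := mom2 n F).
  set (g := fun x => W * (x - al * Gfun u x) - r * (W - 3 * m) * x).
  assert (D : is_derive g x (W * (1 - al * Derive (Gfun u) x) - r * (W - 3 * m))).
  { unfold g; evar_last.
    - deriv.
    - ring. }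
  enough (0 <= W * (1 - al * Derive (Gfun u) x) - r * (W - 3 * m)) by lra.
  apply (derive_nonneg_of_incr g x _ Hx D).
  intros x1 x2 H1 H12 H2; unfold g, W.
  rewrite <- (green n al u F x1) by (first [assumption | lra]).
  rewrite <- (green n al u F x2) by (first [assumption | lra]).
  assert (CS : forall x, -1 < x < 1 -> contI (fun y => w y ^ n * F y * phi n (Tk x y)))
    by (intros; now apply contI_green).
  pose proof (EF_quad n al u F (r * (x2 - x1)) (r * (x2 - x1) * (x1 + x2)) (-3 * r * (x2 - x1)) H Hal) as EQ.
  fold m W in EQ; change (mass n) with W.
  enough (EF n F (fun y => r * (x2 - x1) + r * (x2 - x1) * (x1 + x2) * y + -3 * r * (x2 - x1) * y ^ 2)
     <= Int (fun y => 1 * (w y ^ n * F y * phi n (Tk x2 y)) + -1 * (w y ^ n * F y * phi n (Tk x1 y)))).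
  { rewrite Int_lin in H0 by (apply CS; lra); lra. }
  apply Int_le.
  - intros y _; cntw.
  - intros y Hy; pose proof (CS x1 ltac:(lra) y Hy); pose proof (CS x2 ltac:(lra) y Hy); cnt.
  - intros y Hy.
    assert (E : r * ((x2 - x1) * (1 + (x1 + x2) * y - 3 * y ^ 2)) <= phi n (Tk x2 y) - phi n (Tk x1 y)).
    { pose proof (Tk_slope x1 x2 y H1 H12 H2 ltac:(lra)) as S.
      assert (Hm : 0 <= Tk x2 y - Tk x1 y).
      { pose proof (Tk_den x1 y ltac:(lra) ltac:(lra)); pose proof (Tk_den x2 y ltac:(lra) ltac:(lra)).
        replace (Tk x2 y - Tk x1 y) with ((x2 - x1) * (1 - y ^ 2) / ((1 - x1 * y) * (1 - x2 * y)))
          by (unfold Tk; field; split; lra).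
        apply Rmult_le_pos; [apply Rmult_le_pos; nra | apply Rlt_le, Rinv_0_lt_compat, Rmult_lt_0_compat; assumption]. }
      eapply Rle_trans; [apply Rmult_le_compat_l; [exact Hr | exact S] |].
      apply phi_slope; [assumption | apply (Tk_bound x1) | lra | apply (Tk_bound x2)]; lra. }
    assert (0 <= w y ^ n * F y).
    { apply Rmult_le_pos; [apply pow_le, Rlt_le, w_pos; lra | apply Rlt_le, PF]. }
    apply (Rmult_le_compat_l (w y ^ n * F y)) in E; [lra | assumption].
Qed.

Lemma Int_ftc_open (f g : R -> R) :
  contI f -> contI g -> (forall x, -1 < x < 1 -> is_derive f x (g x)) ->
  Int g = f 1 - f (-1).
Proof.
  intros Hf Hg Hd.
  pose proof (Int_plus_incr (fun x => -1 * g x) f g ltac:(intros x Hx; cnt) Hf Hd ltac:(intros; lra)) as L.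
  pose proof (Int_plus_incr g (fun x => - f x) (fun x => - g x) Hg ltac:(intros x Hx; cnt)
    (fun x Hx => D_opp f x (g x) (Hd x Hx)) ltac:(intros; lra)) as U.
  rewrite Int_scal in L by assumption; lra.
Qed.

(* Expanding [w^(n+1) (G' + l e + (l - 2 (n+1)) g)^2] with [l = 4 n + 6], where [w^(n+1) e] is the
   primitive of [v] and [g = Int (x v) / mass (n+1)] makes [e + g] orthogonal to constants. *)
Lemma poincare_second (n : nat) (u : R -> R) :
  Ck (2 * n + 5) u -> Int (vfun n u) = 0 ->
  (4 * INR n + 6) * Int (fun x => w x ^ n * Gfun u x ^ 2)
    - (2 * INR n + 4) * (2 * INR n + 2) * (Int (fun x => x * vfun n u x) ^ 2 / mass (S n))
  <= Int (fun x => w x ^ S n * Derive (Gfun u) x ^ 2).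
Proof.
  intros Hu Hv0.
  pose proof (Ck_cont _ _ (Ck_v n u Hu)) as Cv.
  pose proof (Ck_G n u Hu) as HG; pose proof (Ck_cont _ _ HG) as CG.
  pose proof (Ck_is_derive _ 0 _ HG ltac:(lia)) as DG.
  change (forall x, is_derive (Gfun u) x (Derive (Gfun u) x)) in DG.
  pose proof (Ck_cont_n _ 1 _ HG ltac:(lia)) as CdG.
  assert (Cu : forall x, continuity_pt (Derive u) x) by (apply (Ck_cont_n _ 1 _ Hu); lia).
  destruct (weighted_primitive (S n) (Derive u) Cu Hv0) as [e [Ce [E1 [Em1 [He De]]]]].
  assert (DV : forall x, -1 < x < 1 -> is_derive (fun x => w x ^ S n * e x) x (vfun n u x)).
  { intros x Hx; pose proof (w_pos x Hx); evar_last.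
    - deriv.
    - unfold vfun; simpl; field; lra. }
  pose proof (mass_pos (S n)) as HW; set (W := mass (S n)) in *.
  set (A := Int (fun x => x * vfun n u x)).
  assert (IV : 1 * Int (fun x => w x ^ S n * e x) + 1 * A = 0).
  { unfold A; rewrite <- Int_lin by (intros x Hx; cntw).
    rewrite (Int_ftc_open (fun x => x * (w x ^ S n * e x))).
    - rewrite E1, Em1; ring.
    - intros x Hx; cntw.
    - intros x Hx; cntw.
    - intros x Hx; evar_last; [deriv |].
      unfold one; simpl; ring. }
  set (g := A / W).
  set (d := fun x => Gfun u x + 2 * INR (S n) * x * e x).
  assert (Cd : contI d) by (intros x Hx; unfold d; cntw).
  assert (De' : forall x, -1 < x < 1 -> is_derive e x (d x / w x)).
  { intros x Hx; pose proof (w_pos x Hx); evar_last; [now apply De |].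
    unfold d, Gfun; field; lra. }
  assert (P : (2 * INR n + 4) * Int (fun x => w x ^ S n * (e x + g) ^ 2) <= Int (fun x => w x ^ n * d x ^ 2)).
  (* e is only known to be continuous on the interval, whereas [poincare] asks for the line. *)
  { assert (Hcl : forall x, -1 <= x <= 1 -> e (clamp x) + g = e x + g) by (intros; now rewrite clamp_id).
    rewrite <- (Int_ext (fun x => w x ^ S n * (e (clamp x) + g) ^ 2)) by (intros; now rewrite Hcl).
    apply (poincare n (fun x => e (clamp x) + g)); [| exact Cd | |].
    - intros x; apply (cp_plus (fun x => e (clamp x)) (fun _ => g)); [| apply cp_const].
      apply (cp_comp clamp e); [apply cp_clamp | apply Ce, clamp_in].
    - intros x Hx; apply (is_derive_ext_loc (V := R_NormedModule) (fun x => e x + g)).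
      + apply locally_inside; [exact Hx | intros y Hy; symmetry; apply Hcl; lra].
      + evar_last; [deriv |].
        unfold zero; simpl; ring.
    - rewrite (Int_ext _ (fun x => 1 * (w x ^ S n * e x) + g * w x ^ S n))
        by (intros; rewrite clamp_id by assumption; ring).
      rewrite Int_lin by (intros x Hx; cntw).
      fold (mass (S n)) W; unfold g; replace (A / W * W) with A by (field; lra); lra. }
  rewrite (Int_ext (fun x => w x ^ S n * (e x + g) ^ 2)
    (fun x => 1 * (w x ^ S n * e x ^ 2) + 2 * g * (w x ^ S n * e x) + g ^ 2 * w x ^ S n)) in P by (intros; ring).
  rewrite Int_lin3 in P by (intros x Hx; cntw).
  fold (mass (S n)) W in P.
  assert (Ia : - (2 * INR (S n)) * Int (fun x => w x ^ S n * e x ^ 2)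
     + 1 * Int (fun x => w x ^ n * Gfun u x ^ 2) + -1 * Int (fun x => w x ^ n * d x ^ 2) = 0).
  { rewrite <- Int_lin3 by (intros x Hx; cntw).
    rewrite (Int_ftc_open (fun x => - (2 * INR (S n)) * (x * w x ^ S n * e x ^ 2))).
    - rewrite E1, Em1; ring.
    - intros x Hx; cntw.
    - intros x Hx; cntw.
    - intros x Hx; pose proof (w_pos x Hx); evar_last.
      + deriv.
      + unfold zero, one; simpl pred; change (INR 2) with 2.
        replace (Gfun u x) with (d x - 2 * INR (S n) * x * e x) by (unfold d; ring).
        generalize (INR (S n)); intros; simpl; field; lra. }
  assert (Ib : 1 * Int (fun x => w x ^ S n * (Derive (Gfun u) x * e x)) + 1 * Int (fun x => w x ^ n * Gfun u x ^ 2) = 0).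
  { rewrite <- Int_lin by (intros x Hx; cntw).
    rewrite (Int_ftc_open (fun x => w x ^ S n * e x * Gfun u x)).
    - rewrite E1, Em1; ring.
    - intros x Hx; cntw.
    - intros x Hx; cntw.
    - intros x Hx; evar_last; [deriv |].
      rewrite vfun_G; ring. }
  assert (Ic : 1 * Int (fun x => w x ^ S n * Derive (Gfun u) x) + - (2 * INR (S n)) * A = 0).
  { unfold A; rewrite <- Int_lin by (intros x Hx; cntw).
    rewrite (Int_ftc (fun x => w x ^ S n * Gfun u x)).
    - rewrite w_1, w_m1; simpl; ring.
    - intros x; evar_last; [deriv |].
      rewrite vfun_G; simpl pred; ring.
    - intros x Hx; cntw. }
  set (l := 4 * INR n + 6); set (mu := 2 * INR n + 4).
  assert (Sq : 0 <= Int (fun x => 1 * (w x ^ S n * Derive (Gfun u) x ^ 2)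
       + 2 * l * (w x ^ S n * (Derive (Gfun u) x * e x))
       + 2 * mu * g * (w x ^ S n * Derive (Gfun u) x)
       + 1 * (l ^ 2 * (w x ^ S n * e x ^ 2) + 2 * l * mu * g * (w x ^ S n * e x) + mu ^ 2 * g ^ 2 * w x ^ S n))).
  { apply Int_ge_0; [intros x Hx; cntw |].
    intros x Hx; pose proof (pow_le _ (S n) (Rlt_le _ _ (w_pos x Hx))) as Hw.
    replace (_ + _) with (w x ^ S n * (Derive (Gfun u) x + l * e x + mu * g) ^ 2) by ring.
    apply Rmult_le_pos; [exact Hw | apply pow2_ge_0]. }
  rewrite Int_lin4, Int_lin3 in Sq by (intros x Hx; cntw).
  fold (mass (S n)) W in Sq.
  assert (HA : A = g * W) by (unfold g; field; lra).
  assert (HA2 : A ^ 2 / W = g * g * W) by (unfold g; field; lra).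
  rewrite HA2, S_INR in *; rewrite HA in IV, Ic.
  set (J := Int (fun x => w x ^ S n * e x ^ 2)) in *.
  set (Ie := Int (fun x => w x ^ S n * e x)) in *.
  set (Jn := Int (fun x => w x ^ n * Gfun u x ^ 2)) in *.
  set (I1 := Int (fun x => w x ^ S n * Derive (Gfun u) x)) in *.
  set (I2 := Int (fun x => w x ^ S n * (Derive (Gfun u) x * e x))) in *.
  replace Ie with (- (g * W)) in * by lra.
  replace I1 with (2 * (INR n + 1) * (g * W)) in * by lra.
  replace I2 with (- Jn) in * by lra.
  pose proof (pos_INR n) as Hn.
  assert (PJ : l * J <= Jn + mu * (g * g * W)) by (unfold l, mu; lra).
  apply (Rmult_le_compat_l l) in PJ; [| unfold l; lra].
  assert (Hl : 2 * (INR n + 1) = l - mu) by (unfold l, mu; ring).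
  rewrite Hl in Sq.
  replace (2 * INR n + 2) with (l - mu) by (unfold l, mu; ring).
  lra.
Qed.

(** With A = int x v, the two identities give (al (2n+3) - 1) A (2n+1)! = al (n + 1/2) E0. As 2 al
    >= 1, the first factor is at least al (2n+1), and al cancels. *)
Lemma energy_harmonic (n : nat) (al : R) (u F : R -> R) :
  (1 <= n)%nat -> axial n al u F -> 1 / 2 <= al ->
  0 <= Int (fun x => x * vfun n u x) /\
  (2 * INR n + 1) * INR (fact (2 * n + 1)) * (2 * Int (fun x => x * vfun n u x)) <= E0 n u * (INR n + / 2) * 2.
Proof.
  intros Hn H Hal.
  pose proof (energy1 n al u F Hn H) as E1; pose proof (first_harmonic n al u F H) as E2.
  pose proof (dfct_nonneg n al u F Hn H Hal) as D.
  set (A := Int (fun x => x * vfun n u x)) in *; set (d := dfct n u F) in *.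
  pose proof (INR_fact_lt_0 (2 * n + 1)) as Hf; set (f := INR (fact (2 * n + 1))) in *.
  pose proof (pos_INR n) as Hi.
  assert (HA : 0 <= A).
  { destruct (Rle_dec 0 A) as [h | h]; [exact h | exfalso].
    assert (0 < al * (2 * INR n + 3) * - A) by (repeat apply Rmult_lt_0_compat; lra); lra. }
  split; [exact HA |].
  assert (E3 : (al * (2 * INR n + 3) - 1) * A * f = al * ((INR n + / 2) * E0 n u)).
  { apply (Rmult_eq_reg_r (/ f)); [| apply Rinv_neq_0_compat; lra].
    transitivity (al / f * ((INR n + / 2) * E0 n u)); [| field; lra].
    transitivity ((al * (2 * INR n + 3) - 1) * A); [field; lra | lra]. }
  apply (Rmult_le_reg_l al); [lra |].
  replace (al * (E0 n u * (INR n + / 2) * 2)) with ((al * (2 * INR n + 3) - 1) * (A * f) * 2)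
    by (transitivity (2 * (al * ((INR n + / 2) * E0 n u))); [rewrite <- E3; ring | ring]).
  assert (0 <= A * f) by (apply Rmult_le_pos; lra).
  nra.
Qed.

(** Bounds one factor of the defect A^2 / mass (n+1) by the mass; the other is bounded by E0 through
    [energy_harmonic]. *)
Lemma harmonic_bound (n : nat) (al : R) (u F : R -> R) :
  (1 <= n)%nat -> axial n al u F -> 1 / 2 <= al -> al <> 1 ->
  (INR n + 1) * (2 * INR n + 1) * (2 * INR n + 3) * Int (fun x => x * vfun n u x) <= 2 * mass n.
Proof.
  intros Hn H Hal Hal1.
  pose proof (first_harmonic n al u F H) as E2.
  pose proof (dfct_mom2 n al u F H) as E3; rewrite S_INR in E3.
  pose proof (mom2_bound n al u F Hn H Hal Hal1) as E4.
  destruct (energy_harmonic n al u F Hn H Hal) as [HA _].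
  set (A := Int (fun x => x * vfun n u x)) in *; set (d := dfct n u F) in *.
  pose proof (pos_INR n) as Hi; set (q := INR n) in *.
  assert (B : (2 * q + 3) * A <= 2 * d).
  { rewrite <- E2; assert (0 <= (2 * q + 3) * A) by (apply Rmult_le_pos; lra); nra. }
  assert (B2 : (q + 1) * (2 * q + 1) * d <= mass n).
  { assert ((2 * q + 3) * ((2 * q + 1) * mom2 n F) <= (2 * q + 3) * mass n) by (apply Rmult_le_compat_l; lra).
    assert (2 * (q + 1) * d * (2 * q + 1) = ((2 * q + 3) * mom2 n F - mass n) * (2 * q + 1)) by (rewrite E3; ring).
    lra. }
  assert ((q + 1) * (2 * q + 1) * ((2 * q + 3) * A) <= (q + 1) * (2 * q + 1) * (2 * d)).
  { apply Rmult_le_compat_l; [nra | exact B]. }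
  lra.
Qed.

(** Let J = int w G^2 and K = int w^2 G'^2, so that E0 = K + 2J. [energy2], the cubic bound and
    [lower_step] give 44 J >= 5 E0, while [poincare_second], its defect being at most E0 / 6, gives
    72 J <= 7 E0. Hence E0 = 0. *)
Lemma energy_zero_4 (al : R) (u F : R -> R) :
  axial 1 al u F -> 1 / 2 <= al -> al <> 1 -> E0 1 u = 0.
Proof.
  intros H Hal Hal1.
  pose proof (ax_u _ _ _ _ H) as Hu.
  destruct (center_of_mass _ al u F H Hal1) as [Hv _].
  pose proof (Ck_G 1 u Hu) as HG.
  pose proof (Ck_cont _ _ HG) as CG.
  pose proof (energy2 1 al u F ltac:(lia) H) as E2.
  pose proof (poincare_second 1 u Hu Hv) as EP.
  destruct (energy_harmonic 1 al u F ltac:(lia) H Hal) as [HA EA].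
  pose proof (harmonic_bound 1 al u F ltac:(lia) H Hal Hal1) as HB.
  pose proof (mass_S 1) as M1.
  set (G := Gfun u) in *; set (G1 := Derive_n G 1); set (G2 := Derive_n G 2); set (G3 := Derive_n G 3).
  pose proof (Ck_is_derive _ 0 _ HG ltac:(lia)) as D0.
  pose proof (Ck_is_derive _ 1 _ HG ltac:(lia)) as D1.
  pose proof (Ck_is_derive _ 2 _ HG ltac:(lia)) as D2.
  pose proof (Ck_cont_n _ 1 _ HG ltac:(lia)) as C1.
  change (forall x, is_derive G x (G1 x)) in D0; change (forall x, is_derive G1 x (G2 x)) in D1.
  change (forall x, is_derive G2 x (G3 x)) in D2.
  change (Derive G) with G1 in *.
  assert (Ev : vfun 1 u = fun x => w x * G x) by (apply functional_extensionality; intros; rewrite vfun_G; unfold G; ring).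
  assert (E3 : forall x, Derive_n (vfun 1 u) (2 * 1 + 1) x = w x * G3 x - 6 * x * G2 x - 6 * G1 x).
  { intros x; rewrite Ev, Derive_n_wmul by (apply (Ck_le _ 6); [lia | exact HG]); simpl INR; simpl pred.
    unfold G3, G2, G1; simpl; ring. }
  pose proof (Ck_cont_n _ (2 * 1 + 1) _ (Ck_v 1 u Hu) ltac:(lia)) as Cv.
  assert (G0e : forall a, w a = 0 -> G a = 0) by (intros a Ha; unfold G, Gfun; rewrite Ha; ring).
  (* The two integrands differ by the derivative of an expression that vanishes at the poles
     together with w and G. *)
  assert (Id : 1 * Int (fun x => Derive_n (vfun 1 u) (2 * 1 + 1) x * (w x * G x ^ 2))
               + -1 * Int (fun x => w x ^ 2 * G1 x ^ 3) = 0).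
  { rewrite <- Int_lin.
    - rewrite (Int_ftc (fun x => w x ^ 2 * G x ^ 2 * G2 x - 2 * x * w x * G x ^ 2 * G1 x
          - w x ^ 2 * G x * G1 x ^ 2 - 4 / 3 * G x ^ 3)).
      + rewrite w_1, w_m1, !G0e by (apply w_1 || apply w_m1); ring.
      + intros x; rewrite E3; evar_last; [deriv | simpl; unfold w; field].
      + intros x _; cntw.
    - intros x _; cntw.
    - intros x _; cntw. }
  assert (EG : EF 1 F (fun x => G x ^ 2)
    = Int (fun x => w x ^ 1 * G x ^ 2) + al / 6 * Int (fun x => w x ^ 2 * G1 x ^ 3)).
  { transitivity (Int (fun x => F x * (w x * G x ^ 2))); [apply Int_ext; intros; ring |].
    rewrite (EF_split 1 al u F) by (first [assumption | intros x _; cntw]).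
    f_equal; [apply Int_ext; intros; ring |].
    replace (coef 1 al) with (al / 6) by (unfold coef; simpl; field); f_equal; lra. }
  pose proof (lower_norm 0 G ltac:(apply (Ck_le _ 6); [lia | exact HG])) as LN.
  pose proof (lower_step 0 12 G ltac:(apply (Ck_le _ 6); [lia | exact HG])) as LS.
  change (Derive G) with G1 in LN.
  assert (Epsi : lower 0 G = psi 1 u).
  { apply functional_extensionality; intros x.
    change (psi 1 u x) with (Derive (vfun 1 u) x); rewrite Ev.
    symmetry; apply is_derive_unique; evar_last; [deriv |].
    unfold lower; change (Derive G x) with (G1 x); simpl; ring. }
  rewrite Epsi in LN, LS.
  replace (Int (fun x => w x ^ 0 * psi 1 u x ^ 2)) with (E0 1 u) in LN, LS
    by (apply Int_ext; intros; simpl; ring).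
  replace (Int (fun x => w x ^ 1 * Derive (psi 1 u) x ^ 2)) with (E1 1 u) in LS
    by (apply Int_ext; intros; rewrite pow_1; reflexivity).
  (* For n = 1 [dG_bound] has r = 1/2, and m <= W / 3 gives al G' <= 1. *)
  assert (Cub : al * Int (fun x => w x ^ 2 * G1 x ^ 3) <= Int (fun x => w x ^ 2 * G1 x ^ 2)).
  { rewrite <- Int_scal by (intros x _; cntw).
    apply Int_le; [intros x _; cntw | intros x _; cntw |].
    intros x Hx.
    pose proof (dG_bound 1 al u F x ltac:(lia) H Hal1 Hx) as B.
    pose proof (mom2_bound 1 al u F ltac:(lia) H Hal Hal1) as Bm.
    pose proof (mass_pos 1) as HW.
    change (Derive (Gfun u) x) with (G1 x) in B; simpl INR in B, Bm.
    assert (B1 : al * G1 x <= 1) by (apply (Rmult_le_reg_l (mass 1)); [exact HW | lra]).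
    replace (al * (w x ^ 2 * G1 x ^ 3)) with (w x ^ 2 * G1 x ^ 2 * (al * G1 x)) by ring.
    rewrite <- (Rmult_1_r (w x ^ 2 * G1 x ^ 2)) at 2.
    apply Rmult_le_compat_l; [apply Rmult_le_pos; apply pow2_ge_0 | exact B1]. }
  rewrite EG in E2.
  set (A := Int (fun x => x * vfun 1 u x)) in *.
  simpl INR in *.
  pose proof (mass_pos 1) as HW1; pose proof (mass_pos 2) as HW2.
  set (W1 := mass 1) in *; set (W2 := mass 2) in *; set (E := E0 1 u) in *; set (e1 := E1 1 u) in *.
  assert (Hq : 1 / 2 * (e1 + 4 * E) <= al * (e1 + 4 * E)).
  { apply Rmult_le_compat_r; [| exact Hal].
    assert (0 <= e1); [| lra].
    pose proof (cp_dpsi 1 u Hu).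
    apply Int_ge_0; [intros x _; cntw |]; intros x Hx.
    apply Rmult_le_pos; [apply Rlt_le, w_pos, Hx | apply pow2_ge_0]. }
  (* A <= W1 / 15 by [harmonic_bound], and 5 W2 = 4 W1. *)
  assert (HA2 : A ^ 2 / W2 <= A * (1 / 12)).
  { apply Rle_div_l; [exact HW2 |]. nra. }
  lra.
Qed.

Lemma energy_zero_6 (al : R) (u F : R -> R) :
  axial 2 al u F -> 1 / 2 <= al -> al <> 1 -> E0 2 u = 0.
Proof.
  intros H Hal Hal1.
  pose proof (ax_u _ _ _ _ H) as Hu.
  destruct (center_of_mass _ al u F H Hal1) as [Hv _].
  pose proof (Ck_G 2 u Hu) as HG.
  pose proof (Ck_cont _ _ HG) as CG.
  pose proof (energy2 2 al u F ltac:(lia) H) as E2.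
  pose proof (poincare_second 2 u Hu Hv) as EP.
  destruct (energy_harmonic 2 al u F ltac:(lia) H Hal) as [HA EA].
  pose proof (harmonic_bound 2 al u F ltac:(lia) H Hal Hal1) as HB.
  pose proof (mass_S 2) as M2.
  set (G := Gfun u) in *; set (G1 := Derive_n G 1); set (G2 := Derive_n G 2); set (G3 := Derive_n G 3).
  set (G4 := Derive_n G 4); set (G5 := Derive_n G 5).
  pose proof (Ck_is_derive _ 0 _ HG ltac:(lia)) as D0.
  pose proof (Ck_is_derive _ 1 _ HG ltac:(lia)) as D1.
  pose proof (Ck_is_derive _ 2 _ HG ltac:(lia)) as D2.
  pose proof (Ck_is_derive _ 3 _ HG ltac:(lia)) as D3.
  pose proof (Ck_is_derive _ 4 _ HG ltac:(lia)) as D4.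
  pose proof (Ck_cont_n _ 1 _ HG ltac:(lia)) as C1.
  pose proof (Ck_cont_n _ 2 _ HG ltac:(lia)) as C2.
  change (forall x, is_derive G x (G1 x)) in D0; change (forall x, is_derive G1 x (G2 x)) in D1.
  change (forall x, is_derive G2 x (G3 x)) in D2; change (forall x, is_derive G3 x (G4 x)) in D3.
  change (forall x, is_derive G4 x (G5 x)) in D4.
  change (Derive G) with G1 in *.
  assert (Ev : vfun 2 u = fun x => w x * (w x * G x)) by (apply functional_extensionality; intros; rewrite vfun_G; unfold G; ring).
  assert (HGk : forall k, (k <= 8)%nat -> Ck k G) by (intros k Hk; now apply (Ck_le k 8)).
  assert (E5 : forall x, Derive_n (vfun 2 u) (2 * 2 + 1) x
    = w x ^ 2 * G5 x - 20 * x * w x * G4 x - (40 - 120 * x ^ 2) * G3 x + 240 * x * G2 x + 120 * G1 x).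
  { intros x; rewrite Ev, Derive_n_wmul by (ckw; apply HGk; lia).
    rewrite !Derive_n_wmul by (apply HGk; simpl; lia); simpl INR; simpl pred.
    unfold G5, G4, G3, G2, G1; simpl; unfold w; ring. }
  assert (G0e : forall a, w a = 0 -> G a = 0) by (intros a Ha; unfold G, Gfun; rewrite Ha; ring).
  pose proof (Ck_cont_n _ (2 * 2 + 1) _ (Ck_v 2 u Hu) ltac:(lia)) as Cv.
  (* L is (w G')'. In terms of it the cubic integral is G' times the nonnegative 4 G'^2 + L^2, so
     that the upper bound on G' can be inserted. *)
  set (L := fun x => w x * G2 x - 2 * x * G1 x).
  assert (CL : forall x, continuity_pt L x) by (intros x; unfold L; cntw).
  assert (Id : 1 * Int (fun x => Derive_n (vfun 2 u) (2 * 2 + 1) x * (w x ^ 2 * G x ^ 2))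
               + 5 * Int (fun x => w x ^ 2 * (G1 x * (4 * G1 x ^ 2 + L x ^ 2))) = 0).
  { rewrite <- Int_lin by (intros x _; cntw).
    rewrite (Int_ftc (fun x => w x ^ 4 * G x ^ 2 * G4 x - 12 * x * w x ^ 3 * G x ^ 2 * G3 x
       - 2 * w x ^ 4 * G x * G1 x * G3 x - (28 - 36 * x ^ 2) * w x ^ 2 * G x ^ 2 * G2 x
       + 8 * x * w x ^ 3 * G x * G1 x * G2 x + 2 * w x ^ 4 * G1 x ^ 2 * G2 x
       + w x ^ 4 * G x * G2 x ^ 2 + (56 * x - 24 * x ^ 3) * w x * G x ^ 2 * G1 x
       - 4 * x * w x ^ 3 * G1 x ^ 3 + (24 - 8 * x ^ 2) * w x ^ 2 * G x * G1 x ^ 2 + 64 / 3 * G x ^ 3)).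
    - rewrite w_1, w_m1, !G0e by (apply w_1 || apply w_m1); ring.
    - intros x; rewrite E5; unfold L; evar_last; [deriv | simpl; unfold w; field].
    - intros x _; cntw. }
  assert (EG : EF 2 F (fun x => G x ^ 2)
    = Int (fun x => w x ^ 2 * G x ^ 2) + al / 24 * Int (fun x => w x ^ 2 * (G1 x * (4 * G1 x ^ 2 + L x ^ 2)))).
  { transitivity (Int (fun x => F x * (w x ^ 2 * G x ^ 2))); [apply Int_ext; intros; ring |].
    rewrite (EF_split 2 al u F) by (first [assumption | intros x _; cntw]).
    f_equal; replace (coef 2 al) with (- al / 120) by (unfold coef; simpl; field).
    match goal with |- _ * ?i = _ => match type of Id with _ + 5 * ?k = 0 => replace i with (- 5 * k) by lra end end.
    field. }
  set (e := lower 1 G).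
  assert (Ce2 : Ck 2 e) by (apply Ck_lower, HGk; lia).
  assert (De : forall x, is_derive e x (L x - 4 * G x - 4 * x * G1 x)).
  { intros x.
    apply (is_derive_ext (fun x => w x * G1 x - 4 * x * G x)).
    - intros t; unfold e, lower; change (Derive G t) with (G1 t); simpl; ring.
    - evar_last; [deriv | unfold L; ring]. }
  assert (Ede : Derive e = fun x => L x - 4 * G x - 4 * x * G1 x).
  { apply functional_extensionality; intros x; apply is_derive_unique, De. }
  assert (Epsi : lower 0 e = psi 2 u).
  { apply functional_extensionality; intros x.
    change (psi 2 u x) with (Derive (Derive (vfun 2 u)) x).
    replace (Derive (vfun 2 u)) with (fun x => w x * e x).
    - symmetry; apply is_derive_unique; evar_last; [deriv |].
      unfold lower; rewrite Ede; simpl; ring.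
    - apply functional_extensionality; intros y; rewrite Ev; symmetry; apply is_derive_unique.
      evar_last; [deriv | unfold e, lower; change (Derive G y) with (G1 y); simpl; ring]. }
  pose proof (lower_norm 1 G (HGk 1%nat ltac:(lia))) as LN1.
  pose proof (lower_norm 0 e (Ck_pred 1 e Ce2)) as LN0.
  (* Eigenvalues of degree 2 along the ladder: 4n + 6 = 14 on G, then 14 + 4 = 18 and 18 + 2 =
     20. *)
  pose proof (lower_step 0 20 e Ce2) as LS0.
  pose proof (lower_step 1 18 G (HGk 2%nat ltac:(lia))) as LS1.
  change (Derive G) with G1 in LN1; fold e in LN1, LS1; rewrite Epsi in LN0, LS0.
  rewrite Ede in LN0, LS1.
  replace (Int (fun x => w x ^ 0 * psi 2 u x ^ 2)) with (E0 2 u) in LN0, LS0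
    by (apply Int_ext; intros; simpl; ring).
  replace (Int (fun x => w x ^ 1 * Derive (psi 2 u) x ^ 2)) with (E1 2 u) in LS0
    by (apply Int_ext; intros; rewrite pow_1; reflexivity).
  set (Y := Int (fun x => w x ^ 2 * (4 * G1 x ^ 2 + L x ^ 2))).
  (* 11/15 = 1 - 2/3 (1 - 3/5), from r = 2/3 and m <= W / 5 in [dG_bound]. *)
  assert (Cub : al * Int (fun x => w x ^ 2 * (G1 x * (4 * G1 x ^ 2 + L x ^ 2))) <= 11 / 15 * Y).
  { unfold Y; rewrite <- !Int_scal by (intros x _; cntw).
    apply Int_le; [intros x _; cntw | intros x _; cntw |].
    intros x Hx.
    pose proof (dG_bound 2 al u F x ltac:(lia) H Hal1 Hx) as B.
    pose proof (mom2_bound 2 al u F ltac:(lia) H Hal Hal1) as Bm.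
    pose proof (mass_pos 2) as HW.
    change (Derive (Gfun u) x) with (G1 x) in B; simpl INR in B, Bm.
    assert (B1 : al * G1 x <= 11 / 15) by (apply (Rmult_le_reg_l (mass 2)); [exact HW | lra]).
    replace (al * (w x ^ 2 * (G1 x * (4 * G1 x ^ 2 + L x ^ 2))))
      with (al * G1 x * (w x ^ 2 * (4 * G1 x ^ 2 + L x ^ 2))) by ring.
    apply Rmult_le_compat_r; [| exact B1].
    apply Rmult_le_pos; [apply pow2_ge_0 |].
    pose proof (pow2_ge_0 (G1 x)); pose proof (pow2_ge_0 (L x)); lra. }
  (* The norm of e' = L - 4G - 4x G' is expanded up to an exact derivative, to compare it with Y. *)
  assert (EY : 1 * Int (fun x => w x ^ 2 * (L x - 4 * G x - 4 * x * G1 x) ^ 2)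
    + -1 * Int (fun x => w x ^ 2 * L x ^ 2) + -4 * Int (fun x => w x ^ 3 * G1 x ^ 2)
    + -1 * Int (fun x => 16 * (w x ^ 2 * G x ^ 2) + 8 * (w x ^ 2 * G1 x ^ 2)) = 0).
  { rewrite <- Int_lin4 by (intros x _; cntw).
    rewrite (Int_ftc (fun x => - 4 * x * w x ^ 3 * G1 x ^ 2 - 8 * w x ^ 3 * G x * G1 x)).
    - rewrite w_1, w_m1; ring.
    - intros x; unfold L; evar_last; [deriv | simpl; unfold w; ring].
    - intros x _; cntw. }
  rewrite Int_lin in EY by (intros x _; cntw).
  assert (Y1 : Y = 4 * Int (fun x => w x ^ 2 * G1 x ^ 2) + 1 * Int (fun x => w x ^ 2 * L x ^ 2)).
  { unfold Y; rewrite <- Int_lin by (intros x _; cntw); apply Int_ext; intros; ring. }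
  assert (W3 : Int (fun x => w x ^ 3 * G1 x ^ 2) <= Int (fun x => w x ^ 2 * G1 x ^ 2)).
  { apply Int_le; [intros x _; cntw | intros x _; cntw |].
    intros x Hx; apply Rmult_le_compat_r; [apply pow2_ge_0 |].
    assert (0 <= w x) by (apply w_nonneg; lra); assert (w x <= 1) by (unfold w; nra).
    rewrite <- (tech_pow_Rmult (w x) 2); pose proof (pow2_ge_0 (w x)); nra. }
  rewrite EG in E2.
  set (A := Int (fun x => x * vfun 2 u x)) in *.
  simpl INR in *.
  pose proof (mass_pos 2) as HW2; pose proof (mass_pos 3) as HW3.
  set (W2 := mass 2) in *; set (M3 := mass 3) in *; set (E := E0 2 u) in *; set (e1 := E1 2 u) in *.
  assert (Hq : 1 / 2 * (e1 + 9 * E) <= al * (e1 + 9 * E)).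
  { apply Rmult_le_compat_r; [| exact Hal].
    assert (0 <= e1); [| lra].
    pose proof (cp_dpsi 2 u Hu).
    apply Int_ge_0; [intros x _; cntw |]; intros x Hx.
    apply Rmult_le_pos; [apply Rlt_le, w_pos, Hx | apply pow2_ge_0]. }
  (* One factor A is at most 2 W2 / 105 = M3 / 45, because 7 M3 = 6 W2; the other is at most E /
     240. *)
  assert (HA2 : 48 * (A ^ 2 / M3) <= 8 / 1800 * E).
  { assert (A ^ 2 / M3 <= A * (1 / 45)); [| lra].
    apply Rle_div_l; [exact HW3 |]; nra. }
  lra.
Qed.

(** * Smooth extension to the line *)

Lemma const_of_deriv_zero (f : R -> R) (a b : R) :
  a <= b -> (forall x, a < x < b -> is_derive f x 0) ->
  (forall x, a <= x <= b -> continuity_pt f x) -> f a = f b.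
Proof.
  intros Hab Hd Hc; apply Rle_antisym.
  - apply (le_of_deriv_nonneg_open f (fun _ => 0)); (assumption || intros; lra).
  - apply Ropp_le_cancel.
    apply (le_of_deriv_nonneg_open (fun x => - f x) (fun _ => 0)); try (assumption || intros; lra).
    + intros x Hx; evar_last; [apply D_opp, Hd, Hx | ring].
    + intros x Hx; now apply cp_opp, Hc.
Qed.

Lemma zero_of_deriv_zero (f df : R -> R) :
  f (-1) = 0 -> (forall x, is_derive f x (df x)) -> (forall x, -1 < x < 1 -> df x = 0) ->
  forall x, -1 <= x <= 1 -> f x = 0.
Proof.
  intros H0 Hd Hz x Hx; rewrite <- H0; symmetry.
  apply const_of_deriv_zero; [lra | |].
  - intros y Hy; rewrite <- (Hz y ltac:(lra)); apply Hd.
  - intros y _; eapply cp_derive, Hd.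
Qed.

(** psi = v^(n) vanishes, and the lower derivatives of v are 0 at -1, so they vanish one after
    another down to v; inside the interval v = 0 means u' = 0. *)
Lemma constant_of_energy_zero (n : nat) (u : R -> R) :
  Ck (2 * n + 5) u -> E0 n u = 0 -> forall x, -1 <= x <= 1 -> u x = u (-1).
Proof.
  intros Hu HE.
  pose proof (cp_psi n u Hu) as Cp; pose proof (Ck_v n u Hu) as Hv.
  assert (Hpsi : forall x, -1 < x < 1 -> psi n u x = 0).
  { intros x Hx.
    pose proof (Int_zero (fun x => psi n u x ^ 2) ltac:(intros y _; cnt) ltac:(intros; apply pow2_ge_0) HE x Hx) as Z.
    cbv beta in Z; nra. }
  assert (Hk : forall k, (k <= n)%nat -> forall x, -1 < x < 1 -> Derive_n (vfun n u) (n - k) x = 0).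
  { induction k as [|k IH]; intros Hk x Hx; [rewrite Nat.sub_0_r; now apply Hpsi |].
    apply (zero_of_deriv_zero _ (Derive_n (vfun n u) (n - k))); [| | now apply IH; lia | lra].
    - apply v_vanish; (assumption || lia || apply w_m1).
    - replace (n - k)%nat with (S (n - S k)) by lia.
      apply (Ck_is_derive (2 * n + 4)); [assumption | lia]. }
  assert (Hd : forall x, -1 < x < 1 -> Derive u x = 0).
  { intros x Hx; specialize (Hk n ltac:(lia) x Hx); rewrite Nat.sub_diag in Hk; simpl in Hk.
    unfold vfun in Hk; apply Rmult_integral in Hk; destruct Hk as [Hk | Hk]; [| assumption].
    pose proof (pow_lt _ (S n) (w_pos x Hx)); lra. }
  pose proof (Ck_is_derive _ 0 _ Hu ltac:(lia)) as Du.
  intros x Hx; symmetry; apply const_of_deriv_zero; [lra | |].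
  - intros y Hy; rewrite <- (Hd y ltac:(lra)); apply Du.
  - intros y _; eapply cp_derive, Du.
Qed.

Lemma axial_constant (n : nat) (al : R) (u F : R -> R) :
  (1 <= n)%nat -> axial n al u F -> 1 / 2 <= al -> al <> 1 ->
  forall x, -1 <= x <= 1 -> u x = u (-1).
Proof.
  intros Hn H Hal Hal1; apply (constant_of_energy_zero n); [apply (ax_u _ _ _ _ H) |].
  destruct n as [| [| [| p]]]; [lia | | |].
  - now apply (energy_zero_4 al u F).
  - now apply (energy_zero_6 al u F).
  - apply (energy_zero_large (S (S p)) al u F); (assumption || lia).
Qed.

Lemma cp_on_clamp (u : R -> R) :
  continuous_on (fun x => -1 <= x <= 1) u -> forall x, continuity_pt (fun x => u (clamp x)) x.
Proof.
  intros Hu x; apply continuity_pt_filterlim.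
  apply (filterlim_comp _ _ _ clamp u (locally x) (within (fun x => -1 <= x <= 1) (locally (clamp x)))).
  - intros P HP; pose proof (cp_clamp x) as Hc; apply continuity_pt_filterlim in Hc.
    specialize (Hc _ HP); unfold filtermap in *; revert Hc; apply filter_imp.
    intros y Hy; apply Hy, clamp_in.
  - apply Hu, clamp_in.
Qed.

(** The boundary extension of u' inherits the hypothesis with all orders shifted by one, which makes
    induction on the order of smoothness possible. *)
Lemma smooth_deriv (u : R -> R) :
  smooth_on_closed (-1) 1 u ->
  exists g, smooth_on_closed (-1) 1 g /\ forall x, -1 < x < 1 -> is_derive u x (g x).
Proof.
  intros [Hu Hs].
  destruct (Hs 1%nat) as [H1 [g [Hg Eg]]]; exists g.
  assert (E : forall n x, -1 < x < 1 -> Derive_n g n x = Derive_n u (S n) x).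
  { intros n x Hx; rewrite <- (Derive_n_S_comm u n); apply Derive_n_ext_loc.
    apply locally_inside; [exact Hx | exact Eg]. }
  split; [split; [exact Hg |] |].
  - intros n; split.
    + intros x Hx; destruct n as [|n]; [exact I |].
      apply (ex_derive_ext_loc (Derive_n u (S n))).
      * apply locally_inside; [exact Hx | intros y Hy; symmetry; now apply E].
      * destruct (Hs (S (S n))) as [H2 _]; exact (H2 x Hx).
    + destruct (Hs (S n)) as [_ [h [Ch Eh]]]; exists h; split; [exact Ch |].
      intros x Hx; rewrite E by assumption; now apply Eh.
  - intros x Hx; rewrite Eg by assumption; apply Derive_correct, (H1 x Hx).
Qed.

(** The derivative is extended first and then integrated from the interior point 0; the base case
    extends by constants. Agreement with u follows from equal derivatives inside and continuity at
    the poles. *)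
Lemma smooth_extension (k : nat) : forall u,
  smooth_on_closed (-1) 1 u -> exists U, Ck k U /\ forall x, -1 <= x <= 1 -> U x = u x.
Proof.
  induction k as [|k IH]; intros u Hu.
  - exists (fun x => u (clamp x)); split; [exact (cp_on_clamp u (proj1 Hu)) |].
    intros x Hx; now rewrite clamp_id.
  - destruct (smooth_deriv u Hu) as [g [Hg Dg]]; destruct (IH g Hg) as [V [HV EV]].
    pose proof (Ck_cont _ _ HV) as CV.
    set (U := fun x => u 0 + RI V 0 x).
    assert (DU : forall x, is_derive U x (V x)).
    { intros x; evar_last; [apply (D_plus (fun _ => u 0)); [apply D_const | apply derive_RI; exact CV] | simpl; ring]. }
    exists U; split.
    + split; [intros x; eexists; apply DU |].
      replace (Derive U) with V; [exact HV |].
      apply functional_extensionality; intros x; symmetry; apply is_derive_unique, DU.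
    + set (f := fun x => U x - u (clamp x)).
      assert (Cf : forall x, continuity_pt f x).
      { intros x; apply cp_minus; [eapply cp_derive, DU | apply (cp_on_clamp u (proj1 Hu))]. }
      assert (Df : forall x, -1 < x < 1 -> is_derive f x 0).
      { intros x Hx; evar_last.
        - apply (D_minus U (fun x => u (clamp x))); [apply DU |].
          apply (is_derive_ext_loc (V := R_NormedModule) u); [| now apply Dg].
          apply locally_inside; [exact Hx | intros y Hy; rewrite clamp_id; lra].
        - rewrite EV by lra; ring. }
      assert (f0 : f 0 = 0) by (unfold f, U; rewrite RI_point, clamp_id by lra; ring).
      intros x Hx; enough (Z : f x = 0) by (unfold f in Z; rewrite clamp_id in Z by assumption; lra).
      rewrite <- f0; destruct (Rle_dec 0 x).
      * symmetry; apply const_of_deriv_zero; [lra | | auto]; intros y Hy; apply Df; lra.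
      * apply const_of_deriv_zero; [lra | | auto]; intros y Hy; apply Df; lra.
Qed.

Lemma eq_closed (f g : R -> R) :
  (forall x, continuity_pt f x) -> (forall x, continuity_pt g x) ->
  (forall x, -1 < x < 1 -> f x = g x) -> forall x, -1 <= x <= 1 -> f x = g x.
Proof.
  intros Hf Hg H.
  set (h := fun x => f x - g x).
  assert (Ch : forall x, continuity_pt h x) by (intros x; now apply cp_minus).
  assert (Dh : forall x, -1 < x < 1 -> is_derive h x 0).
  { intros x Hx; apply (is_derive_ext_loc (V := R_NormedModule) (fun _ => 0)); [| apply D_const].
    apply locally_inside; [exact Hx | intros y Hy; unfold h; symmetry; apply Rminus_diag_eq, H, Hy]. }
  assert (h0 : h 0 = 0) by (unfold h; rewrite H by lra; ring).
  intros x Hx; enough (h x = 0) by (unfold h in *; lra).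
  rewrite <- h0; destruct (Rle_dec 0 x).
  - symmetry; apply const_of_deriv_zero; [lra | | auto]; intros y Hy; apply Dh; lra.
  - apply const_of_deriv_zero; [lra | | auto]; intros y Hy; apply Dh; lra.
Qed.

Lemma axial_of_ode (n : nat) (al c : R) (u : R -> R) :
  Ck (2 * n + 5) u ->
  (forall x, -1 < x < 1 ->
    c * exp (2 * INR (S n) * u x) = 1 + coef n al * Derive_n (vfun n u) (2 * n + 1) x) ->
  axial n al u (fun x => c * exp (2 * INR (S n) * u x)).
Proof.
  intros Hu Heq.
  pose proof (Ck_is_derive _ 0 _ Hu ltac:(lia)) as Du.
  change (forall x, is_derive u x (Derive u x)) in Du.
  pose proof (Ck_cont_n _ (2 * n + 1) _ (Ck_v n u Hu) ltac:(lia)) as Cv.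
  set (e := fun x => exp (2 * INR (S n) * u x)).
  assert (De : forall x, is_derive e x (2 * INR (S n) * Derive u x * e x)).
  { intros x; unfold e; generalize (2 * INR (S n)); intros a.
    evar_last.
    - apply (is_derive_comp exp (fun x => a * u x)); [apply is_derive_exp |].
      apply (D_mult (fun _ => a)); [apply D_const | apply Du].
    - unfold scal; simpl; unfold mult; simpl; ring. }
  assert (Ce : forall x, continuity_pt e x) by (intros x; eapply cp_derive, De).
  pose proof (eq_closed (fun x => c * e x) (fun x => 1 + coef n al * Derive_n (vfun n u) (2 * n + 1) x)
    ltac:(intros; cnt) ltac:(intros; cnt) Heq) as Eq.
  (* Integrating the equation against w^n removes the derivative term, since w^n has degree 2n; what
     remains is c int w^n e = int w^n > 0. *)
  assert (Hc : 0 < c).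
  { assert (E : c * Int (fun x => w x ^ n * e x) = mass n).
    { rewrite <- Int_scal by (intros x _; cntw).
      rewrite (Int_ext _ (fun x => 1 * w x ^ n + coef n al * (Derive_n (vfun n u) (2 * n + 1) x * (w x ^ n * 1)))).
      - rewrite Int_lin, (Int_v_test n u (fun _ => 1)) by
          (first [assumption | apply Ck_const | intros x _; cntw]).
        rewrite (Int_ext (fun x => vfun n u x * _) (fun _ => 0)).
        + rewrite Int_const; unfold mass; ring.
        + intros x _; replace (fun y => w y ^ n * 1) with (fun y => w y ^ n)
            by (apply functional_extensionality; intros; ring).
          rewrite Derive_n_wpow_over; ring.
      - intros x Hx; specialize (Eq x Hx); cbv beta in Eq.
        transitivity (w x ^ n * (c * e x)); [ring | rewrite Eq; ring]. }
    assert (P : 0 < Int (fun x => w x ^ n * e x)).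
    { apply Int_gt_0; [intros x _; cntw |]; intros x Hx.
      apply Rmult_lt_0_compat; [apply pow_lt, w_pos, Hx | apply exp_pos]. }
    pose proof (mass_pos n) as HW; rewrite <- E in HW.
    apply (Rmult_lt_reg_r _ _ _ P); lra. }
  split.
  - exact Hu.
  - intros x; evar_last; [apply (D_mult (fun _ => c)); [apply D_const | apply De] |].
    unfold e; ring.
  - intros x; apply Rmult_lt_0_compat; [exact Hc | apply exp_pos].
  - exact Eq.
Qed.

Theorem theorem1p1 (N : nat) (alpha : R) (u : R -> R)
  (hN : (4 <= N)%nat) (hNeven : Nat.Even N)
  (halpha : 1 / 2 <= alpha) (halpha1 : alpha <> 1)
  (hu : axial_solution N alpha u) :
  exists c : R, forall x : R, -1 <= x <= 1 -> u x = c.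
Proof.
  destruct hu as [Hs Heq].
  destruct hNeven as [m Hm].
  destruct m as [|n]; [lia |].
  assert (Hn : (1 <= n)%nat) by lia.
  destruct (smooth_extension (2 * n + 5) u Hs) as [U [HU EU]].
  assert (Hloc : forall x, -1 < x < 1 -> locally x (fun y => U y = u y)).
  { intros x Hx; apply locally_inside; [exact Hx | intros y Hy; apply EU; lra]. }
  (* The normalising factor is kept as one number, whose sign [axial_of_ode] reads off from the
     equation. *)
  set (k := sqrt PI * Gamma (INR N / 2) / (Gamma ((INR N + 1) / 2) * gamma_mass N u)).
  assert (HA : axial n alpha U (fun x => k * exp (2 * INR (S n) * U x))).
  { apply axial_of_ode; [exact HU |].
    intros x Hx; specialize (Heq x Hx); unfold axial_Q_equation in Heq.
    replace (N / 2)%nat with (S n) in Heq by (rewrite Hm, Nat.mul_comm, Nat.div_mul; lia).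
    replace (N - 1)%nat with (2 * n + 1)%nat in Heq by lia.
    replace (Derive_n (fun y => (1 - y ^ 2) ^ S n * Derive u y) (2 * n + 1) x)
      with (Derive_n (vfun n U) (2 * n + 1) x) in Heq.
    2:{ apply Derive_n_ext_loc, locally_inside; [exact Hx |].
        intros y Hy; unfold vfun, w; f_equal; apply Derive_ext_loc, Hloc, Hy. }
    replace (INR (fact (2 * n + 1)) * sqrt PI * Gamma (INR N / 2) / (Gamma ((INR N + 1) / 2) * gamma_mass N u))
      with (INR (fact (2 * n + 1)) * k) in Heq by (unfold k, Rdiv; ring).
    replace (INR N * u x) with (2 * INR (S n) * U x) in Heq
      by (rewrite EU, Hm, mult_INR by lra; reflexivity).
    pose proof (INR_fact_neq_0 (2 * n + 1)).
    unfold coef; apply (Rmult_eq_reg_l (INR (fact (2 * n + 1)))); [| assumption].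
    transitivity (INR (fact (2 * n + 1)) + alpha * (-1) ^ S n * Derive_n (vfun n U) (2 * n + 1) x); [lra | field; assumption]. }
  exists (U (-1)); intros x Hx; rewrite <- EU by assumption.
  now apply (axial_constant n alpha U _ Hn HA).
Qed.
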